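(* Let $A$ be a semilocal Noether algebra with Jacobson radical $J$. Then $$\operatorname{Gproj\,dim}_A(J)=\operatorname{Gproj\,dim}_{A^{\mathrm{op}}}(J).$$
   Context: A Noether algebra is an algebra $A$ over a commutative noetherian ring $R$ (with the image of $R$ central in $A$) that is finitely generated as an $R$-module; it is a semilocal Noether algebra if $R$ can be chosen semilocal, i.e. with finitely many maximal ideals. Modules are left modules; modules over the opposite ring $A^{\mathrm{op}}$ are right $A$-modules. An $A$-module $G$ is Gorenstein projective if it is a cokernel of a differential in an exact (two-sided unbounded) complex $P$ of projective $A$-modules such that $\operatorname{Hom}_A(P,Q)$ is exact for every projective $A$-module $Q$. $\operatorname{Gproj\,dim}_A M$ is the least $n\ge 0$ for which there is an exact sequence $0\to G_n\to\cdots\to G_0\to M\to 0$ with all $G_i$ Gorenstein projective, and $\infty$ if there is none. *)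

(* Defs.v *)
From HB Require Import structures.
From mathcomp Require Export all_boot all_order all_algebra.
From mathcomp Require Export boolp classical_sets cardinality.

Set Implicit Arguments.
Unset Strict Implicit.
Unset Printing Implicit Defensive.

Import GRing.Theory.

Local Open Scope ring_scope.

(* Modules over a ring A are the library's left modules, lmodType A; right
   A-modules are left modules over the converse ring A^c.  Rings are unital and
   possibly zero (pzRingType).  Submodules of V are predicates I : {pred V} with
   submod_closed I; left ideals of A are submodules of the regular module A^o. *)

Section Submodules.
Context (A : pzRingType) (V : lmodType A).
Implicit Types I K : {pred V}.

Definition fg_submod I : Prop :=
  exists (n : nat) (v : 'I_n -> V), forall x : V,
    x \in I <-> exists c : 'I_n -> A, x = \sum_(i < n) c i *: v i.

Definition maximal_submod I : Prop :=
  [/\ submod_closed I,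
      exists x : V, x \notin I
    & forall K, submod_closed K -> {subset I <= K} ->
        (exists x : V, x \notin K) -> {subset K <= I}].

End Submodules.

Section SubmoduleType.
Context (A : pzRingType) (V : lmodType A) (S : submodClosed V).

Definition submod_type : Type := {x : V | x \in S}.

HB.instance Definition _ := SubChoice.on submod_type.
HB.instance Definition _ := [SubChoice_isSubLmodule of submod_type by <:].

End SubmoduleType.

Definition noetherian (R : comPzRingType) : Prop :=
  forall I : {pred R^o}, submod_closed I -> fg_submod I.

Definition semilocal (R : comPzRingType) : Prop :=
  finite_set [set I : {pred R^o} | maximal_submod I].

(* The R-module structure of A is r . a = phi r * a.  The library's algType is
   not used because it excludes the zero ring. *)
Definition noether_algebra_over (R : comPzRingType) (A : pzRingType)
    (phi : {rmorphism R -> A}) : Prop :=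
  [/\ noetherian R,
      forall (r : R) (a : A), phi r * a = a * phi r
    & exists (n : nat) (v : 'I_n -> A), forall a : A,
        exists c : 'I_n -> R, a = \sum_(i < n) phi (c i) * v i].

Definition semilocal_noether_algebra (A : pzRingType) : Prop :=
  exists (R : comPzRingType) (phi : {rmorphism R -> A}),
    noether_algebra_over phi /\ semilocal R.

Section JacobsonRadical.
Context (A : pzRingType).

Definition jacobson : {pred A^o} := fun x =>
  `[< forall I : {pred A^o}, maximal_submod I -> x \in I >].

Lemma jacobsonP (x : A) :
  reflect (forall I : {pred A^o}, maximal_submod I -> x \in I) (x \in jacobson).
Proof. exact: asboolP. Qed.

Lemma jacobson_submod_closed : submod_closed jacobson.
Proof.
split=> [|a x y /jacobsonP Jx /jacobsonP Jy]; apply/jacobsonP => I mI.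
  by case: mI => -[].
by have [[_ linI] _ _] := mI; apply: linI; [apply: Jx | apply: Jy].
Qed.

Lemma submod_closed_residual (I : {pred A^o}) (a : A) :
  submod_closed I -> submod_closed ([pred y : A^o | (y : A) * a \in I]).
Proof.
move=> [I0 linI]; split=> [|b x y]; rewrite !inE ?mul0r // => Ix Iy.
rewrite mulrDl; have := linI b _ _ Ix Iy.
by rewrite -[b *: (_ : A^o)]/(b * _) mulrA.
Qed.

Lemma maximal_residual (I : {pred A^o}) (a : A) :
  maximal_submod I -> a \notin I ->
  maximal_submod ([pred y : A^o | (y : A) * a \in I]).
Proof.
move=> [sI _ maxI] aNI; split; first exact: submod_closed_residual.
  by exists 1; rewrite inE mul1r.
have [I0 linI] := sI => K [K0 linK] subK [z zNK] k Kk; rewrite inE.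
apply: contrapT => /negP kaNI.
pose L : {pred A^o} := fun y : A^o =>
  `[< exists2 i : A^o, i \in I & exists b : A, y = i + b * (k * a) >].
have LP (y : A^o) : reflect
    (exists2 i : A^o, i \in I & exists b : A, y = i + b * (k * a)) (y \in L).
  exact: asboolP.
have sL : submod_closed L.
  split=> [|c x y /LP[i Ii [b ->]] /LP[j Ij [b' ->]]]; apply/LP.
    by exists 0 => //; exists 0; rewrite mul0r addr0.
  exists (c *: i + j); first exact: linI.
  exists (c * b + b'); rewrite scalerDr addrACA mulrDl -mulrA.
  by [].
have subIL : {subset I <= L}.
  by move=> i Ii; apply/LP; exists i => //; exists 0; rewrite mul0r addr0.
have Lka : (k * a : A^o) \in L.
  by apply/LP; exists 0 => //; exists 1; rewrite mul1r add0r.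
have aL : (a : A^o) \in L.
  apply: contrapT => /negP aNL; case/negP: kaNI.
  by apply: (maxI L sL subIL) Lka; exists a.
have /LP[i Ii [b Ea]] := aL.
have K1 : (1 : A^o) \in K.
  have -> : (1 : A^o) = b *: k + (1 - b * k).
    by rewrite -[b *: k]/(b * k) addrC subrK.
  apply: linK => //; apply: subK; rewrite inE mulrBl mul1r {1}Ea -mulrA.
  by rewrite addrK.
case/negP: zNK.
have -> : z = z *: (1 : A^o) + 0 by rewrite addr0 -[_ *: _]/(z * 1) mulr1.
exact: linK.
Qed.

Lemma jacobson_mulr (x a : A) :
  (x : A^o) \in jacobson -> (x * a : A^o) \in jacobson.
Proof.
move=> /jacobsonP Jx; apply/jacobsonP => I mI.
have [[I0 linI] _ _] := mI.
have [aI|aNI] := boolP ((a : A^o) \in I).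
  by rewrite -[_ * _]addr0; apply: linI.
by have := Jx _ (maximal_residual mI aNI); rewrite inE.
Qed.

(* The same subset of A, as a submodule of the right regular module. *)
Definition jacobson_op : {pred A^c^o} := fun x => (x : A^o) \in jacobson.

Lemma jacobson_op_submod_closed : submod_closed jacobson_op.
Proof.
have [J0 linJ] := jacobson_submod_closed.
split=> [|a x y Jx Jy]; first exact: J0.
have Jxa : ((x : A) * a : A^o) \in jacobson by apply: jacobson_mulr.
by have := linJ 1 _ _ Jxa Jy; rewrite scale1r.
Qed.

HB.instance Definition _ :=
  GRing.isSubmodClosed.Build A A^o jacobson jacobson_submod_closed.
HB.instance Definition _ :=
  GRing.isSubmodClosed.Build A^c A^c^o jacobson_op jacobson_op_submod_closed.

Definition jacobson_left : lmodType A := submod_type jacobson.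
Definition jacobson_right : lmodType A^c := submod_type jacobson_op.

End JacobsonRadical.

Section GorensteinProjective.
Context (A : pzRingType).
Implicit Types M N P Q G : lmodType A.

Definition exact_at M N P (f : {linear M -> N}) (g : {linear N -> P}) : Prop :=
  forall y : N, g y = 0 <-> exists x : M, f x = y.

Definition surj M N (f : {linear M -> N}) : Prop :=
  forall y : N, exists x : M, f x = y.

Definition is_cokernel M N P (f : {linear M -> N}) (p : {linear N -> P}) : Prop :=
  exact_at f p /\ surj p.

Definition projective P : Prop :=
  forall M N (g : {linear M -> N}) (f : {linear P -> N}), surj g ->
    exists h : {linear P -> M}, forall x : P, g (h x) = f x.

Definition exact_complex (P : int -> lmodType A)
    (d : forall i : int, {linear P (i + 1) -> P i}) : Prop :=
  forall i : int, exact_at (d (i + 1)) (d i).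

(* Exactness of Hom(P, Q), whose maps are f |-> f \o d i. *)
Definition Hom_exact (P : int -> lmodType A)
    (d : forall i : int, {linear P (i + 1) -> P i}) Q : Prop :=
  forall (i : int) (f : {linear P (i + 1) -> Q}),
    (forall y, f (d (i + 1) y) = 0) <->
    (exists g : {linear P i -> Q}, forall x, g (d i x) = f x).

Definition Gorenstein_projective G : Prop :=
  exists (P : int -> lmodType A) (d : forall i : int, {linear P (i + 1) -> P i}),
    [/\ forall i, projective (P i),
        exact_complex d,
        forall Q, projective Q -> Hom_exact d Q
      & exists (i : int) (p : {linear P i -> G}), is_cokernel (d i) p].

(* An exact sequence 0 -> G n -> ... -> G 0 -> M -> 0, extended to the left by
   zero modules. *)
Definition Gproj_resolution M (n : nat) : Prop :=
  exists (G : nat -> lmodType A) (d : forall i : nat, {linear G i.+1 -> G i})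
         (e : {linear G 0%N -> M}),
    [/\ forall i, (i <= n)%N -> Gorenstein_projective (G i),
        forall i, (n < i)%N -> forall x : G i, x = 0,
        forall i, exact_at (d i.+1) (d i)
      & is_cokernel (d 0%N) e].

Lemma Gproj_resolution_ex M : (exists n, Gproj_resolution M n) ->
  exists n, `[< Gproj_resolution M n >].
Proof. by case=> n Mn; exists n; apply/asboolP. Qed.

(* None stands for infinity. *)
Definition Gproj_dim M : option nat :=
  match pselect (exists n, Gproj_resolution M n) with
  | left exM => Some (ex_minn (Gproj_resolution_ex exM))
  | right _ => None
  end.

End GorensteinProjective.

(* Main.v *)
(* Suppose that Gpd_A(J) <= n and put m = n + 1.  An Auslander-Buchweitz
   approximation 0 -> Y -> X -> A/J -> 0, with pd Y < m and X embedded in a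
   projective module, can be spread along composition series: every left module
   of finite length embeds in a module W with pd W <= m.

   Let P be a resolution of the right module A/J by finite free modules, P' its
   dual, and e a cocycle of P'_q with q > m.  If e is not a coboundary, it
   survives in some quotient of finite length of coker(P'_{q-1} -> P'_q);
   embed this quotient in W as above.  The resulting map P'_q -> W is a cycle of
   P_q (x) W, and Tor_q(A/J, W) = 0, so it factors through P'_{q+1} and kills e,
   a contradiction.  Hence Ext^q_{A^op}(A/J, A) = 0 for q > m.

   On the left, Ext^j_A(A/J, A) = 0 for j > m, and Bass's argument (Noetherian
   induction and Nakayama's lemma) extends this to all finitely generated
   modules.  Resolving the left module ker(P'_m -> P'_{m+1}) therefore gives a
   complex of finite free modules that is exact together with its dual, so the
   n-th syzygy of the right module J is Gorenstein projective. *)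

From HB Require Import structures.
From mathcomp Require Import all_boot all_order all_algebra generic_quotient ring_quotient.
From mathcomp Require Import boolp classical_sets functions cardinality.
Require Import Defs.

Set Implicit Arguments.
Unset Strict Implicit.
Unset Printing Implicit Defensive.

Import GRing.Theory.

Local Open Scope classical_set_scope.
Local Open Scope ring_scope.
Local Open Scope quotient_scope.

(** * Linear maps, submodules and quotients *)

(** The constant m comes from 0 -> J -> A -> A/J -> 0, which turns a resolution of J of length n
    into an approximation of A/J with pd Y <= n. Each simple module is a direct summand of A/J, but
    extensions of simple modules need not split. The approximation overcomes this: Ext^1(X, W) = 0
    for every W of finite projective dimension, so an embedding of a submodule into W extends after
    pulling back along X -> A/J. Dividing W x Q by Y, where Q is projective and contains X, then
    keeps pd at most m.

    Semilocality of R gives finite length to finitely generated modules on which every element of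
    rad(R) is locally nilpotent.

    Gorenstein projectives are awkward to glue, being defined by two-sided complexes. The
    approximation needs only their right half, a coresolution with Ext^1 vanishing, which is closed
    under extensions. Two-sided complexes are built only at the end, from matrices, where dualizing
    is transposition. One inequality is proved for a ring and an anti-isomorphic one, and is applied
    in both directions. *)

Section LinearTools.
Context (A : pzRingType).
Implicit Types (M N L : lmodType A).

Lemma linear_ex M N (f : M -> N) : linear f ->
  exists g : {linear M -> N}, forall x, g x = f x.
Proof.
move=> lf; pose h := GRing.isLinear.Build A M N *:%R f lf.
pose g : {linear M -> N} := HB.pack f h.
by exists g.
Qed.

(** By subtraction, a relation closed under linear combinations is single-valued as soon as it is so
    over 0. Maps defined through chosen preimages are built this way, with one check over 0 as their
    well-definedness. *)
Lemma linear_of_rel M N (r : M -> N -> Prop) :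
  (forall x, exists y, r x y) ->
  (forall a x x' y y', r x y -> r x' y' -> r (a *: x + x') (a *: y + y')) ->
  (forall y, r 0 y -> y = 0) ->
  exists f : {linear M -> N}, forall x y, r x y <-> f x = y.
Proof.
move=> tot lin func.
have uniq x y y' : r x y -> r x y' -> y = y'.
  move=> rxy rxy'; apply/eqP; rewrite -subr_eq0; apply/eqP; apply: func.
  by have := lin (-1) _ _ _ _ rxy' rxy; rewrite !scaleN1r addNr addrC.
have [f fP] := choice tot.
have lf : linear f.
  by move=> a x y; apply: (uniq (a *: x + y)) => //; apply: lin.
have [g gE] := linear_ex lf; exists g => x y; rewrite gE; split => [rxy|<- //].
exact: uniq rxy.
Qed.

Lemma cst0_linear M N : exists g : {linear M -> N}, forall x, g x = 0.
Proof. by apply: linear_ex => a x y; rewrite scaler0 addr0. Qed.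

Lemma id_linear M : exists g : {linear M -> M}, forall x, g x = x.
Proof. exact: linear_ex. Qed.

Lemma comp_linear M N L (f : {linear M -> N}) (g : {linear N -> L}) :
  exists h : {linear M -> L}, forall x, h x = g (f x).
Proof. by apply: linear_ex => a x y; rewrite !linearP. Qed.

Definition lsub M (X : set M) : Prop :=
  X 0 /\ forall a x y, X x -> X y -> X (a *: x + y).

Lemma lsubD M (X : set M) x y : lsub X -> X x -> X y -> X (x + y).
Proof. by move=> [_ h] Xx Xy; have := h 1 x y Xx Xy; rewrite scale1r. Qed.

Lemma lsubZ M (X : set M) a x : lsub X -> X x -> X (a *: x).
Proof. by move=> [h0 h] Xx; have := h a x 0 Xx h0; rewrite addr0. Qed.

Lemma lsubN M (X : set M) x : lsub X -> X x -> X (- x).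
Proof. by move=> hX Xx; rewrite -scaleN1r; apply: lsubZ. Qed.

Lemma lsubB M (X : set M) x y : lsub X -> X x -> X y -> X (x - y).
Proof. by move=> hX Xx Xy; apply: lsubD => //; apply: lsubN. Qed.

Definition pred_of M (X : set M) : {pred M} := fun x => `[< X x >].

Lemma pred_ofP M (X : set M) x : reflect (X x) (x \in pred_of X).
Proof. exact: asboolP. Qed.

Lemma pred_of_closed M (X : set M) : lsub X -> submod_closed (pred_of X).
Proof.
move=> [h0 h]; split; first exact/pred_ofP.
by move=> a x y /pred_ofP Xx /pred_ofP Xy; apply/pred_ofP; apply: h.
Qed.

Lemma submodule_ex M (X : set M) : lsub X ->
  exists (K : lmodType A) (i : {linear K -> M}),
    injective i /\ forall x, X x <-> exists k, i k = x.
Proof.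
move=> /pred_of_closed cX.
pose m := GRing.isSubmodClosed.Build A M (pred_of X) cX.
pose S : submodClosed M := HB.pack (pred_of X) m.
have [i iE] : exists i : {linear submod_type S -> M}, forall x, i x = val x.
  by apply: linear_ex => a x y.
exists (submod_type S), i; split=> [x y|x]; first by rewrite !iE => /val_inj.
split=> [/pred_ofP Xx|[k <-]].
  by exists (Sub x Xx); rewrite iE.
by rewrite iE; apply/pred_ofP; case: k.
Qed.

Section Quotient.
Context (M : lmodType A) (S : {pred M}) (cS : submod_closed S).
Let Sz : zmodClosed M :=
  HB.pack S (GRing.isZmodClosed.Build M S (GRing.submod_closedB cS)).
Definition lquot := Quotient.quot Sz.
HB.instance Definition _ := GRing.Zmodule.on lquot.
Let sc (a : A) (x : lquot) : lquot := \pi_lquot (a *: repr x : M).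
Lemma lquot_eq (x y : M) : (\pi_lquot x == \pi_lquot y) = (x - y \in S).
Proof. by rewrite -(Quotient.idealrBE Sz). Qed.
Lemma lquot_repr (x : lquot) : \pi_lquot (repr x) = x.
Proof. exact: reprK. Qed.
Lemma lquot_scE a (x : M) : sc a (\pi_lquot x) = \pi_lquot (a *: x).
Proof.
have [S0 linS] := cS.
apply/eqP; rewrite lquot_eq -scalerBr -[_ *: _]addr0 linS //.
by rewrite -lquot_eq lquot_repr.
Qed.
Lemma lquot_piD (x y : M) : \pi_lquot (x + y) = \pi_lquot x + \pi_lquot y.
Proof. exact: Quotient.pi_add. Qed.
Lemma lquotP (x : lquot) : exists y : M, x = \pi_lquot y.
Proof. by exists (repr x); rewrite lquot_repr. Qed.
Fact scA a b x : sc a (sc b x) = sc (a * b) x.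
Proof. by have [y ->] := lquotP x; rewrite !lquot_scE scalerA. Qed.
Fact sc1 : left_id 1 sc.
Proof. by move=> x; have [y ->] := lquotP x; rewrite !lquot_scE scale1r. Qed.
Fact scDr : right_distributive sc +%R.
Proof.
move=> a x y; have [x' ->] := lquotP x; have [y' ->] := lquotP y.
by rewrite -lquot_piD !lquot_scE scalerDr lquot_piD.
Qed.
Fact scDl x : {morph sc^~ x : a b / a + b}.
Proof.
by move=> a b; have [y ->] := lquotP x; rewrite !lquot_scE scalerDl lquot_piD.
Qed.
HB.instance Definition _ := GRing.Zmodule_isLmodule.Build A lquot scA sc1 scDr scDl.
Lemma lquot_linear : linear (\pi_lquot : M -> lquot).
Proof. by move=> a x y; rewrite lquot_piD -lquot_scE. Qed.
End Quotient.

Lemma quotient_ex M (X : set M) : lsub X ->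
  exists (Q : lmodType A) (p : {linear M -> Q}),
    surj p /\ forall x, p x = 0 <-> X x.
Proof.
move=> /pred_of_closed cX.
have [p pE] := linear_ex (lquot_linear cX).
exists (lquot cX : lmodType A), p; split=> [y|x].
  by have [x ->] := lquotP y; exists x.
rewrite -(linear0 p) !pE; split.
  by move/eqP; rewrite lquot_eq subr0 => /pred_ofP.
by move=> Xx; apply/eqP; rewrite lquot_eq subr0; apply/pred_ofP.
Qed.

End LinearTools.

Section ShortExact.
Context (A : pzRingType).
Implicit Types (K L M N P Q : lmodType A).

Definition ses L M N (i : {linear L -> M}) (p : {linear M -> N}) : Prop :=
  [/\ injective i, exact_at i p & surj p].

Lemma linear_inj L M (f : {linear L -> M}) :
  (forall x, f x = 0 -> x = 0) -> injective f.
Proof.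
move=> f0 x y fxy; apply/eqP; rewrite -subr_eq0; apply/eqP; apply: f0.
by rewrite linearB fxy subrr.
Qed.

Lemma ses_comp0 L M N (i : {linear L -> M}) (p : {linear M -> N}) x :
  ses i p -> p (i x) = 0.
Proof. by case=> _ ex _; apply/ex; exists x. Qed.

Lemma lsub_ker M N (p : {linear M -> N}) : lsub [set x | p x = 0].
Proof.
split=> [|a x y] /=; first exact: linear0.
by move=> px py; rewrite linearP px py scaler0 addr0.
Qed.

Lemma lsub_im L M (i : {linear L -> M}) : lsub [set x | exists y, i y = x].
Proof.
split=> [|a x y] /=; first by exists 0; rewrite linear0.
by move=> [u <-] [v <-]; exists (a *: u + v); rewrite linearP.
Qed.

Lemma ses_of_surj M N (p : {linear M -> N}) : surj p ->
  exists (L : lmodType A) (i : {linear L -> M}), ses i p.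
Proof.
move=> sp; have [L [i [inj_i iE]]] := submodule_ex (lsub_ker p).
by exists L, i; split.
Qed.

Lemma ses_of_inj L M (i : {linear L -> M}) : injective i ->
  exists (N : lmodType A) (p : {linear M -> N}), ses i p.
Proof.
move=> inj_i; have [N [p [sp pE]]] := quotient_ex (lsub_im i).
by exists N, p; split.
Qed.

Lemma factor_surj M N L (p : {linear M -> N}) (f : {linear M -> L}) :
  surj p -> (forall x, p x = 0 -> f x = 0) ->
  exists g : {linear N -> L}, forall x, g (p x) = f x.
Proof.
move=> sp pf.
have [||| g gE] := @linear_of_rel A N L (fun n l => exists2 x, p x = n & f x = l).
- by move=> n; have [x px] := sp n; exists (f x), x.
- move=> a n n' l l' [x <- <-] [x' <- <-].
  by exists (a *: x + x'); rewrite linearP.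
- by move=> l [x /pf fx <-].
by exists g => x; apply/gE; exists x.
Qed.

Lemma factor_inj K L M (i : {linear L -> M}) (f : {linear K -> M}) :
  injective i -> (forall x, exists y, i y = f x) ->
  exists g : {linear K -> L}, forall x, i (g x) = f x.
Proof.
move=> inj_i if_.
have [||| g gE] := @linear_of_rel A K L (fun k l => i l = f k) => //.
- by move=> a x x' y y' E E'; rewrite !linearP E E'.
- by move=> y; rewrite linear0 -(linear0 i) => /inj_i.
by exists g => x; apply/gE.
Qed.

Lemma pair_linear K L M (f : {linear K -> L}) (g : {linear K -> M}) :
  exists h : {linear K -> (L * M)%type}, forall x, h x = (f x, g x).
Proof. by apply: linear_ex => a x y; rewrite !linearP. Qed.

Lemma sub_linear L M (f g : {linear L -> M}) :
  exists h : {linear L -> M}, forall x, h x = f x - g x.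
Proof.
by apply: linear_ex => a x y; rewrite (linearP f) (linearP g) scalerBr opprD addrACA.
Qed.

Lemma copair_linear K L M (f : {linear K -> M}) (g : {linear L -> M}) :
  exists h : {linear (K * L)%type -> M}, forall x y, h (x, y) = f x + g y.
Proof.
have [|h hE] := @linear_ex A (K * L)%type M (fun z => f z.1 + g z.2).
  by move=> a x y; rewrite /= !linearP scalerDr addrACA.
by exists h => x y; rewrite hE.
Qed.

Lemma fst_linear K L : exists h : {linear (K * L)%type -> K}, forall z, h z = z.1.
Proof. exact: linear_ex. Qed.

Lemma snd_linear K L : exists h : {linear (K * L)%type -> L}, forall z, h z = z.2.
Proof. exact: linear_ex. Qed.

Lemma projective_prod P Q : projective P -> projective Q -> projective (P * Q)%type.
Proof.
move=> pP pQ M N g f sg.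
have [inl inlE] : exists h : {linear P -> (P * Q)%type}, forall x, h x = (x, 0).
  by have [z zE] := cst0_linear P Q; have [i iE] := id_linear P;
     have [h hE] := pair_linear i z; exists h => x; rewrite hE iE zE.
have [inr inrE] : exists h : {linear Q -> (P * Q)%type}, forall x, h x = (0, x).
  by have [z zE] := cst0_linear Q P; have [i iE] := id_linear Q;
     have [h hE] := pair_linear z i; exists h => x; rewrite hE iE zE.
have [f1 f1E] := comp_linear inl f; have [f2 f2E] := comp_linear inr f.
have [h1 h1E] := pP _ _ g f1 sg; have [h2 h2E] := pQ _ _ g f2 sg.
have [h hE] := copair_linear h1 h2.
exists h => -[x y]; rewrite hE linearD h1E h2E f1E f2E inlE inrE -linearD.
by congr (f _); apply/pair_eqP; rewrite /= addr0 add0r !eqxx.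
Qed.

Lemma projective_retract P Q (s : {linear P -> Q}) (r : {linear Q -> P}) :
  (forall x, r (s x) = x) -> projective Q -> projective P.
Proof.
move=> rs pQ M N g f sg; have [fr frE] := comp_linear r f.
have [h hE] := pQ _ _ g fr sg; have [k kE] := comp_linear s h.
by exists k => x; rewrite kE hE frE rs.
Qed.

Lemma projective_zero P : (forall x : P, x = 0) -> projective P.
Proof.
move=> P0 M N g f sg; have [h hE] := cst0_linear P M.
by exists h => x; rewrite hE linear0 (P0 x) linear0.
Qed.

Lemma row_linear n M (v : 'I_n -> M) :
  exists f : {linear 'rV[A]_n -> M}, forall x, f x = \sum_i x 0 i *: v i.
Proof.
apply: linear_ex => a x y; rewrite scaler_sumr -big_split /=.
by apply: eq_bigr => i _; rewrite !mxE scalerDl scalerA.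
Qed.

Lemma linear_row n M (f : {linear 'rV[A]_n -> M}) x :
  f x = \sum_i x 0 i *: f (delta_mx 0 i).
Proof.
by rewrite {1}[x]row_sum_delta linear_sum; apply: eq_bigr => i _; rewrite linearZ.
Qed.

Lemma projective_row n : projective 'rV[A]_n.
Proof.
move=> M N g f sg.
have [v vE] := choice (fun i => sg (f (delta_mx 0 i))).
have [h hE] := row_linear v; exists h => x.
by rewrite hE linear_sum linear_row; apply: eq_bigr => i _; rewrite linearZ vE.
Qed.

End ShortExact.

Section FreeModule.
Context (A : pzRingType) (X : eqType).

Definition fin_supp (f : X -> A) : Prop :=
  exists s : seq X, forall x, x \notin s -> f x = 0.

Lemma fin_supp_uniq f : fin_supp f ->
  exists2 s : seq X, uniq s & forall x, x \notin s -> f x = 0.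
Proof.
by case=> s sP; exists (undup s); rewrite ?undup_uniq // => x; rewrite mem_undup; apply: sP.
Qed.

Lemma fin_suppP : lsub (fin_supp : set (X -> A^o)).
Proof.
split=> [|a f g [s sP] [t tP]]; first by exists [::].
exists (s ++ t) => x; rewrite mem_cat negb_or => /andP[xs xt].
have -> : (a *: (f : X -> A^o) + g) x = a * f x + g x by [].
by rewrite sP // tP // mulr0 addr0.
Qed.

Lemma sum_supp (M : lmodType A) (f : X -> A) (h : X -> M) (s t : seq X) :
  uniq s -> uniq t -> (forall x, x \notin s -> f x = 0) ->
  (forall x, x \notin t -> f x = 0) ->
  \sum_(x <- s) f x *: h x = \sum_(x <- t) f x *: h x.
Proof.
move=> us ut fs ft.
have E (u : seq X) : \sum_(x <- u) f x *: h x = \sum_(x <- u | f x != 0) f x *: h x.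
  rewrite [LHS](bigID (fun x => f x != 0)) /= [X in _ + X]big1 ?addr0 //.
  by move=> x; rewrite negbK => /eqP->; rewrite scale0r.
rewrite (E s) (E t) -[LHS]big_filter -[RHS]big_filter; apply: perm_big.
apply: uniq_perm; rewrite ?filter_uniq // => x; rewrite !mem_filter.
have [//|fx /=] := eqVneq (f x) 0.
have -> : x \in s by apply: contraNT fx => /fs->.
by symmetry; apply: contraNT fx => /ft->.
Qed.

(* [c] gives the coordinates and [b] is the basis. *)
Lemma free_module_ex : exists (F : lmodType A) (c : {linear F -> (X -> A^o)})
    (b : X -> F),
  [/\ injective c, forall g : X -> A^o, fin_supp g <-> exists f, c f = g,
      forall x y, c (b x) y = (x == y)%:R &
      forall (M : lmodType A) (h : X -> M), exists g : {linear F -> M},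
        (forall x, g (b x) = h x) /\
        forall f s, uniq s -> (forall x, x \notin s -> c f x = 0) ->
          g f = \sum_(x <- s) (c f x : A) *: h x].
Proof.
have [F [c [cinj cE]]] := submodule_ex fin_suppP.
have /choice[b bE] : forall x, exists f, c f = (fun y => (x == y)%:R) :> (X -> A^o).
  move=> x; apply/cE; exists [:: x] => y; rewrite inE eq_sym.
  by case: eqVneq.
exists F, c, b; split=> // [x y|M h]; first by rewrite bE.
have cs f : fin_supp (c f) by apply/cE; exists f.
have [|||g gE] := @linear_of_rel A F M (fun f m => exists s, [/\ uniq s,
    forall x, x \notin s -> c f x = 0 & m = \sum_(x <- s) (c f x : A) *: h x]).
- by move=> f; have [s us sP] := fin_supp_uniq (cs f); eexists; exists s; split.
- move=> a f f' m m' [s [us sP ->]] [s' [us' sP' ->]].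
  pose t := undup (s ++ s').
  have ut : uniq t by rewrite undup_uniq.
  have st x : x \notin t -> x \notin s /\ x \notin s'.
    by rewrite mem_undup mem_cat negb_or => /andP.
  have tP x : x \notin t -> c f x = 0 by move=> /st[/sP].
  have tP' x : x \notin t -> c f' x = 0 by move=> /st[_ /sP'].
  have cP x : c (a *: f + f') x = a * c f x + c f' x by rewrite linearP.
  exists t; split=> // [x xt|].
    by rewrite cP tP // tP' // mulr0 addr0.
  rewrite (sum_supp h us ut sP tP) (sum_supp h us' ut sP' tP').
  rewrite scaler_sumr -big_split /=; apply: eq_bigr => x _.
  by rewrite cP scalerDl scalerA.
- move=> m [s [_ _ ->]]; rewrite big1 // => x _.
  by rewrite linear0 scale0r.
exists g; split=> [x|f s us sP].
  apply/gE; exists [:: x]; split=> // [y|].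
    by rewrite inE bE eq_sym; case: eqVneq.
  by rewrite big_seq1 bE eqxx scale1r.
by apply/gE; exists s.
Qed.

End FreeModule.

Section FreeCover.
Context (A : pzRingType).

(** Taking the whole underlying set of [M] as basis makes surjectivity immediate. *)
Lemma free_cover (M : lmodType A) : exists (F : lmodType A) (p : {linear F -> M}),
  projective F /\ surj p.
Proof.
have [F [c [b [cinj cP bE univ]]]] := free_module_ex A M.
have [p [pb _]] := univ M id; exists F, p; split; last by move=> x; exists (b x).
move=> N N' g f sg; have [w wE] := choice (fun x => sg (f (b x))).
have [h [hb hE]] := univ _ w; exists h => z.
have [s us sP] : exists2 s : seq M, uniq s & forall x, x \notin s -> c z x = 0.
  by apply: fin_supp_uniq; apply/cP; exists z.
have -> : z = \sum_(x <- s) (c z x : A) *: b x.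
  apply: cinj; apply/funext => y; rewrite linear_sum fct_sumE.
  have cbE x : c ((c z x : A) *: b x) y = c z x * (x == y)%:R.
    by rewrite linearZ -bE.
  under eq_bigr do rewrite cbE.
  have [ys|ys] := boolP (y \in s); last first.
    rewrite sP // big1_seq // => x /andP[_ xs].
    by case: eqVneq ys => [<-|]; rewrite ?xs ?mulr0.
  rewrite (big_rem y) //= big1_seq ?addr0 ?eqxx ?mulr1 // => x /andP[_].
  by rewrite mem_rem_uniq // inE => /andP[/negPf-> _]; rewrite mulr0.
rewrite !linear_sum; apply: eq_bigr => x _.
by rewrite !linearZ hb wE.
Qed.

End FreeCover.

(** * Vanishing of Ext and approximations *)

Section Ext1.
Context (A : pzRingType).
Implicit Types (B C G H K L M N P Q R X Y Z : lmodType A).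

(* [Ext1_vanishes Z Y] says that Ext^1(Z, Y) = 0. *)
Definition Ext1_vanishes Z Y : Prop :=
  forall B C (i : {linear B -> C}) (p : {linear C -> Z}), ses i p ->
  forall u : {linear B -> Y}, exists v : {linear C -> Y}, forall x, v (i x) = u x.

(** Any extension [C] of [Z] by [B] is a pushout of the given presentation along a comparison map
    [K -> B], so one projective presentation suffices as a test. *)
Lemma Ext1_vanishes_of_projective K R Z Y (i : {linear K -> R}) (p : {linear R -> Z}) :
  ses i p -> projective R ->
  (forall u : {linear K -> Y}, exists v : {linear R -> Y}, forall x, v (i x) = u x) ->
  Ext1_vanishes Z Y.
Proof.
move=> [inj_i ex_i sp] pR ext B C i' p' [inj_i' ex_i' sp'] u.
have [rho rhoE] := pR _ _ p' p sp'.
have [ri riE] := comp_linear i rho.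
have [|t tE] := @factor_inj A K B C i' ri inj_i'.
  by move=> x; apply/ex_i'; rewrite riE rhoE; apply/ex_i; exists x.
have [ut utE] := comp_linear t u; have [s sE] := ext ut.
have [q qE] := copair_linear i' rho; have [f fE] := copair_linear u s.
(* [C] is [B * R] modulo the pairs [(- t w, i w)], and the sum of [u] and [s] vanishes on these. *)
have [||v vE] := @factor_surj A (B * R)%type C Y q f.
- move=> c; have [r rE] := sp (p' c).
  have /ex_i'[b bE] : p' (c - rho r) = 0 by rewrite linearB rhoE rE subrr.
  by exists (b, r); rewrite qE bE subrK.
- move=> [b r]; rewrite qE fE => brE.
  have pr : p r = 0.
    have : p' (i' b + rho r) = 0 by rewrite brE linear0.
    by rewrite linearD rhoE (_ : p' (i' b) = 0) ?add0r //; apply/ex_i'; exists b.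
  have /ex_i[w wE] := pr; subst r.
  have -> : b = - t w.
    apply: inj_i'; rewrite linearN tE riE; apply/eqP.
    by rewrite -addr_eq0 brE.
  by rewrite sE utE linearN addNr.
exists v => b; have := vE (b, 0); rewrite qE fE !linear0 !addr0; exact.
Qed.

(** The map is extended in two stages, through the preimage [D] of [G] in [C]: [D / B] is [G] and
    [C / D] is [H]. *)
Lemma Ext1_vanishes_ext G Z H Y (i : {linear G -> Z}) (p : {linear Z -> H}) :
  ses i p -> Ext1_vanishes G Y -> Ext1_vanishes H Y -> Ext1_vanishes Z Y.
Proof.
move=> [inj_i ex_i sp] EG EH B C i' p' [inj_i' ex_i' sp'] u.
have [pp ppE] := comp_linear p' p.
have [|D [k sk]] := @ses_of_surj A C H pp.
  by move=> h; have [z zE] := sp h; have [c cE] := sp' z; exists c; rewrite ppE cE.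
have [inj_k ex_k spp] := sk.
have [|j jE] := @factor_inj A B D C k i' inj_k.
  by move=> b; apply/ex_k; rewrite ppE (_ : p' _ = 0) ?linear0 //; apply/ex_i'; exists b.
have [pk pkE] := comp_linear k p'.
have [|q qE] := @factor_inj A D G Z i pk inj_i.
  by move=> d; apply/ex_i; rewrite pkE -ppE; apply/ex_k; exists d.
have [|w wE] := EG _ _ j q _ u.
  split=> [x y /(congr1 k)|d|g].
  - by rewrite !jE => /inj_i'.
  - split=> [qd|[b <-]].
      have /ex_i'[b bE] : p' (k d) = 0 by rewrite -pkE -qE qd linear0.
      by exists b; apply: inj_k; rewrite jE.
    by apply: inj_i; rewrite linear0 qE pkE jE; apply/ex_i'; exists b.
  - have [c cE] := sp' (i g).
    have /ex_k[d dE] : pp c = 0 by rewrite ppE cE; apply/ex_i; exists g.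
    by exists d; apply: inj_i; rewrite qE pkE dE.
have [v vE] := EH _ _ k pp sk w.
by exists v => b; rewrite -jE vE wE.
Qed.

(** The extension of [M1] is pulled back along [r]. The map extends over the pullback, into which
    [C] is sent by [c |-> (c, s (p c))]. *)
Lemma Ext1_vanishes_retract M M1 Y (s : {linear M1 -> M}) (r : {linear M -> M1}) :
  (forall x, r (s x) = x) -> Ext1_vanishes M Y -> Ext1_vanishes M1 Y.
Proof.
move=> rs EM B C i p [inj_i ex_i sp] u.
have lD : lsub ([set z | p z.1 = r z.2] : set (C * M)%type).
  split=> [|a x y] /=; first by rewrite !linear0.
  by move=> px py; rewrite !linearP px py.
have [D [k [inj_k kE]]] := submodule_ex lD.
have [z0 z0E] := cst0_linear B M; have [i0 i0E] := pair_linear i z0.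
have [|j jE] := @factor_inj A B D _ k i0 inj_k.
  move=> b; apply/kE; rewrite i0E z0E /= linear0.
  by apply/ex_i; exists b.
have [sn snE] := snd_linear C M; have [q qE] := comp_linear k sn.
have [|w wE] := EM _ _ j q _ u.
  split=> [x y /(congr1 k)|d|m].
  - by rewrite !jE !i0E => -[/inj_i].
  - rewrite qE snE; split=> [d2|[b <-]]; last by rewrite jE i0E z0E.
    have /= d1 : p (k d).1 = r (k d).2 by apply/kE; exists d.
    have /ex_i[b bE] : p (k d).1 = 0 by rewrite d1 d2 linear0.
    by exists b; apply: inj_k; rewrite jE i0E z0E bE [RHS]surjective_pairing d2.
  - have [c cE] := sp (r m).
    have [d dE] : exists d, k d = (c, m) by apply/kE.
    by exists d; rewrite qE snE dE.
have [sp1 sp1E] := comp_linear p s.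
have [ic icE] := id_linear C; have [g gE] := pair_linear ic sp1.
have [|h hE] := @factor_inj A C D _ k g inj_k.
  by move=> c; apply/kE; rewrite gE icE sp1E /= rs.
have [v vE] := comp_linear h w; exists v => b.
rewrite vE -wE; congr (w _); apply: inj_k.
rewrite hE gE icE sp1E jE i0E z0E; congr (_, _).
by rewrite (_ : p _ = 0) ?linear0 //; apply/ex_i; exists b.
Qed.

Lemma Ext1_vanishes_projective P Y : projective P -> Ext1_vanishes P Y.
Proof.
move=> pP; have [p pE] := id_linear P.
have [|K [i si]] := ses_of_surj (p := p); first by move=> x; exists x.
apply: (Ext1_vanishes_of_projective si pP) => u.
have [v vE] := cst0_linear P Y; exists v => x; rewrite vE.
have [inj_i ex_i _] := si.
have -> : x = 0 by apply: inj_i; rewrite linear0 -[i x]pE (ses_comp0 _ si).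
by rewrite linear0.
Qed.

(* [fpd k Y] is a form of "Y has projective dimension < k": closing under
   products and cokernels by definition avoids constructing resolutions. *)
Inductive fpd : nat -> lmodType A -> Prop :=
| fpd_zero k Y : (forall y : Y, y = 0) -> fpd k Y
| fpd_projective k P : projective P -> fpd k.+1 P
| fpd_prod k Y Y' : fpd k Y -> fpd k Y' -> fpd k (Y * Y')%type
| fpd_quotient k Y Y' Y'' (i : {linear Y -> Y'}) (p : {linear Y' -> Y''}) :
    ses i p -> fpd k Y -> fpd k.+1 Y' -> fpd k.+1 Y''.

Section HomExact.
Context (P : int -> lmodType A) (d : forall i : int, {linear P (i + 1) -> P i}).
Context (pP : forall i, projective (P i)).
Context (dd : forall i x, d i (d (i + 1) x) = 0).

(** As the [P i] are projective, a cocycle with values in [Y''] lifts to [Y']; its coboundary has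
    values in [Y], where exactness provides the correction. *)
Lemma Hom_exact_quotient Y Y' Y'' (i : {linear Y -> Y'}) (p : {linear Y' -> Y''}) :
  ses i p -> Hom_exact d Y -> Hom_exact d Y' -> Hom_exact d Y''.
Proof.
move=> [inj_i ex_i sp] hY hY' k f; split=> [fd|[g gE] y]; last by rewrite -gE dd linear0.
have [f' f'E] := pP f sp.
have [f'd f'dE] := comp_linear (d (k + 1)) f'.
have [|w wE] := factor_inj (f := f'd) inj_i.
  by move=> x; apply/ex_i; rewrite f'dE f'E fd.
have [v vE] : exists v : {linear P (k + 1) -> Y}, forall x, v (d (k + 1) x) = w x.
  by apply/hY => y; apply: inj_i; rewrite wE f'dE dd !linear0.
have [iv ivE] := comp_linear v i; have [u uE] := sub_linear f' iv.
have [g gE] : exists g : {linear P k -> Y'}, forall x, g (d k x) = u x.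
  by apply/hY' => y; rewrite uE ivE vE wE f'dE subrr.
have [pg pgE] := comp_linear g p; exists pg => x.
rewrite pgE gE uE linearB f'E ivE (_ : p (i (v x)) = 0) ?subr0 //.
by apply/ex_i; exists (v x).
Qed.

Lemma Hom_exact_zero Y : (forall y : Y, y = 0) -> Hom_exact d Y.
Proof.
move=> Y0 k f; split=> [_|[g gE] y]; last exact: Y0.
by have [g gE] := cst0_linear (P k) Y; exists g => x; rewrite gE (Y0 (f x)).
Qed.

Lemma Hom_exact_prod Y Y' : Hom_exact d Y -> Hom_exact d Y' ->
  Hom_exact d (Y * Y')%type.
Proof.
move=> hY hY' k f; split=> [fd|[g gE] y]; last by rewrite -gE dd linear0.
have [a aE] := fst_linear Y Y'; have [b bE] := snd_linear Y Y'.
have [fa faE] := comp_linear f a; have [fb fbE] := comp_linear f b.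
have [ga gaE] : exists g : {linear P k -> Y}, forall x, g (d k x) = fa x.
  by apply/hY => y; rewrite faE fd linear0.
have [gb gbE] : exists g : {linear P k -> Y'}, forall x, g (d k x) = fb x.
  by apply/hY' => y; rewrite fbE fd linear0.
have [g gE] := pair_linear ga gb; exists g => x.
by rewrite gE gaE gbE faE fbE aE bE -surjective_pairing.
Qed.

Context (hP : forall Q, projective Q -> Hom_exact d Q).

Lemma Hom_exact_fpd k Y : fpd k Y -> Hom_exact d Y.
Proof.
elim=> {k Y} [k Y Y0|k Q pQ|k Y Y' _ hY _ hY'|k Y Y' Y'' i p s _ hY _ hY'].
- exact: Hom_exact_zero.
- exact: hP.
- exact: Hom_exact_prod.
- exact: Hom_exact_quotient s hY hY'.
Qed.

Lemma Ext1_vanishes_cokernel k G (p : {linear P k -> G}) Y :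
  is_cokernel (d k) p -> Hom_exact d Y -> Ext1_vanishes G Y.
Proof.
move=> [ex_p sp] hY; have [K [i si]] := ses_of_surj sp.
have [inj_i ex_i _] := si.
apply: (Ext1_vanishes_of_projective si) => // u.
have [|d' d'E] := factor_inj (f := d k) inj_i.
  by move=> x; apply/ex_i/ex_p; exists x.
have [ud udE] := comp_linear d' u.
have [g gE] : exists g : {linear P k -> Y}, forall x, g (d k x) = ud x.
  by apply/hY => y; rewrite udE (_ : d' _ = 0) ?linear0 //; apply: inj_i;
     rewrite d'E dd linear0.
exists g => x; have /ex_p[y yE] : p (i x) = 0 by apply/ex_i; exists x.
by rewrite -yE gE udE; congr (u _); apply: inj_i; rewrite d'E.
Qed.

End HomExact.

(* The part of Gorenstein projectivity that is stable under extensions by a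
   one-step argument: [coresolved] is the largest class [F] included in
   [coresolved_step F]. *)
Definition coresolved_step (F : lmodType A -> Prop) G : Prop :=
  exists Q G' (i : {linear G -> Q}) (p : {linear Q -> G'}),
    [/\ ses i p, projective Q, forall k Y, fpd k Y -> Ext1_vanishes G Y & F G'].

Definition coresolved G : Prop :=
  exists2 F : lmodType A -> Prop, forall G, F G -> coresolved_step F G & F G.

Lemma coresolved_intro (F : lmodType A -> Prop) G :
  (forall G, F G -> coresolved_step F G) -> F G -> coresolved G.
Proof. by exists F. Qed.

Lemma coresolved_elim G : coresolved G -> coresolved_step coresolved G.
Proof.
case=> F hF /hF[Q [G' [i [p [s pQ hE FG']]]]].
by exists Q, G', i, p; split=> //; exists F.
Qed.

Lemma coresolved_Ext1 G k Y : coresolved G -> fpd k Y -> Ext1_vanishes G Y.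
Proof. by move=> /coresolved_elim[Q [G' [i [p [_ _ h _]]]]]; apply: h. Qed.

Lemma coresolved_Gorenstein G : Gorenstein_projective G -> coresolved G.
Proof.
case=> P [d [pP ex hP [k [p kp]]]].
have dd i x : d i (d (i + 1) x) = 0 by apply/(ex i); exists x.
apply: (@coresolved_intro (fun G => exists k (p : {linear P k -> G}), is_cokernel (d k) p));
  last by exists k, p.
move=> {}G [{}k [{}p {}kp]].
(* The cokernel of [d (j + 1)] is the image of [d j], hence embeds in [P j]; the quotient is the
   cokernel of [d j], again in the class. *)
have [j ej] : exists j, k = j + 1 by exists (k - 1); rewrite subrK.
subst k; have [ex_p sp] := kp.
have [|i iE] := @factor_surj A _ G _ p (d j) sp.
  by move=> x /ex_p[y <-]; rewrite dd.
have inj_i : injective i.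
  apply: linear_inj => g; have [x <-] := sp g; rewrite iE => /(ex j)[y yE].
  by apply/ex_p; exists y.
have [G' [p' si]] := ses_of_inj inj_i.
have [_ ex_i sp'] := si.
exists (P j), G', i, p'; split=> // [n Y fY|].
  exact: (Ext1_vanishes_cokernel pP dd kp (Hom_exact_fpd pP dd hP fY)).
exists j, p'; split=> // y; split.
  by move=> /ex_i[g <-]; have [x <-] := sp g; exists x; rewrite iE.
by move=> [x <-]; rewrite -iE; apply/ex_i; exists (p x).
Qed.

(** A horseshoe for coresolutions: Ext^1(H, QG) = 0 extends [G -> QG] to [Z], so [Z] embeds in
    [QG * QH] with cokernel an extension of [H'] by [G']. The class of all such extensions is thus
    stable under the step, as coinduction requires. *)
Lemma coresolved_ext G Z H (i : {linear G -> Z}) (p : {linear Z -> H}) :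
  ses i p -> coresolved G -> coresolved H -> coresolved Z.
Proof.
move=> s gG gH.
apply: (@coresolved_intro (fun Z => exists G H (i : {linear G -> Z}) (p : {linear Z -> H}),
  [/\ ses i p, coresolved G & coresolved H])); last by exists G, H, i, p.
move=> {s gG gH} {}Z [{}G [{}H [{}i [{}p [s gG gH]]]]].
have EZ k Y : fpd k Y -> Ext1_vanishes Z Y.
  by move=> fY; apply: (Ext1_vanishes_ext s); apply: coresolved_Ext1 fY.
have EH k Y : fpd k Y -> Ext1_vanishes H Y by move=> fY; apply: coresolved_Ext1 fY.
have [QG [G' [iG [pG [sG prG _ gG']]]]] := coresolved_elim gG.
have [QH [H' [iH [pH [sH prH _ gH']]]]] := coresolved_elim gH.
have [inj_iG ex_G spG] := sG; have [inj_iH ex_H spH] := sH.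
have [inj_i ex_i sp] := s.
have [a aE] := EH _ _ (fpd_projective 0 prG) _ _ i p s iG.
have [b bE] := comp_linear p iH; have [j jE] := pair_linear a b.
have inj_j : injective j.
  apply: linear_inj => z; rewrite jE bE => -[az /eqP].
  rewrite -(linear0 iH) => /eqP /inj_iH pz.
  have /ex_i[g gE] := pz; move: az; rewrite -gE aE -(linear0 iG) => /inj_iG->.
  by rewrite linear0.
have [Z' [pi sj]] := ses_of_inj inj_j; have [_ ex_j spi] := sj.
have [idG idGE] := id_linear QG; have [zG zGE] := cst0_linear QG QH.
have [l lE] := pair_linear idG zG; have [pl plE] := comp_linear l pi.
have [|i' i'E] := @factor_surj A _ _ _ pG pl spG.
  move=> q /ex_G[g <-]; rewrite plE; apply/ex_j; exists (i g).
  by rewrite jE aE bE lE idGE zGE (ses_comp0 _ s) linear0.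
have [sn snE] := snd_linear QG QH; have [psn psnE] := comp_linear sn pH.
have [|p' p'E] := @factor_surj A _ _ _ pi psn spi.
  by move=> q /ex_j[z <-]; rewrite psnE snE jE bE (ses_comp0 _ sH).
have s' : ses i' p'.
  split=> [|z'|h].
  - apply: linear_inj => g'; have [q <-] := spG g'; rewrite i'E plE => /ex_j[z].
    rewrite jE lE idGE zGE bE => -[aq /eqP].
    rewrite -(linear0 iH) => /eqP /inj_iH /ex_i[g gE].
    by rewrite -aq -gE aE (ses_comp0 _ sG).
  - have [[q q'] <-] := spi z'; rewrite p'E psnE snE /=; split.
      move=> /ex_H[h hE]; have [z zE] := sp h.
      exists (pG (q - a z)); rewrite i'E plE lE idGE zGE.
      apply/eqP; rewrite eq_sym -subr_eq0 -linearB; apply/eqP/ex_j; exists z.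
      by rewrite jE bE zE hE; congr (_, _); rewrite /= ?subr0 // opprB addrC subrK.
    move=> [g' ]; have [x <-] := spG g'; rewrite i'E plE => /eqP.
    rewrite -subr_eq0 -linearB => /eqP/ex_j[z]; rewrite jE lE idGE zGE bE => -[_ /eqP].
    by rewrite sub0r -eqr_oppLR => /eqP <-; rewrite linearN (ses_comp0 _ sH) oppr0.
  - have [q qE] := spH h; exists (pi (0, q)).
    by rewrite p'E psnE snE.
exists (QG * QH)%type, Z', j, pi; split=> //; first exact: projective_prod.
by exists G', H', i', p'.
Qed.

Lemma coresolved_zero G : (forall x : G, x = 0) -> coresolved G.
Proof.
move=> G0; apply: (@coresolved_intro (fun G => forall x : G, x = 0)) => // {G0}G G0.
have [i iE] := id_linear G; have [p pE] := cst0_linear G G.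
have si : ses i p.
  split=> [x y|y|y]; first by rewrite (G0 x) (G0 y).
    by split=> _; [exists y | rewrite pE].
  by exists 0; rewrite (G0 y) pE.
have pG := projective_zero G0.
by exists G, G, i, p; split=> // k Y _; apply: Ext1_vanishes_projective.
Qed.

Lemma coresolved_projective P : projective P -> coresolved P.
Proof.
move=> pP; have [i iE] := id_linear P.
have [|Z [p si]] := @ses_of_inj A P P i; first by move=> x y; rewrite !iE.
apply: (@coresolved_intro (fun G => G = P \/ coresolved G)); last by left.
move=> X [->|/coresolved_elim[Q [G' [j [q [sj pQ h gG']]]]]]; last first.
  by exists Q, G', j, q; split=> //; right.
exists P, Z, i, p; split=> // [k Y _|]; first exact: Ext1_vanishes_projective.
right; apply: coresolved_zero => z; have [_ ex_i sp] := si; have [x <-] := sp z.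
by apply/ex_i; exists x.
Qed.

(* Auslander-Buchweitz approximations. *)
Definition approx k L : Prop :=
  exists Y X (i : {linear Y -> X}) (p : {linear X -> L}),
    [/\ ses i p, fpd k Y & coresolved X].

(** With [X] embedded in a projective [Q], the module [Z] is the pushout of [G] and [Q] along [X].
    It is an extension of [X'] by [G], hence coresolved, and the kernel of [Z -> L] is [Q / Y],
    which costs one unit of projective dimension. *)
Lemma approx_step k K G L (i : {linear K -> G}) (p : {linear G -> L}) :
  ses i p -> coresolved G -> approx k K -> approx k.+1 L.
Proof.
move=> sK gG [Y [X [iY [pX [sY fY]]]]] gX.
have [Q [X' [jX [qX [sX pQ _ gX']]]]] := coresolved_elim gX.
have [inj_iK ex_K spL] := sK; have [inj_iY ex_Y spX] := sY.
have [inj_jX ex_X sqX] := sX.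
have [a aE] := comp_linear pX i; have [m mE] := pair_linear a jX.
have inj_m : injective m.
  apply: linear_inj => x; rewrite mE => -[_ /eqP].
  by rewrite -(linear0 jX) => /eqP /inj_jX.
have [Z [pi sm]] := ses_of_inj inj_m; have [_ ex_m spi] := sm.
have [idG idGE] := id_linear G; have [zG zGE] := cst0_linear G Q.
have [l lE] := pair_linear idG zG; have [pl plE] := comp_linear l pi.
have [sn snE] := snd_linear G Q; have [psn psnE] := comp_linear sn qX.
have [|p' p'E] := @factor_surj A _ _ _ pi psn spi.
  by move=> q /ex_m[z <-]; rewrite psnE snE mE (ses_comp0 _ sX).
have gZ : coresolved Z.
  apply: (@coresolved_ext _ _ _ pl p') => //; split=> [|z|x'].
  - apply: linear_inj => g; rewrite plE => /ex_m[x]; rewrite mE lE idGE zGE.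
    by move=> [ax /eqP]; rewrite -ax -(linear0 jX) => /eqP/inj_jX->; rewrite linear0.
  - have [[g q] <-] := spi z; rewrite p'E psnE snE /=; split.
      move=> /ex_X[x xE]; exists (g - a x); rewrite plE lE idGE zGE.
      apply/eqP; rewrite eq_sym -subr_eq0 -linearB; apply/eqP/ex_m; exists x.
      by rewrite mE xE; congr (_, _); rewrite /= ?subr0 // opprB addrC subrK.
    move=> [g']; rewrite plE lE idGE zGE => /eqP.
    rewrite -subr_eq0 -linearB => /eqP/ex_m[x]; rewrite mE => -[_ /eqP].
    by rewrite sub0r -eqr_oppLR => /eqP <-; rewrite linearN (ses_comp0 _ sX) oppr0.
  - by have [q qE] := sqX x'; exists (pi (0, q)); rewrite p'E psnE snE.
have [j jE] := comp_linear iY jX.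
have [|Y2 [pY2 sj]] := @ses_of_inj A Y Q j.
  by move=> x y; rewrite !jE => /inj_jX/inj_iY.
have [inj_j ex_j spY2] := sj.
have [zQ zQE] := cst0_linear Q G; have [idQ idQE] := id_linear Q.
have [r rE] := pair_linear zQ idQ; have [pr prE] := comp_linear r pi.
have [|i2 i2E] := @factor_surj A _ _ _ pY2 pr spY2.
  move=> q /ex_j[y <-]; rewrite prE; apply/ex_m; exists (iY y).
  by rewrite mE aE (ses_comp0 _ sY) linear0 rE zQE idQE jE.
have [fs fsE] := fst_linear G Q; have [pfs pfsE] := comp_linear fs p.
have [|p2 p2E] := @factor_surj A _ _ _ pi pfs spi.
  by move=> q /ex_m[z <-]; rewrite pfsE fsE mE aE (ses_comp0 _ sK).
exists Y2, Z, i2, p2; split=> //; last first.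
  exact: fpd_quotient sj fY (fpd_projective _ pQ).
split=> [|z|x].
- apply: linear_inj => y; have [q <-] := spY2 y; rewrite i2E prE => /ex_m[x].
  rewrite mE rE zQE idQE aE => -[/eqP ax jx].
  move: ax; rewrite -(linear0 i) => /eqP/inj_iK/ex_Y[y' yE].
  by apply/ex_j; exists y'; rewrite jE yE.
- have [[g q] <-] := spi z; rewrite p2E pfsE fsE /=; split.
    move=> /ex_K[k' kE]; have [x xE] := spX k'.
    exists (pY2 (q - jX x)); rewrite i2E prE rE zQE idQE.
    apply/eqP; rewrite eq_sym -subr_eq0 -linearB; apply/eqP/ex_m; exists x.
    by rewrite mE aE xE kE; congr (_, _); rewrite /= ?subr0 // opprB addrC subrK.
  move=> [y]; have [q' <-] := spY2 y; rewrite i2E prE rE zQE idQE => /eqP.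
  rewrite -subr_eq0 -linearB => /eqP/ex_m[x]; rewrite mE aE => -[/eqP].
  by rewrite sub0r -eqr_oppLR => /eqP <- _; rewrite linearN (ses_comp0 _ sK) oppr0.
- by have [g gE] := spL x; exists (pi (g, 0)); rewrite p2E pfsE fsE.
Qed.

Lemma Gproj_resolution_step M k : Gproj_resolution M k.+1 ->
  exists K G (i : {linear K -> G}) (p : {linear G -> M}),
    [/\ ses i p, Gorenstein_projective G & Gproj_resolution K k].
Proof.
move=> [G [d [e [gG G0 ex [ex_e se]]]]].
have [K [i si]] := ses_of_surj se; have [inj_i ex_i _] := si.
exists K, (G 0%N), i, e; split; [by []|exact: gG|].
have [|e' e'E] := factor_inj (f := d 0%N) inj_i.
  by move=> x; apply/ex_i/ex_e; exists x.
exists (fun n => G n.+1), (fun n => d n.+1), e'; split.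
- by move=> n le_n; apply: gG.
- by move=> n lt_n; apply: G0.
- by move=> n; apply: ex.
split=> [y|x].
  split=> [e'y|[x <-]]; first by apply/(ex 0%N); rewrite -e'E e'y linear0.
  by apply: inj_i; rewrite linear0 e'E; apply/(ex 0%N); exists x.
have /ex_e[y yE] : e (i x) = 0 by apply/ex_i; exists x.
by exists y; apply: inj_i; rewrite e'E.
Qed.

Lemma Gproj_resolution0 M : Gproj_resolution M 0 ->
  exists K G (i : {linear K -> G}) (p : {linear G -> M}),
    [/\ ses i p, Gorenstein_projective G & forall x : K, x = 0].
Proof.
move=> [G [d [e [gG G0 ex [ex_e se]]]]].
have [K [i si]] := ses_of_surj se; have [inj_i ex_i _] := si.
exists K, (G 0%N), i, e; split=> [//||x]; first exact: gG.
have /ex_e[y yE] : e (i x) = 0 by apply/ex_i; exists x.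
by apply: inj_i; rewrite -yE (G0 1%N _ y) // !linear0.
Qed.

Lemma approx_resolution k M : Gproj_resolution M k -> approx k M.
Proof.
elim: k M => [|k IHk] M.
  move=> /Gproj_resolution0[K [G [i [p [si /coresolved_Gorenstein gG K0]]]]].
  by exists K, G, i, p; split=> //; apply: fpd_zero.
move=> /Gproj_resolution_step[K [G [i [p [si /coresolved_Gorenstein gG /IHk aK]]]]].
exact: approx_step si gG aK.
Qed.

End Ext1.

(** * Higher Ext by dimension shifting *)

Section ExtVanishing.
Context (A : pzRingType).
Implicit Types (B C G H K L M N P Q R X Y Z : lmodType A).

(* [Ext_vanishes Y j M] says that Ext^(j+1)(M, Y) = 0. *)
Fixpoint Ext_vanishes Y (j : nat) M : Prop :=
  if j is j'.+1 then
    forall K R (i : {linear K -> R}) (p : {linear R -> M}),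
      ses i p -> projective R -> Ext_vanishes Y j' K
  else Ext1_vanishes M Y.

Lemma horseshoe L M N R R' (i : {linear L -> M}) (p : {linear M -> N})
    K (k : {linear K -> R}) (q : {linear R -> L})
    K' (k' : {linear K' -> R'}) (q' : {linear R' -> N}) :
  ses i p -> ses k q -> ses k' q' -> projective R' ->
  exists H (j : {linear H -> (R * R')%type}) (r : {linear (R * R')%type -> M})
    (a : {linear K -> H}) (b : {linear H -> K'}), ses j r /\ ses a b.
Proof.
move=> s [inj_k ex_k sq] [inj_k' ex_k' sq'] pR'; have [inj_i ex_i sp] := s.
have [iq iqE] := comp_linear q i; have [rho rhoE] := pR' _ _ p q' sp.
have [r rE] := copair_linear iq rho.
have sr : surj r.
  move=> m; have [y yE] := sq' (p m).
  have /ex_i[l lE] : p (m - rho y) = 0 by rewrite linearB rhoE yE subrr.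
  by have [x xE] := sq l; exists (x, y); rewrite rE iqE xE lE subrK.
have [H [j sj]] := ses_of_surj sr; have [inj_j ex_j _] := sj.
have pr z : p (r z) = q' z.2.
  by case: z => x y; rewrite rE linearD rhoE iqE (ses_comp0 _ s) add0r.
have [z0 z0E] := cst0_linear K R'; have [kl klE] := pair_linear k z0.
have [|a aE] := @factor_inj A K H _ j kl inj_j.
  move=> x; apply/ex_j; rewrite klE rE z0E linear0 addr0 iqE.
  by rewrite (_ : q (k x) = 0) ?linear0 //; apply/ex_k; exists x.
have [sn snE] := snd_linear R R'; have [js jsE] := comp_linear j sn.
have [|b bE] := @factor_inj A H K' _ k' js inj_k'.
  move=> h; apply/ex_k'; rewrite jsE snE -pr (_ : r (j h) = 0) ?linear0 //.
  by apply/ex_j; exists h.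
exists H, j, r, a, b; split=> //; split=> [x y /(congr1 j)|h|y].
- by rewrite !aE !klE => -[/inj_k].
- split=> [bh|[x <-]]; last first.
    by apply: inj_k'; rewrite bE jsE aE klE snE /= z0E linear0.
  have h2 : (j h).2 = 0 by rewrite -snE -jsE -bE bh linear0.
  have : r (j h) = 0 by apply/ex_j; exists h.
  rewrite [j h]surjective_pairing rE h2 linear0 addr0 iqE -(linear0 i).
  move=> /inj_i/ex_k[x xE]; exists x; apply: inj_j.
  by rewrite aE klE z0E xE -h2 -surjective_pairing.
- have /ex_i[l lE] : p (- rho (k' y)) = 0.
    rewrite linearN rhoE (_ : q' (k' y) = 0) ?oppr0 //; apply/ex_k'; by exists y.
  have [x xE] := sq l.
  have /ex_j[h hE] : r (x, k' y) = 0 by rewrite rE iqE xE lE addNr.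
  by exists h; apply: inj_k'; rewrite bE jsE hE snE.
Qed.

Lemma ses_kernel_quotient K R M N L H (i : {linear L -> M}) (p : {linear M -> N})
    (k : {linear K -> R}) (q : {linear R -> M})
    (k' : {linear H -> R}) (q' : {linear R -> N}) :
  ses i p -> ses k q -> ses k' q' -> (forall x, q' x = p (q x)) ->
  exists (a : {linear K -> H}) (b : {linear H -> L}), ses a b.
Proof.
move=> [inj_i ex_i sp] [inj_k ex_k sq] [inj_k' ex_k' sq'] q'E.
have [|a aE] := factor_inj (f := k) inj_k'.
  move=> x; apply/ex_k'; rewrite q'E (_ : q (k x) = 0) ?linear0 //.
  by apply/ex_k; exists x.
have [qk qkE] := comp_linear k' q.
have [|b bE] := factor_inj (f := qk) inj_i.
  by move=> h; apply/ex_i; rewrite qkE -q'E; apply/ex_k'; exists h.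
exists a, b; split=> [x y /(congr1 k')|h|l].
- by rewrite !aE => /inj_k.
- split=> [bh|[x <-]].
    have /ex_k[x xE] : q (k' h) = 0 by rewrite -qkE -bE bh linear0.
    by exists x; apply: inj_k'; rewrite aE.
  by apply: inj_i; rewrite bE qkE aE linear0; apply/ex_k; exists x.
- have [x xE] := sq (i l).
  have /ex_k'[h hE] : q' x = 0 by rewrite q'E xE; apply/ex_i; exists l.
  by exists h; apply: inj_i; rewrite bE qkE hE.
Qed.

(** This is exactness of Ext^(j+1)(M, Y) -> Ext^(j+1)(L, Y) -> Ext^(j+2)(N, Y). The horseshoe lemma
    passes to syzygies and lowers [j], so only [j = 0] needs a direct construction. *)
Lemma Ext_vanishes_left Y j L M N (i : {linear L -> M}) (p : {linear M -> N}) :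
  ses i p -> Ext_vanishes Y j M -> Ext_vanishes Y j.+1 N -> Ext_vanishes Y j L.
Proof.
elim: j L M N i p => [|j IHj] L M N i p s hM hN; last first.
  move=> K R k q sk pR.
  have [R' [q' [pR' sq']]] := free_cover N.
  have [K' [k' sk']] := ses_of_surj sq'.
  have [H [j' [r [a [b [sj sab]]]]]] := horseshoe s sk sk' pR'.
  apply: (IHj _ _ _ a b sab); first exact: hM sj (projective_prod pR pR').
  exact: hN sk' pR'.
have [R [q [pR sq]]] := free_cover N.
have [K [k sk]] := ses_of_surj sq.
have EK : Ext1_vanishes K Y := hN _ _ _ _ sk pR.
have [inj_i ex_i sp] := s; have [inj_k ex_k _] := sk.
have [rho rhoE] := pR _ _ p q sp.
move=> B C i' p' [inj_i' ex_i' sp'] u.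
(* The kernel [D] of [C * R -> M] is also an extension of [K] by [B]: [u] extends to [D] because
   Ext^1(K, Y) = 0, then to [C * R] because Ext^1(M, Y) = 0. *)
have [ip ipE] := comp_linear p' i.
have [t tE] := copair_linear ip rho.
have st : surj t.
  move=> m; have [y yE] := sq (p m).
  have /ex_i[l lE] : p (m - rho y) = 0 by rewrite linearB rhoE yE subrr.
  by have [c cE] := sp' l; exists (c, y); rewrite tE ipE cE lE subrK.
have [D [d sd]] := ses_of_surj st; have [inj_d ex_d _] := sd.
have [z0 z0E] := cst0_linear B R; have [il ilE] := pair_linear i' z0.
have [|a aE] := @factor_inj A B D _ d il inj_d.
  move=> b; apply/ex_d; rewrite ilE tE z0E linear0 addr0 ipE.
  by rewrite (_ : p' (i' b) = 0) ?linear0 //; apply/ex_i'; exists b.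
have [sn snE] := snd_linear C R; have [ds dsE] := comp_linear d sn.
have pt z : p (t z) = q z.2.
  by case: z => x y; rewrite tE linearD rhoE ipE (ses_comp0 _ s) add0r.
have [|b bE] := @factor_inj A D K _ k ds inj_k.
  move=> h; apply/ex_k; rewrite dsE snE -pt (_ : t (d h) = 0) ?linear0 //.
  by apply/ex_d; exists h.
have sab : ses a b.
  split=> [x y /(congr1 d)|h|y].
  - by rewrite !aE !ilE => -[/inj_i'].
  - split=> [bh|[x <-]]; last first.
      by apply: inj_k; rewrite bE dsE aE ilE snE /= z0E linear0.
    have h2 : (d h).2 = 0 by rewrite -snE -dsE -bE bh linear0.
    have : t (d h) = 0 by apply/ex_d; exists h.
    rewrite [d h]surjective_pairing tE h2 linear0 addr0 ipE -(linear0 i).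
    move=> /inj_i/ex_i'[x xE]; exists x; apply: inj_d.
    by rewrite aE ilE z0E xE -h2 -surjective_pairing.
  - have /ex_i[l lE] : p (- rho (k y)) = 0.
      rewrite linearN rhoE (_ : q (k y) = 0) ?oppr0 //; apply/ex_k; by exists y.
    have [c cE] := sp' l.
    have /ex_d[h hE] : t (c, k y) = 0 by rewrite tE ipE cE lE addNr.
    by exists h; apply: inj_k; rewrite bE dsE hE snE.
have [v vE] := EK _ _ _ _ sab u; have [w wE] := hM _ _ _ _ sd v.
have [ic icE] := id_linear C; have [zC zCE] := cst0_linear C R.
have [inc incE] := pair_linear ic zC; have [x xE] := comp_linear inc w.
by exists x => y; rewrite xE incE icE zCE -vE -wE aE ilE z0E.
Qed.

(** The kernel [H] of the composite [R -> N] is a syzygy of [N] and an extension of [L] by the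
    syzygy [K] of [M], so [Ext_vanishes_left] applies to it. *)
Lemma Ext_vanishes_ext Y j L M N (i : {linear L -> M}) (p : {linear M -> N}) :
  ses i p -> Ext_vanishes Y j L -> Ext_vanishes Y j N -> Ext_vanishes Y j M.
Proof.
case: j => [|j] s hL hN; first exact: Ext1_vanishes_ext s hL hN.
move=> K R k q sk pR.
have [pq pqE] := comp_linear q p; have [_ _ sp] := s; have [_ _ sq] := sk.
have [|H [k' sk']] := ses_of_surj (p := pq).
  by move=> n; have [m <-] := sp n; have [x <-] := sq m; exists x; rewrite pqE.
have [a [b sab]] := ses_kernel_quotient s sk sk' pqE.
by apply: (Ext_vanishes_left sab) => //; apply: hN sk' pR.
Qed.

Lemma Ext_vanishes_projective Y j P : projective P -> Ext_vanishes Y j P.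
Proof.
elim: j P => [|j IHj] P pP; first exact: Ext1_vanishes_projective.
move=> K R k q [inj_k ex_k sq] pR; apply: IHj.
have [iP iPE] := id_linear P; have [s sE] := pP _ _ q iP sq.
have [sq' sq'E] := comp_linear q s; have [iR iRE] := id_linear R.
have [e eE] := sub_linear iR sq'.
have [|r rE] := factor_inj (f := e) inj_k.
  by move=> x; apply/ex_k; rewrite eE iRE sq'E linearB sE iPE subrr.
apply: (projective_retract (s := k) (r := r)) => // x; apply: inj_k.
have qk : q (k x) = 0 by apply/ex_k; exists x.
by rewrite rE eE iRE sq'E qk linear0 subr0.
Qed.

(** The pullback of [R] and [M] over [N] splits as [L * R], because [R] is projective, and it is an
    extension of [M] by the syzygy [K]. *)
Lemma Ext_vanishes_right Y j L M N (i : {linear L -> M}) (p : {linear M -> N}) :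
  ses i p -> Ext_vanishes Y j L -> Ext_vanishes Y j.+1 M -> Ext_vanishes Y j.+1 N.
Proof.
move=> s hL hM K R k q sk pR.
have [inj_i ex_i sp] := s; have [inj_k ex_k sq] := sk.
have [rho rhoE] := pR _ _ p q sp.
have [t tE] := copair_linear i rho.
have [rk rkE] := comp_linear k rho.
have [|l lE] := factor_inj (f := rk) inj_i.
  by move=> x; apply/ex_i; rewrite rkE rhoE; apply/ex_k; exists x.
have [nl nlE] : exists nl : {linear K -> L}, forall x, nl x = - l x.
  by have [z zE] := cst0_linear K L; have [h hE] := sub_linear z l;
     exists h => x; rewrite hE zE sub0r.
have [a aE] := pair_linear nl k.
have sat : ses a t.
  split=> [x y|z|m].
  - by rewrite !aE => -[_ /inj_k].
  - case: z => x y; rewrite tE; split=> [tz|[w]].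
      have /ex_k[w wE] : q y = 0.
        have : p (i x + rho y) = 0 by rewrite tz linear0.
        by rewrite linearD rhoE (ses_comp0 _ s) add0r.
      exists w; rewrite aE wE nlE; congr (_, _); apply: inj_i.
      rewrite linearN lE rkE wE; apply/eqP.
      by rewrite eqr_oppLR -addr_eq0 addrC tz.
    by rewrite aE nlE => -[<- <-]; rewrite linearN lE rkE addNr.
  - have [y yE] := sq (p m).
    have /ex_i[x xE] : p (m - rho y) = 0 by rewrite linearB rhoE yE subrr.
    by exists (x, y); rewrite tE xE subrK.
have hLR : Ext_vanishes Y j (L * R)%type.
  have [il ilE] := id_linear L; have [z zE] := cst0_linear L R.
  have [inl inlE] := pair_linear il z; have [sn snE] := snd_linear L R.
  apply: (@Ext_vanishes_ext Y j L _ R inl sn) => //; last exact: Ext_vanishes_projective.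
  split=> [x y|[x y]|y].
  - by rewrite !inlE !ilE => -[].
  - rewrite snE /=; split=> [->|[w]]; first by exists x; rewrite inlE ilE zE.
    by rewrite inlE zE => -[].
  - by exists (0, y); rewrite snE.
exact: (Ext_vanishes_left sat hLR hM).
Qed.

Lemma Ext_vanishes_syzygy Y j K R M (i : {linear K -> R}) (p : {linear R -> M}) :
  ses i p -> projective R -> Ext_vanishes Y j K -> Ext_vanishes Y j.+1 M.
Proof. by move=> s pR hK; apply: (Ext_vanishes_right s hK); apply: Ext_vanishes_projective. Qed.

Lemma Ext_vanishes_zero Y j M : (forall x : M, x = 0) -> Ext_vanishes Y j M.
Proof. by move=> M0; apply/Ext_vanishes_projective/projective_zero. Qed.

Lemma Ext_vanishes_iso Y j L M (i : {linear L -> M}) :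
  injective i -> surj i -> Ext_vanishes Y j L -> Ext_vanishes Y j M.
Proof.
move=> inj_i si hL; have [N [p s]] := ses_of_inj inj_i.
apply: (Ext_vanishes_ext s hL); apply: Ext_vanishes_zero => n; have [_ ex_i sp] := s.
by have [m <-] := sp n; apply/ex_i; apply: si.
Qed.

Lemma Ext_vanishes_retract Y j M M1 (s : {linear M1 -> M}) (r : {linear M -> M1}) :
  (forall x, r (s x) = x) -> Ext_vanishes Y j M -> Ext_vanishes Y j M1.
Proof.
elim: j M M1 s r => [|j IHj] M M1 s r rs hM; first exact: Ext1_vanishes_retract hM.
move=> K1 R1 k1 q1 sk1 pR1.
have [R [q [pR sq]]] := free_cover M.
have [K [k sk]] := ses_of_surj sq.
have [inj_k ex_k _] := sk; have [inj_k1 ex_k1 sq1] := sk1.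
have [rq rqE] := comp_linear q r; have [sq1' sq1'E] := comp_linear q1 s.
(* Covering [M] by [R1 * R], with [R1] acting through [s], makes the kernel [H] retract onto the
   prescribed syzygy [K1] of [M1]. *)
have [t tE] := copair_linear sq1' q.
have st : surj t by move=> m; have [x <-] := sq m; exists (0, x); rewrite tE linear0 add0r.
have [H [h sh]] := ses_of_surj st; have [inj_h ex_h _] := sh.
have hH := hM _ _ _ _ sh (projective_prod pR1 pR).
have [z zE] := cst0_linear K1 R; have [kz kzE] := pair_linear k1 z.
have [|a aE] := @factor_inj A K1 H _ h kz inj_h.
  move=> x; apply/ex_h; rewrite kzE tE zE linear0 addr0 sq1'E.
  by rewrite (ses_comp0 _ sk1) linear0.
have [rho rhoE] := pR _ _ q1 rq sq1.
have [iR1 iR1E] := id_linear R1; have [u uE] := copair_linear iR1 rho.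
have [hu huE] := comp_linear h u.
have qu w : q1 (u w) = r (t w).
  by case: w => x y; rewrite uE tE !linearD rhoE rqE iR1E sq1'E rs.
have [|b bE] := factor_inj (f := hu) inj_k1.
  by move=> x; apply/ex_k1; rewrite huE qu (ses_comp0 _ sh) linear0.
apply: (IHj H K1 a b) => // x; apply: inj_k1.
by rewrite bE huE aE kzE uE zE linear0 addr0 iR1E.
Qed.

Lemma Ext_vanishes_Gorenstein Y j G : projective Y -> Gorenstein_projective G -> Ext_vanishes Y j G.
Proof.
move=> pY [P [d [pP ex hP [k [p kp]]]]].
have dd i x : d i (d (i + 1) x) = 0 by apply/(ex i); exists x.
elim: j k G p kp => [|j IHj] k G p kp.
  exact: (Ext1_vanishes_cokernel pP dd kp (hP _ pY)).
have [K [i si]] := ses_of_surj kp.2; have [inj_i ex_i _] := si.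
apply: (Ext_vanishes_syzygy si (pP k)).
have [|q qE] := factor_inj (f := d k) inj_i.
  by move=> x; apply/ex_i/kp.1; exists x.
apply: (IHj (k + 1) K q); split=> [y|x].
  split=> [qy|[x <-]]; first by apply/(ex k); rewrite -qE qy linear0.
  by apply: inj_i; rewrite linear0 qE dd.
have /kp.1[y yE] : p (i x) = 0 by apply/ex_i; exists x.
by exists y; apply: inj_i; rewrite qE.
Qed.

Lemma Ext_vanishes_Gproj_resolution Y j n M : projective Y -> Gproj_resolution M n ->
  (n <= j)%N -> Ext_vanishes Y j M.
Proof.
move=> pY; elim: n j M => [|n IHn] [|j] M //.
- move=> /Gproj_resolution0[K [G [i [p [s gG K0]]]]] _; have [inj_i ex_i sp] := s.
  apply: (Ext_vanishes_iso _ sp); last exact: Ext_vanishes_Gorenstein.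
  by apply: linear_inj => x /ex_i[y <-]; rewrite (K0 y) linear0.
- move=> /Gproj_resolution0[K [G [i [p [s gG K0]]]]] _.
  by apply: (Ext_vanishes_right s); [apply: Ext_vanishes_zero | apply: Ext_vanishes_Gorenstein].
- move=> /Gproj_resolution_step[K [G [i [p [s gG gK]]]]] le_nj.
  by apply: (Ext_vanishes_right s); [apply: IHn | apply: Ext_vanishes_Gorenstein].
Qed.

End ExtVanishing.

(** * Finiteness over the base ring *)

Section CentralAction.
Context (R : comPzRingType) (A : pzRingType) (phi : {rmorphism R -> A}).
Implicit Types (V W : lmodType A).

(** [R] acts on [A]-modules only through [phi]; keeping its submodules as sets avoids a second
    module structure on the same carrier. *)
Definition rsub V (X : set V) : Prop :=
  X 0 /\ forall r x y, X x -> X y -> X (phi r *: x + y).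

Lemma lsub_rsub V (X : set V) : lsub X -> rsub X.
Proof. by case=> X0 linX; split=> // r x y; apply: linX. Qed.

Lemma rsubD V (X : set V) x y : rsub X -> X x -> X y -> X (x + y).
Proof. by move=> [_ h] Xx Xy; have := h 1 x y Xx Xy; rewrite rmorph1 scale1r. Qed.

Lemma rsubZ V (X : set V) r x : rsub X -> X x -> X (phi r *: x).
Proof. by move=> [h0 h] Xx; have := h r x 0 Xx h0; rewrite addr0. Qed.

Lemma rsubN V (X : set V) x : rsub X -> X x -> X (- x).
Proof.
by move=> hX Xx; have := rsubZ (-1) hX Xx; rewrite rmorphN1 scaleN1r.
Qed.

Lemma rsubB V (X : set V) x y : rsub X -> X x -> X y -> X (x - y).
Proof. by move=> hX Xx Xy; apply: rsubD => //; apply: rsubN. Qed.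

Fixpoint rspan V (s : seq V) (x : V) : Prop :=
  if s is y :: s' then exists r z, rspan s' z /\ x = phi r *: y + z else x = 0.

Lemma rspan_rsub V (s : seq V) : rsub (rspan s).
Proof.
elim: s => [|y s [IH0 IH]] /=.
  by split=> // r x y -> ->; rewrite scaler0 addr0.
split; first by exists 0, 0; rewrite rmorph0 scale0r addr0.
move=> r _ _ [a [z [sz ->]]] [b [w [sw ->]]].
exists (r * a + b), (phi r *: z + w); split; first exact: IH.
by rewrite rmorphD rmorphM scalerDl scalerDr scalerA addrACA.
Qed.

Lemma rspan_cons V (s : seq V) y x : rspan s x -> rspan (y :: s) x.
Proof. by move=> sx; exists 0, x; rewrite rmorph0 scale0r add0r. Qed.

Lemma rspan_mem V (s : seq V) x : x \in s -> rspan s x.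
Proof.
elim: s => // y s IHs; rewrite inE => /orP[/eqP->|/IHs]; last exact: rspan_cons.
exists 1, 0; rewrite rmorph1 scale1r addr0; split=> //.
by have [] := rspan_rsub s.
Qed.

Lemma rspan_sub V (s : seq V) (X : set V) x :
  rsub X -> (forall y, y \in s -> X y) -> rspan s x -> X x.
Proof.
move=> hX; elim: s x => [|y s IHs] x sX /=; first by move=> ->; case: hX.
move=> [r [z [sz ->]]]; have [_] := hX; apply; first exact: sX (mem_head _ _).
by apply: IHs => // w ws; apply: sX; rewrite inE ws orbT.
Qed.

Definition fgR V : Prop := exists s : seq V, forall x, rspan s x.

Lemma fgR_quotient V W (p : {linear V -> W}) : surj p -> fgR V -> fgR W.
Proof.
move=> sp [s sP]; exists (map p s) => w; have [v <-] := sp w.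
move: (sP v) => {sP}; elim: s v => [|y s IHs] v /=; first by move=> ->; rewrite linear0.
by move=> [r [z [sz ->]]]; exists r, (p z); rewrite linearP; split=> //; apply: IHs.
Qed.

Context (noethR : noetherian R).

(** The coefficients at [y] of elements of [X] form an ideal [I]. Lifts of generators of [I],
    together with generators of the part of [X] spanned by the remaining elements, generate [X]. *)
Lemma rsub_fg_span V (s : seq V) (X : set V) :
  rsub X -> (forall x, X x -> rspan s x) ->
  exists t : seq V, (forall y, y \in t -> X y) /\ forall x, X x -> rspan t x.
Proof.
elim: s X => [|y s IHs] X hX sX; first by exists [::].
pose I : set R^o := fun r => exists z, rspan s z /\ X (phi r *: y + z).
have hI : lsub I.
  split=> [|r a b [z [sz Xz]] [w [sw Xw]]].
    by exists 0; rewrite rmorph0 scale0r addr0; split; case: (rspan_rsub s); case: hX.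
  exists (phi r *: z + w); split; first by have [_] := rspan_rsub s; apply.
  rewrite -[r *: a]/(r * a) rmorphD rmorphM scalerDl -scalerA.
  by rewrite addrACA -scalerDr; have [_] := hX; apply.
have [n [v vP]] := noethR (pred_of_closed hI).
have /choice[z zP] : forall i, I (v i).
  move=> i; apply/pred_ofP/vP; exists (fun j => (j == i)%:R).
  rewrite (bigD1 i) //= eqxx scale1r big1 ?addr0 // => j /negPf->.
  by rewrite scale0r.
have hX' : rsub [set x | X x /\ rspan s x].
  have [s0 linS] := rspan_rsub s; have [X0 linX] := hX.
  by split=> // r a b [? ?] [? ?]; split; [apply: linX | apply: linS].
have [|t [tX tP]] := IHs _ hX'; first by move=> x [].
pose t1 := [seq phi (v i) *: y + z i | i <- enum 'I_n].
exists (t1 ++ t); split=> [w|x Xx].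
  rewrite mem_cat => /orP[/mapP[i _ ->]|/tX[]//]; by have [] := zP i.
have [r [w [sw xE]]] := sX x Xx.
have /pred_ofP/vP[c rE] : I r by exists w; rewrite -xE.
have hT := rspan_rsub (t1 ++ t).
have sumT (F : 'I_n -> V) (Y : set V) : rsub Y -> (forall i, Y (F i)) -> Y (\sum_i F i).
  by move=> hY YF; apply: big_ind => // [|a b]; [case: hY | apply: rsubD].
(* [x1] is an element of [X] with the same coefficient at [y] as [x], so the difference falls under
   the induction hypothesis. *)
pose x1 := \sum_i phi (c i) *: (phi (v i) *: y + z i).
have T1 : rspan (t1 ++ t) x1.
  apply: sumT => // i; apply: rsubZ => //; apply: rspan_mem.
  by rewrite mem_cat; apply/orP; left; apply/mapP; exists i; rewrite ?mem_enum.
have X1 : X x1 by apply: sumT => // i; apply: rsubZ => //; have [] := zP i.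
have xx1 : x - x1 = w - \sum_i phi (c i) *: z i.
  rewrite xE rE rmorph_sum scaler_suml /x1.
  under [in X in _ - X]eq_bigr do rewrite scalerDr scalerA -rmorphM.
  by rewrite big_split /= opprD addrACA subrr add0r.
rewrite -(subrK x1 x) addrC; apply: rsubD => //.
have : rspan t (x - x1).
  apply: tP; split; first exact: rsubB.
  rewrite xx1; apply: rsubB => //; first exact: rspan_rsub.
  apply: sumT => [|i]; first exact: rspan_rsub.
  by apply: rsubZ; [apply: rspan_rsub | have [] := zP i].
apply: rspan_sub => // u ut; apply: rspan_mem.
by rewrite mem_cat ut orbT.
Qed.

Lemma rsub_fg V (X : set V) : fgR V -> rsub X ->
  exists t : seq V, (forall y, y \in t -> X y) /\ forall x, X x -> rspan t x.
Proof. by move=> [s sP] hX; apply: (rsub_fg_span (s := s)) => // x _. Qed.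

Lemma fgR_sub V W (i : {linear W -> V}) : injective i -> fgR V -> fgR W.
Proof.
move=> inj_i fV.
have [t [tX tP]] := rsub_fg fV (lsub_rsub (lsub_im i)).
have /choice[g gP] : forall v, exists w, (exists w, i w = v) -> i w = v.
  by move=> v; have [[w wE]|nw] := pselect (exists w, i w = v);
     [exists w | exists 0 => /nw].
exists (map g t) => w; have /tP : exists w', i w' = i w by exists w.
have : forall y, y \in t -> i (g y) = y by move=> y /tX/gP.
elim: t {tX tP} w => [|y t IHt] w gt /=.
  by move=> iw; apply: inj_i; rewrite iw linear0.
move=> [r [z [tz iwE]]]; exists r, (w - phi r *: g y); split; last by rewrite addrC subrK.
apply: IHt => [u ut|]; first by apply: gt; rewrite inE ut orbT.
by rewrite linearB linearZ gt ?mem_head // iwE addrC addKr.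
Qed.

(** The ascending chain condition: a strictly increasing chain, produced by choice, would have a
    finitely generated union, already contained in one of its terms. *)
Lemma rsub_max V (F : set (set V)) : fgR V -> (forall X, F X -> rsub X) ->
  (exists X, F X) -> exists2 X, F X & forall Y, F Y -> X `<=` Y -> Y `<=` X.
Proof.
move=> fV hF [X0 FX0]; apply: contrapT => nmax.
have /choice[next nextP] : forall X, exists Y, F X ->
    [/\ F Y, X `<=` Y & exists2 y, Y y & ~ X y].
  move=> X; have [FX|nFX] := pselect (F X); last by exists X => /nFX.
  apply: contrapT => nY; apply: nmax; exists X => // Y FY XY y Yy.
  by apply: contrapT => nXy; apply: nY; exists Y => _; split=> //; exists y.
pose C n := iter n next X0.
have FC n : F (C n) by elim: n => //= n /nextP[].
have CS m n : (m <= n)%N -> C m `<=` C n.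
  elim: n => [|n IHn]; first by rewrite leqn0 => /eqP->.
  rewrite leq_eqVlt => /orP[/eqP-> //|/IHn mn].
  by apply: subset_trans mn _; have [] := nextP _ (FC n).
pose U : set V := fun x => exists n, C n x.
have hU : rsub U.
  split; first by exists 0%N; have [] := hF _ (FC 0%N).
  move=> r x y [m mx] [n ny]; exists (maxn m n).
  have [_] := hF _ (FC (maxn m n)); apply.
    by apply: (CS m) => //; apply: leq_maxl.
  by apply: (CS n) => //; apply: leq_maxr.
have [t [tU tP]] := rsub_fg fV hU.
have [N tN] : exists N, forall y, y \in t -> C N y.
  elim: t tU {tP} => [|y t IHt] tU; first by exists 0%N.
  have [|N tN] := IHt; first by move=> z zt; apply: tU; rewrite inE zt orbT.
  have [n yn] := tU y (mem_head _ _); exists (maxn N n) => z.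
  rewrite inE => /orP[/eqP->|/tN zN]; first by apply: (CS n) => //; apply: leq_maxr.
  by apply: (CS N) => //; apply: leq_maxl.
have [_ _ [y yS nyN]] := nextP _ (FC N).
by apply: nyN; apply: (rspan_sub (hF _ (FC N)) tN); apply: tP; exists N.+1.
Qed.

End CentralAction.

Section MaximalIdeal.
Context (R : comPzRingType) (A : pzRingType) (phi : {rmorphism R -> A}).
Context (noethR : noetherian R).
Context (fgA : fgR phi A^o).

Lemma maximal_ex (X : set A^o) : lsub X -> ~ X 1 ->
  exists2 I : {pred A^o}, maximal_submod I & forall a, X a -> a \in I.
Proof.
move=> hX nX1.
have [||I [hI nI1 XI] maxI] := @rsub_max R A phi noethR A^o
    [set Y : set A^o | [/\ lsub Y, ~ Y 1 & X `<=` Y]] fgA.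
  by move=> Y [/(lsub_rsub phi)].
  by exists X; split.
exists (pred_of I); last by move=> a /XI Ia; apply/pred_ofP.
split; first exact: pred_of_closed.
  by exists 1; apply/negP => /pred_ofP.
move=> K [K0 linK] IK [x /negP nKx] y Ky; apply/pred_ofP.
apply: (maxI [set z | z \in K]) => //=; last by move=> z Iz; apply: IK; apply/pred_ofP.
split=> // [K1|z Xz]; last by apply: IK; apply/pred_ofP/XI.
apply: nKx; rewrite -[x]addr0 -[x]mulr1; exact: linK.
Qed.

Lemma maximal_proper (I : {pred A^o}) : maximal_submod I -> (1 : A^o) \notin I.
Proof.
move=> [[I0 linI] [x nIx] _]; apply: contra nIx => I1.
by rewrite -[x]addr0 -[x]mulr1; apply: linI.
Qed.

Lemma maximal_inv (I : {pred A^o}) (w : A) : maximal_submod I -> (w : A^o) \notin I ->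
  exists b : A, ((1 - b * w : A) : A^o) \in I.
Proof.
move=> mI nIw; have [[I0 linI] _ maxI] := mI.
pose K : set A^o := fun x => exists b : A, ((x : A) - b * w : A^o) \in I.
have hK : lsub K.
  split=> [|a x y [b bP] [c cP]]; first by exists 0; rewrite mul0r subr0.
  exists (a * b + c); rewrite mulrDl opprD addrACA -mulrA.
  by have := linI a _ _ bP cP; rewrite scalerBr.
have IK : {subset I <= pred_of K}.
  by move=> x Ix; apply/pred_ofP; exists 0; rewrite mul0r subr0.
apply: contrapT => nb; case/negP: nIw.
apply: (maxI _ (pred_of_closed hK) IK).
  by exists 1; apply/negP => /pred_ofP[b bP]; apply: nb; exists b.
by apply/pred_ofP; exists 1; rewrite mul1r subrr.
Qed.

Lemma jacobson_left_inv (y : A) : (y : A^o) \in @jacobson A -> exists u, u * (1 - y) = 1.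
Proof.
move=> /jacobsonP Jy.
pose X : set A^o := fun x => exists u : A, u * (1 - y) = x.
have hX : lsub X.
  split=> [|a _ _ [u <-] [v <-]]; first by exists 0; rewrite mul0r.
  by exists (a * u + v); rewrite mulrDl -mulrA.
apply: contrapT => nX1; have [I mI XI] := maximal_ex hX nX1.
have [[I0 linI] _ _] := mI.
case/negP: (maximal_proper mI).
have -> : (1 : A^o) = 1 *: (1 - y : A^o) + y by rewrite scale1r subrK.
by apply: linI (Jy _ mI); apply: XI; exists 1; rewrite mul1r.
Qed.

End MaximalIdeal.

(** * Semilocal base ring: Nakayama's lemma and length *)

Section Semilocal.
Context (R : comPzRingType) (noethR : noetherian R).

Lemma fgR_regular : fgR (@idfun R : {rmorphism R -> R}) R^o.
Proof. by exists [:: 1] => x; exists x, 0; rewrite addr0 -[_ *: _]/(x * 1) mulr1. Qed.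

Lemma rad_inv (x r : R) : (x : R^o) \in @jacobson R -> exists u : R, u * (1 - x * r) = 1.
Proof.
move=> Jx; apply: (jacobson_left_inv noethR fgR_regular).
exact: jacobson_mulr.
Qed.

Context (slR : semilocal R).

(** If each of the finitely many maximal ideals had an element outside [P], the product of these
    elements would lie outside [P] and yet in the radical. *)
Lemma prime_maximal (P : set R^o) : lsub P -> ~ P 1 ->
  (forall r s : R, P (r * s) -> P r \/ P s) ->
  (forall x : R^o, x \in @jacobson R -> P x) ->
  exists2 I : {pred R^o}, maximal_submod I & forall x, x \in I -> P x.
Proof.
move=> hP nP1 primeP radP; apply: contrapT => nI.
have /finite_seqP[s sE] := slR.
have : forall t : seq {pred R^o}, (forall I, I \in t -> maximal_submod I) ->
    exists2 x : R, ~ P x & forall I, I \in t -> (x : R^o) \in I.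
  elim=> [|I t IHt] tM; first by exists 1.
  have [|x nPx xt] := IHt; first by move=> K Kt; apply: tM; rewrite inE Kt orbT.
  have mI := tM I (mem_head _ _).
  have [y Iy nPy] : exists2 y, y \in I & ~ P y.
    apply: contrapT => nIy; apply: nI; exists I => // y Iy.
    by apply: contrapT => nPy; apply: nIy; exists y.
  exists (x * y); first by move=> /primeP[].
  move=> K; rewrite inE => /orP[/eqP->|/[dup] Kt /xt Kx].
    by have [[I0 linI] _ _] := mI; rewrite -[x * y]addr0; apply: (linI x y 0).
  have [[K0 linK] _ _] : maximal_submod K by apply: tM; rewrite inE Kt orbT.
  by rewrite mulrC -[y * x]addr0; apply: (linK y x 0).
have sM I : I \in s -> maximal_submod I.
  by move=> Is; have : [set` s] I by []; rewrite -sE.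
move=> /(_ s sM)[x nPx xs]; apply/nPx/radP/jacobsonP => I mI; apply: xs.
have : [set I : {pred R^o} | maximal_submod I] I by [].
by rewrite sE.
Qed.

Context (A : pzRingType) (phi : {rmorphism R -> A}).
Implicit Types (V : lmodType A).

(** Generators of [Z] modulo [B] are eliminated one at a time, since the relation for the first has
    the invertible coefficient [1 - x * r1]. The form with two sets avoids [Z / B], which is only an
    [R]-module. *)
Lemma nakayama V (Z B : set V) (x : R) : fgR phi V -> rsub phi Z -> rsub phi B ->
  (x : R^o) \in @jacobson R ->
  (forall z, Z z -> exists2 z', Z z' & B (z - phi x *: z')) -> Z `<=` B.
Proof.
move=> fV hZ hB radx ZxZ; have [t [tZ tP]] := rsub_fg noethR fV hZ.
have : Z `<=` [set z | exists b w, [/\ B b, rspan phi t w & z = b + w]].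
  by move=> z Zz; exists 0, z; rewrite add0r; split; [case: hB | apply: tP |].
elim: t tZ {tP} => [|y t IHt] tZ Zt z Zz.
  by have [b [_ [Bb -> ->]]] := Zt z Zz; rewrite addr0.
apply: IHt z Zz => [w wt|z /Zt[b [_ [Bb [r [w [tw ->]]] ->]]]].
  by apply: tZ; rewrite inE wt orbT.
have [z' /Zt[b1 [_ [Bb1 [r1 [w1 [tw1 ->]]] ->]]] Byz] := ZxZ y (tZ _ (mem_head _ _)).
have ht := rspan_rsub phi t.
have [u uE] := rad_inv r1 radx.
set b2 := y - _ in Byz.
(* This solves [(1 - x r1) y = b2 + x b1 + x w1] for [y]. *)
have yE : y = phi u *: (b2 + phi x *: b1) + phi u *: (phi x *: w1).
  rewrite -[LHS]scale1r -[in LHS](rmorph1 phi) -uE rmorphM -scalerA -scalerDr.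
  congr (_ *: _); rewrite rmorphB rmorph1 scalerBl scale1r rmorphM -scalerA.
  rewrite /b2 !scalerDr -!addrA; congr (_ + _).
  by rewrite [phi x *: b1 + _]addrCA opprD -addrA addNr addr0.
have linB := hB.2; have lint := ht.2.
exists (phi r *: (phi u *: (b2 + phi x *: b1)) + b),
  (phi r *: (phi u *: (phi x *: w1)) + w); split.
- by apply: linB => //; apply: (rsubZ _ hB); apply: (rsubD hB) => //; apply: (rsubZ _ hB).
- by apply: lint => //; apply: (rsubZ _ ht); apply: (rsubZ _ ht).
- by rewrite {1}yE [phi r *: _]scalerDr -!addrA [in RHS]addrCA.
Qed.

(** A maximal member among the annihilators, modulo [U], of elements outside [U] is a prime ideal.
    Local nilpotence puts the radical inside it, hence it contains a maximal ideal. *)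
Lemma associated_maximal V (U : set V) (a : V) : rsub phi U -> ~ U a ->
  (forall x : R, (x : R^o) \in @jacobson R -> forall y, exists k, U (phi (x ^+ k) *: y)) ->
  exists2 y, ~ U y & exists2 I : {pred R^o}, maximal_submod I &
    forall r : R, (r : R^o) \in I -> U (phi r *: y).
Proof.
move=> hU nUa radU; pose ann y : set R^o := fun r => U (phi r *: y).
have hann y : lsub (ann y).
  split=> [|r b c Ub Uc]; first by rewrite /ann rmorph0 scale0r; case: hU.
  rewrite /ann rmorphD rmorphM scalerDl -scalerA; have [_] := hU; exact.
have [||P [y nUy ->] maxP] := @rsub_max R R idfun noethR R^o
    [set P | exists2 y, ~ U y & P = ann y] fgR_regular.
- by move=> _ [y _ ->]; apply: lsub_rsub.
- by exists (ann a), a.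
exists y => //; apply: (@prime_maximal (ann y)) => //.
- by rewrite /ann rmorph1 scale1r.
- move=> r s rs; have [ys|nys] := pselect (ann y s); [by right | left].
  apply: (maxP (ann (phi s *: y))); first by exists (phi s *: y).
    move=> t; rewrite /ann => Ut; rewrite scalerA -rmorphM mulrC rmorphM -scalerA.
    exact: rsubZ.
  by rewrite /ann scalerA -rmorphM.
- move=> x /radU/(_ y)[k]; elim: k => [|k IHk].
    by rewrite expr0 rmorph1 scale1r => /nUy.
  have [Uk _|nUk] := pselect (U (phi (x ^+ k) *: y)); first exact: IHk.
  rewrite exprSr => Uxk.
  apply: (maxP (ann (phi (x ^+ k) *: y))); first by exists (phi (x ^+ k) *: y).
    move=> t; rewrite /ann => Ut; rewrite scalerA -rmorphM mulrC rmorphM -scalerA.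
    exact: rsubZ.
  by rewrite /ann scalerA -rmorphM mulrC.
Qed.

Definition span_over V (V0 : set V) (s : seq V) : set V :=
  fun x => exists b w, [/\ V0 b, rspan phi s w & x = b + w].

Lemma span_over_rsub V (V0 : set V) s : rsub phi V0 -> rsub phi (span_over V0 s).
Proof.
move=> [h0 hlin]; have [s0 slin] := rspan_rsub phi s; split.
  by exists 0, 0; rewrite addr0.
move=> r _ _ [b [w [? ? ->]]] [c [v [? ? ->]]].
exists (phi r *: b + c), (phi r *: w + v); split; [exact: hlin|exact: slin|].
by rewrite scalerDr addrACA.
Qed.

Lemma span_over_cons V (V0 : set V) s y x : span_over V0 (y :: s) x <->
  exists r z, span_over V0 s z /\ x = phi r *: y + z.
Proof.
split=> [[b [_ [Vb [r [w [sw ->]] ->]]]]|[r [_ [[b [w [Vb sw ->]]] ->]]]].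
  by exists r, (b + w); split; [exists b, w | rewrite addrCA].
by exists b, (phi r *: y + w); split; [|exists r, w|rewrite addrCA].
Qed.

(** The list is read from its tail, the head generating the top step. A step is simple or zero over
    [R], since its generator may already lie in the previous one. *)
Fixpoint simple_chain V (V0 : set V) (s : seq V) : Prop :=
  if s is y :: s' then
    simple_chain V0 s' /\
    exists2 I : {pred R^o}, maximal_submod I &
      forall r : R, (r : R^o) \in I -> span_over V0 s' (phi r *: y)
  else True.

Lemma simple_chain_ex V (V0 : set V) : fgR phi V -> rsub phi V0 ->
  (forall x : R, (x : R^o) \in @jacobson R -> forall y, exists k, V0 (phi (x ^+ k) *: y)) ->
  exists2 s, simple_chain V0 s & forall x, span_over V0 s x.
Proof.
move=> fV hV0 radV.
have [||_ [s cs ->] maxs] := @rsub_max R A phi noethR V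
    [set X | exists2 s, simple_chain V0 s & X = span_over V0 s] fV.
- by move=> _ [s _ ->]; apply: span_over_rsub.
- by exists (span_over V0 [::]), [::].
exists s => // x; apply: contrapT => nsx.
have V0s : V0 `<=` span_over V0 s.
  by move=> v V0v; exists v, 0; rewrite addr0; split=> //; case: (rspan_rsub phi s).
have [||y nsy [I mI Iy]] := associated_maximal _ nsx _; first exact: span_over_rsub.
  by move=> r /radV rV v; have [k rk] := rV v; exists k; apply: V0s.
apply: nsy; apply: (maxs (span_over V0 (y :: s))).
- by exists (y :: s) => //; split=> //; exists I.
- move=> z sz; apply/span_over_cons; exists 0, z.
  by rewrite rmorph0 scale0r add0r.
apply/span_over_cons; exists 1, 0; rewrite rmorph1 scale1r addr0; split=> //.
by have [] := span_over_rsub s hV0.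
Qed.

(* The number of steps of the chain at which [U] grows: a strictly monotone
   length, because the steps have simple quotients. *)
Fixpoint chain_length V (V0 : set V) (U : set V) (s : seq V) : nat :=
  if s is y :: s' then
    (chain_length V0 U s' +
     `[< exists u, [/\ U u, span_over V0 s u & ~ span_over V0 s' u] >])%N
  else 0%N.

Lemma chain_length_mono V (V0 U U' : set V) s : U `<=` U' ->
  (chain_length V0 U s <= chain_length V0 U' s)%N.
Proof.
move=> UU'; elim: s => //= y s IHs; apply: leq_add => //.
case: asboolP => // [[u [/UU' Uu su nsu]]]; case: asboolP => // nu.
by case: nu; exists u.
Qed.

(** Each step contributes at most as much for [U] as for [U'], so equal totals agree step by step.
    At a step where [U'] grows, some [u] in [U] has a coefficient [r] outside the maximal ideal; as
    [r] is invertible modulo it, subtracting a multiple of [u] moves [x] one step down. *)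
Lemma chain_length_eq V (V0 U U' : set V) s : rsub phi V0 -> rsub phi U -> rsub phi U' ->
  simple_chain V0 s -> V0 `<=` U -> U `<=` U' ->
  chain_length V0 U s = chain_length V0 U' s ->
  forall x, U' x -> span_over V0 s x -> U x.
Proof.
move=> hV0 hU hU' + V0U UU'; elim: s => [_ _ x _|y s IHs] /=.
  by move=> [b [_ [V0b -> ->]]]; rewrite addr0; apply: V0U.
move=> [cs [I mI Iy]] lE x U'x sx.
set p := `[< _ >] in lE; set q := `[< _ >] in lE.
have le1 := chain_length_mono V0 s UU'.
have le2 : (p <= q)%N.
  rewrite /p /q; case: asboolP => // [[u [/UU' Uu su nsu]]]; case: asboolP => // nu.
  by case: nu; exists u.
have [lE1 lE2] : chain_length V0 U s = chain_length V0 U' s /\ p = q.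
  have : (chain_length V0 U' s <= chain_length V0 U s)%N.
    by rewrite -(leq_add2r q) -lE leq_add2l.
  move=> le3; have e : chain_length V0 U s = chain_length V0 U' s.
    by apply/eqP; rewrite eqn_leq le1.
  by split=> //; move: lE; rewrite e => /addnI; case: (p) (q) => [] [].
have [sx'|nsx] := pselect (span_over V0 s x); first exact: IHs.
have qT : q by apply/asboolP; exists x.
have /asboolP[u [Uu /span_over_cons[r [z [sz uE]]] nsu]] : p by rewrite lE2.
have hs := span_over_rsub s hV0.
have nIr : (r : R^o) \notin I.
  by apply/negP => /Iy ry; apply: nsu; rewrite uE; apply: rsubD hs _ sz.
have [b Ib] := maximal_inv mI nIr.
move/span_over_cons: (sx) => [r' [z' [sz' xE]]].
have -> : x = (x - phi (r' * b) *: u) + phi (r' * b) *: u by rewrite subrK.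
apply: (rsubD hU); last exact: rsubZ.
apply: IHs => //; first by apply: (rsubB hU') => //; apply: (rsubZ _ hU'); apply: UU'.
have -> : x - phi (r' * b) *: u =
    phi r' *: (phi (1 - b * r) *: y) + (z' - phi (r' * b) *: z).
  rewrite xE uE scalerDr opprD addrACA; congr (_ + _).
  by rewrite !scalerA -!rmorphM -scalerBl -rmorphB mulrBr mulr1 mulrA.
apply: (rsubD hs); first by apply: (rsubZ _ hs); apply: Iy.
by apply: (rsubB hs) => //; apply: (rsubZ _ hs).
Qed.

Lemma rsub_min V (V0 : set V) (F : set (set V)) : fgR phi V -> rsub phi V0 ->
  (forall x : R, (x : R^o) \in @jacobson R -> forall y, exists k, V0 (phi (x ^+ k) *: y)) ->
  (forall X, F X -> rsub phi X /\ V0 `<=` X) -> (exists X, F X) ->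
  exists2 X, F X & forall Y, F Y -> Y `<=` X -> X `<=` Y.
Proof.
move=> fV hV0 radV hF [X0 FX0]; have [s cs sT] := simple_chain_ex fV hV0 radV.
have exn : exists n, `[< exists2 X, F X & chain_length V0 X s = n >].
  by exists (chain_length V0 X0 s); apply/asboolP; exists X0.
case: (ex_minnP exn) => n /asboolP[X FX Xn] minn.
exists X => // Y FY YX x Xx; have [hX V0X] := hF _ FX; have [hY V0Y] := hF _ FY.
apply: (chain_length_eq hV0 hY hX cs V0Y YX) => //.
apply/eqP; rewrite eqn_leq chain_length_mono //= Xn.
by apply: minn; apply/asboolP; exists Y.
Qed.

End Semilocal.

(** * Modules of finite length *)

Section FiniteLength.
Context (R : comPzRingType) (A : pzRingType) (phi : {rmorphism R -> A}).
Context (noethR : noetherian R) (slR : semilocal R).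
Context (central : forall r a, phi r * a = a * phi r) (fgA : fgR phi A^o).
Implicit Types (M W : lmodType A).

Lemma regularZ (a b : A) : a *: (b : A^o) = a * b. Proof. by []. Qed.

(** An element [phi x * a] outside a maximal [I] is invertible modulo [I]; as [phi x] is central
    this gives [A = x A + I], and Nakayama's lemma puts 1 in [I]. *)
Lemma rad_jacobson (x : R) (a : A) :
  (x : R^o) \in @jacobson R -> (phi x * a : A^o) \in @jacobson A.
Proof.
move=> radx; apply/jacobsonP => I mI; apply: contrapT => /negP nI.
have [[I0 linI] _ _] := mI.
have hI : lsub [set z | z \in I] by [].
have [b bI] := maximal_inv mI nI.
case/negP: (maximal_proper mI).
apply: (@nakayama R noethR A phi A^o setT [set z | z \in I] x fgA _ _ radx _ 1) => //.
  exact: lsub_rsub.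
move=> z _; exists (z * b * a) => //=.
have -> : z - phi x *: (z * b * a : A^o) = z *: (1 - b * (phi x * a) : A^o) + 0.
  rewrite addr0 !regularZ mulrBr mulr1; congr (_ - _); rewrite !mulrA; congr (_ * a).
  by rewrite -mulrA central.
exact: linI.
Qed.

Lemma jacobson_lsub : lsub [set a : A^o | a \in @jacobson A].
Proof. exact: jacobson_submod_closed. Qed.

(* The simple module A/I is a direct summand of A/J. *)
Lemma simple_retract (I : {pred A^o}) : maximal_submod I ->
  exists2 k : A, ((1 - k : A) : A^o) \in I &
    forall i : A, (i : A^o) \in I -> (i * k : A^o) \in @jacobson A.
Proof.
move=> mI; have [[I0 linI] _ _] := mI; have hI : lsub [set z | z \in I] by [].
have hJ := jacobson_lsub.
(* For a minimal left ideal [K] above J and not inside [I], the quotient K/J turns out to be a copy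
   of A/I; [k] is an element of [K] congruent to 1 modulo [I]. *)
have [||||K [hK JK [w Kw nIw]] minK] := @rsub_min R noethR slR A phi A^o
  [set a : A^o | a \in @jacobson A]
  [set K | [/\ lsub K, [set a : A^o | a \in @jacobson A] `<=` K &
               exists2 w, K w & w \notin I]] fgA.
- exact: lsub_rsub.
- by move=> x radx y; exists 1%N; rewrite expr1; apply: rad_jacobson.
- by move=> X [hX JX _]; split=> //; apply: lsub_rsub.
- exists setT; split=> //; exists 1 => //; exact: maximal_proper.
have [b bI] := maximal_inv mI nIw.
exists (b * w); rewrite // => i Ii; apply/jacobsonP => I' mI'.
have Kk : K (i * (b * w)).
  by rewrite mulrA; apply: (lsubZ (i * b) hK Kw).
have Ik : (i * (b * w) : A^o) \in I.
  have -> : i * (b * w) = - (i *: (1 - b * w : A^o) - i).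
    by rewrite regularZ mulrBr mulr1 opprB opprB addrCA subrr addr0.
  apply: (lsubN hI); apply: (lsubB hI) => //; exact: (lsubZ i hI bI).
move: (i * (b * w)) Kk Ik => z Kz Iz.
have [[I'0 linI'] _ _] := mI'; have hI' : lsub [set z | z \in I'] by [].
apply: contrapT => /negP nI'z.
(* By minimality [K] cannot shrink to its intersection with [I'], which misses [z], unless that
   intersection lies in [I]. Then [w = w (1 - c z) + w c z] would put [w] in [I]. *)
have KI'I : K `&` [set z | z \in I'] `<=` [set z | z \in I].
  apply: contrapT => nKI'.
  case/negP: nI'z; apply: (minK (K `&` [set z | z \in I']) _ _ z Kz).2; last first.
    by move=> ? [].
  split.
  - split; first by split=> //; case: hK.
    by move=> a x y [Kx I'x] [Ky I'y]; split; [have [_] := hK; apply | apply: linI'].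
  - by move=> a Ja; split; [apply: JK | move/jacobsonP: Ja; apply].
  - apply: contrapT => nw; apply: nKI' => u KI'u; apply: contrapT => nIu.
    by apply: nw; exists u => //; apply/negP.
have [c cI'] := maximal_inv mI' nI'z.
case/negP: nIw.
have -> : w = (w *: (1 - c * z : A^o)) + (w * c) *: (z : A^o).
  by rewrite !regularZ mulrBr mulr1 mulrA subrK.
apply: (lsubD hI); last exact: (lsubZ _ hI).
apply: KI'I; split; last exact: (lsubZ w hI').
have -> : w *: (1 - c * z : A^o) = w - (w * c) *: (z : A^o).
  by rewrite !regularZ mulrBr mulr1 mulrA.
by apply: (lsubB hK) => //; apply: (lsubZ _ hK).
Qed.

Definition adjoin M (N : set M) (y : M) : set M :=
  fun x => exists2 a : A, N (x - a *: y) & True.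

Lemma adjoin_lsub M (N : set M) y : lsub N -> lsub (adjoin N y).
Proof.
move=> [N0 linN]; split; first by exists 0; rewrite // scale0r subr0.
move=> c u v [a Nu _] [b Nv _]; exists (c * a + b) => //.
rewrite scalerDl opprD addrACA -scalerA -scalerBr; exact: linN.
Qed.

Definition annihilator M (N : set M) (y : M) : {pred A^o} :=
  pred_of [set a : A^o | N ((a : A) *: y)].

Lemma annihilatorP M (N : set M) (y : M) a : reflect (N (a *: y)) (a \in annihilator N y).
Proof. exact: pred_ofP. Qed.

(* Induction along a composition series. *)
Lemma finite_length_ind M (Pr : set M -> Prop) : fgR phi M ->
  (forall x : R, (x : R^o) \in @jacobson R -> forall y : M, exists k, phi (x ^+ k) *: y = 0) ->
  Pr [set 0] ->
  (forall N y, lsub N -> Pr N -> maximal_submod (annihilator N y) -> Pr (adjoin N y)) ->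
  Pr setT.
Proof.
move=> fM nilM Pr0 PrS.
(* If the maximal [N] were proper, a minimal [N'] strictly above it would make [N' / N] simple, and
   adjoining to [N] an element [y] of [N'] would contradict maximality. *)
have [||N [hN PrN] maxN] := @rsub_max R A phi noethR M [set N | lsub N /\ Pr N] fM.
- by move=> N [/(lsub_rsub phi)].
- exists [set 0]; split=> //; split=> // a x y -> ->; by rewrite scaler0 addr0.
have [NT|nNT] := pselect (forall x, N x).
  by have <- : N = setT by apply/seteqP; split.
have [a nNa] : exists a, ~ N a.
  by apply: contrapT => nN; apply: nNT => x; apply: contrapT => nNx; apply: nN; exists x.
have [||||N' [hN' NN' [y N'y nNy]] minN'] := @rsub_min R noethR slR A phi M N
  [set N' | [/\ lsub N', N `<=` N' & exists2 y, N' y & ~ N y]] fM.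
- exact: lsub_rsub.
- by move=> x /nilM nx z; have [k kz] := nx z; exists k; rewrite kz; case: hN.
- by move=> X [hX NX _]; split=> //; apply: lsub_rsub.
- by exists setT; split=> //; exists a.
have hadj := adjoin_lsub y hN.
have Nadj : N `<=` adjoin N y by move=> u Nu; exists 0; rewrite // scale0r subr0.
have yadj : adjoin N y y by exists 1; rewrite // scale1r subrr; case: hN.
case: (nNy); apply: (maxN (adjoin N y)) => //; split=> //; apply: PrS => //.
have hann : lsub [set a : A^o | N ((a : A) *: y)].
  split=> [|c u v /= Nu Nv]; first by rewrite /= scale0r; case: hN.
  by rewrite scalerDl regularZ -scalerA; have [_] := hN; apply.
split; first exact: pred_of_closed.
  by exists 1; apply/negP => /annihilatorP; rewrite scale1r.
move=> K cK annK [x nKx] k Kk; apply/annihilatorP; apply: contrapT => nNk.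
have hK : lsub [set z | z \in K] by case: cK.
have NX : N `<=` [set u | exists2 c : A, (c : A^o) \in K & N (u - c *: y)].
  by move=> u Nu; exists 0; rewrite ?scale0r ?subr0 //; case: cK.
have [||c Kc Nyc] := minN' [set u | exists2 c : A, (c : A^o) \in K & N (u - c *: y)] _ _ y N'y.
- split=> //; last first.
    by exists ((k : A) *: y) => //; exists (k : A); rewrite ?subrr //; case: hN.
  split; first by apply: NX; case: hN.
  move=> c u v [a1 Ka1 Nu] [b1 Kb1 Nv]; exists (c * a1 + b1).
    by have [_] := cK; apply.
  by rewrite scalerDl opprD addrACA -scalerA -scalerBr; have [_] := hN; apply.
- move=> u [c Kc Nuc]; rewrite -(subrK (c *: y) u); apply: (lsubD hN').
    exact: NN'.
  exact: lsubZ.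
have K1 : (1 : A^o) \in K.
  rewrite -(subrK (c : A^o) 1); apply: (lsubD hK) => //; apply: annK.
  by apply/annihilatorP; rewrite scalerBl scale1r.
case/negP: nKx; rewrite -[x]mulr1; exact: (lsubZ x hK K1).
Qed.

(** [D] is the pullback of [N + A y] and [X] over the quotient of [N + A y] by [N], to which A/J
    maps by [a |-> a y]. It is an extension of [X] by [N], so Ext^1(X, W) = 0 extends [j] to [h] on
    [D]. With [X -> Q] this embeds [D] in [W * Q], and [D / Y] in [W']. A lift of [N + A y] to
    [D / Y] comes from [k], which splits A/J onto the simple quotient. *)
Lemma embed_fpd_step k0 (T : lmodType A) (pT : {linear A^o -> T}) M (N : set M) (y : M)
    (K : lmodType A) (iN : {linear K -> M}) W (j : {linear K -> W}) :
  surj pT -> (forall a : A^o, pT a = 0 <-> a \in @jacobson A) -> approx k0 T ->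
  lsub N -> injective iN -> (forall x, N x <-> exists k, iN k = x) ->
  fpd k0.+1 W -> injective j -> maximal_submod (annihilator N y) ->
  exists (K' : lmodType A) (i' : {linear K' -> M}) (W' : lmodType A) (j' : {linear K' -> W'}),
    [/\ injective i', forall x, adjoin N y x <-> exists k, i' k = x,
        fpd k0.+1 W' & injective j'].
Proof.
move=> sT pTE [Y [X [iY [p [sY fY gX]]]]] hN inj_iN iNE fW inj_j mI.
have [inj_iY ex_Y sp] := sY; have [Q [X' [e [qe [se pQ _ _]]]]] := coresolved_elim gX.
have [inj_e _ _] := se.
have [K' [i' [inj_i' i'E]]] := submodule_ex (adjoin_lsub y hN).
have [k /annihilatorP kI IkJ] := simple_retract mI.
have JI a : a \in @jacobson A -> N ((a : A) *: y).
  by move=> /jacobsonP/(_ _ mI)/annihilatorP.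
have hD : lsub ([set z | exists a : A, pT a = p z.2 /\ N (z.1 - a *: y)] : set (M * X)%type).
  split=> [|c u v [a [pa Na]] [b [pb Nb]]].
    by exists 0; rewrite !linear0 scale0r subr0; split=> //; case: hN.
  exists (c * a + b); rewrite -[c * a]/(c *: (a : A^o)) !linearP pa pb; split=> //=.
  rewrite scalerDl opprD addrACA -scalerA -scalerBr; have [_] := hN; exact.
have [D [d [inj_d dE]]] := submodule_ex hD.
have [zX zXE] := cst0_linear K X; have [l lE] := pair_linear iN zX.
have [|iK iKE] := factor_inj (f := l) inj_d.
  move=> w; apply/dE; exists 0; rewrite lE zXE !linear0 scale0r subr0; split=> //.
  by apply/iNE; exists w.
have [sn snE] := snd_linear M X; have [q qE] := comp_linear d sn.
have sK : ses iK q.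
  split=> [u v /(congr1 d)|z|x].
  - by rewrite !iKE !lE => -[/inj_iN].
  - rewrite qE snE; split=> [z2|[w <-]]; last by rewrite iKE lE zXE.
    have /dE[a [/=]] : exists w, d w = d z by exists z.
    rewrite z2 linear0 => /pTE/JI Nay Nz.
    have /iNE[w wE] : N (d z).1 by rewrite -(subrK (a *: y) (d z).1); apply: lsubD.
    by exists w; apply: inj_d; rewrite iKE lE zXE wE -z2 -surjective_pairing.
  - have [a aE] := sT (p x).
    have [w wE] : exists w, d w = ((a : A) *: y, x).
      by apply/dE; exists a; split=> //=; rewrite subrr; case: hN.
    by exists w; rewrite qE snE wE.
have [h hE] := coresolved_Ext1 gX fW sK j.
have [zM zME] := cst0_linear Y M; have [l' l'E] := pair_linear zM iY.
have [|kap kapE] := factor_inj (f := l') inj_d.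
  move=> w; apply/dE; exists 0; rewrite l'E zME /= (ses_comp0 _ sY) linear0.
  by rewrite scale0r subr0; split=> //; case: hN.
have [hk hkE] := comp_linear kap h; have [ei eiE] := comp_linear iY e.
have [m mE] := pair_linear hk ei.
have inj_m : injective m.
  by move=> u v; rewrite !mE !eiE => -[_ /inj_e/inj_iY].
have [W' [pi sm]] := ses_of_inj inj_m; have [_ ex_m spi] := sm.
(* The bound does not grow along the series: [Y] satisfies [fpd k0], while [W] and [Q] satisfy
   [fpd k0.+1]. *)
have fW' : fpd k0.+1 W'.
  by apply: (fpd_quotient sm fY); apply: fpd_prod => //; apply: fpd_projective.
(* Replacing [a] by [a * k] removes the dependence on [a]: if [a *: y] is in [N], then [a * k] is in
   J. The choice of [z] is absorbed by [Y]. *)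
pose r (x : K') (w : W') := exists z a, [/\ (d z).1 = i' x, N (i' x - a *: y),
  pT (a * k) = p (d z).2 & w = pi (h z, e (d z).2)].
have rtot x : exists w, r x w.
  have /i'E[a Na _] : exists w, i' w = i' x by exists x.
  have [x' x'E] := sp (pT (a * k)).
  have [z zE] : exists z, d z = (i' x, x').
    apply/dE; exists (a * k); split=> //=.
    have -> : i' x - (a * k) *: y = (i' x - a *: y) + a *: ((1 - k) *: y).
      by rewrite scalerA mulrBr mulr1 scalerBl addrA subrK.
    by apply: lsubD => //; apply: lsubZ.
  by exists (pi (h z, e (d z).2)), z, a; rewrite zE; split.
have [||j' j'E] := @linear_of_rel A K' W' r rtot.
- move=> c u u' v v' [z [a [z1 Na pa ->]]] [z' [a' [z1' Na' pa' ->]]].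
  exists (c *: z + z'), (c * a + a'); split.
  + by rewrite !linearP /= z1 z1'.
  + by rewrite linearP scalerDl opprD addrACA -scalerA -scalerBr; have [_] := hN; apply.
  + rewrite mulrDl -mulrA -[c * (a * k)]/(c *: (a * k : A^o)).
    by rewrite [LHS]linearP pa pa' [d (_ + _)]linearP [RHS]linearP.
  + by rewrite -[LHS]linearP [d (_ + _)]linearP [h (_ + _)]linearP /= [e (_ + _)]linearP.
- move=> w [z [a [z1 Na pa ->]]]; rewrite linear0 in z1 Na.
  have /annihilatorP/IkJ/pTE ak : N (a *: y).
    by rewrite sub0r in Na; rewrite -[a *: y]opprK; apply: lsubN.
  rewrite ak in pa; have /ex_Y[u uE] := esym pa.
  have -> : z = kap u by apply: inj_d; rewrite kapE l'E zME uE -z1 -surjective_pairing.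
  by apply/ex_m; exists u; rewrite mE hkE eiE kapE l'E.
exists K', i', W', j'; split=> //; apply: linear_inj => x /j'E[z [a [z1 Na pa]]].
(* If the class vanishes, [z - kap u] lies in [N], where [h] is the injective map [j], so it is
   zero. *)
move=> /esym/ex_m[u]; rewrite mE hkE eiE => -[hu /inj_e iYu].
have : q (z - kap u) = 0.
  by rewrite linearB !qE !snE kapE l'E iYu subrr.
move=> /(let: And3 _ ex _ := sK in ex _).1[w wE].
have w0 : w = 0.
  by apply: inj_j; rewrite -hE wE linearB hu subrr linear0.
apply: inj_i'; rewrite linear0 -z1.
have -> : z = kap u by apply/eqP; rewrite -subr_eq0 -wE w0 linear0.
by rewrite kapE l'E zME.
Qed.

Lemma embed_fpd k0 (T : lmodType A) (pT : {linear A^o -> T}) M :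
  surj pT -> (forall a : A^o, pT a = 0 <-> a \in @jacobson A) -> approx k0 T ->
  fgR phi M ->
  (forall x : R, (x : R^o) \in @jacobson R -> forall y : M, exists k, phi (x ^+ k) *: y = 0) ->
  exists W (j : {linear M -> W}), fpd k0.+1 W /\ injective j.
Proof.
move=> sT pTE aT fM nilM.
have [|N y hN [_ [K [iN [W [j [inj_i iE fW inj_j]]]]]] mI|_ [K [i [W [j [inj_i iE fW inj_j]]]]]] :=
  finite_length_ind (Pr := fun N => lsub N /\ exists (K : lmodType A)
    (i : {linear K -> M}) W (j : {linear K -> W}),
    [/\ injective i, forall x, N x <-> exists k, i k = x, fpd k0.+1 W & injective j]) fM nilM.
- have h0 : lsub [set (0 : M)] by split=> // a x y -> ->; rewrite scaler0 addr0.
  split=> //; have [K [i [inj_i iE]]] := submodule_ex h0.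
  have [j jE] := id_linear K; exists K, i, K, j; split=> //.
    apply: fpd_zero => x; apply: inj_i; rewrite linear0.
    by apply/iE; exists x.
  by move=> x y; rewrite !jE.
- split; first exact: adjoin_lsub.
  exact: embed_fpd_step sT pTE aT hN inj_i iE fW inj_j mI.
- have [||f fE] := @factor_surj A K M W i j.
  + by move=> x; apply/iE.
  + by move=> x ix; rewrite (_ : x = 0) ?linear0 //; apply: inj_i; rewrite ix linear0.
  exists W, f; split=> //; apply: linear_inj => x.
  have /iE[u <-] : setT x by [].
  by rewrite fE => ju; rewrite (_ : u = 0) ?linear0 //; apply: inj_j; rewrite ju linear0.
Qed.

End FiniteLength.

(** * Exactness of the dual of a right resolution *)

Section Flat.
Context (A : pzRingType).
Implicit Types (Q Y Z : lmodType A).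

Lemma mulmxr_linear p q (D : 'M[A]_(p, q)) :
  exists f : {linear 'rV[A]_p -> 'rV[A]_q}, forall v, f v = v *m D.
Proof. by apply: linear_ex => a u v; rewrite mulmxDl scalemxAl. Qed.

(* The equational criterion for flatness of the projective module Q: exactness
   of the dual complex of column vectors passes to Hom(-, Q). *)
Lemma Hom_exact_row p q r (D : 'M[A]_(p, q)) (D' : 'M[A]_(q, r)) Q
    (f : {linear 'rV[A]_q -> Q}) : projective Q ->
  (forall u : 'cV[A]_q, D *m u = 0 -> exists w : 'cV_r, u = D' *m w) ->
  (forall v, f (v *m D) = 0) ->
  exists g : {linear 'rV[A]_r -> Q}, forall v, f v = g (v *m D').
Proof.
move=> pQ exD fD.
have [F [c [b [cinj cP bE univ]]]] := free_module_ex A Q.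
have [h [hb _]] := univ _ id.
have [iQ iQE] := id_linear Q.
have [s sE] : exists s : {linear Q -> F}, forall x, h (s x) = x.
  have [|s sE] := pQ _ _ h iQ; first by move=> x; exists (b x).
  by exists s => x; rewrite sE iQE.
pose u i := s (f (delta_mx 0 i)).
pose cl y : 'cV[A]_q := \col_i (c (u i) y : A).
have c_sum (n : nat) (v : 'I_n -> A) (z : 'I_n -> F) y :
    c (\sum_i v i *: z i) y = \sum_i v i * (c (z i) y : A).
  rewrite linear_sum fct_sumE; apply: eq_bigr => i _; by rewrite linearZ.
have sfE v : s (f v) = \sum_i v 0 i *: u i.
  by rewrite linear_row linear_sum; apply: eq_bigr => i _; rewrite linearZ.
have Dcl y : D *m cl y = 0.
  apply/matrixP => k l; rewrite !mxE.
  have : c (s (f (delta_mx 0 k *m D))) y = 0 by rewrite fD !linear0.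
  rewrite sfE c_sum => E; rewrite -[RHS]E; apply: eq_bigr => i _.
  by rewrite -rowE !mxE.
(* Sending the zero column to 0 keeps the family [w] finitely supported, so that its entries define
   elements of the free module. *)
have /choice[w wP] : forall y, exists w : 'cV[A]_r,
    cl y = D' *m w /\ (cl y = 0 -> w = 0).
  move=> y; have [cl0|cl0] := pselect (cl y = 0).
    by exists 0; rewrite mulmx0.
  by have [w wE] := exD _ (Dcl y); exists w; split.
have supp : exists t : seq Q, forall y, y \notin t -> cl y = 0.
  have /choice[t tP] : forall i, fin_supp (c (u i)) by move=> i; apply/cP; exists (u i).
  exists (flatten [seq t i | i <- enum 'I_q]) => y yt.
  apply/matrixP => i j; rewrite !mxE; apply: tP; apply: contra yt => yi.
  by apply/flattenP; exists (t i) => //; apply: map_f; rewrite mem_enum.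
have /choice[g gE] : forall k : 'I_r, exists z : F, c z = (fun y => w y k 0).
  move=> k; apply/cP; have [t tP] := supp; exists t => y /tP.
  by have [_ /[apply]->] := wP y; rewrite mxE.
have [g' g'E] := row_linear (fun k => h (g k)).
exists g' => v; rewrite -[LHS]sE sfE g'E.
have -> : \sum_i (v *m D') 0 i *: h (g i) = h (\sum_i (v *m D') 0 i *: g i).
  by rewrite linear_sum; apply: eq_bigr => i _; rewrite linearZ.
congr (h _); apply: cinj; apply/funext => y; rewrite !c_sum.
have -> : \sum_i v 0 i * (c (u i) y : A) = (v *m cl y) 0 0.
  by rewrite mxE; apply: eq_bigr => i _; rewrite mxE.
have [-> _] := wP y; rewrite mulmxA mxE; apply: eq_bigr => i _.
by rewrite gE.
Qed.

Context (p : nat -> nat) (C : forall j, 'M[A]_(p j, p j.+1)).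
Context (CC : forall j, C j *m C j.+1 = 0).
Context (exC : forall j (u : 'cV[A]_(p j.+2)), C j.+1 *m u = 0 ->
  exists w : 'cV_(p j.+3), u = C j.+2 *m w).

(* When [p 0 = 0] and the columns of sizes [p 1], [p 2], ... resolve a right
   module N, this says that Tor_j(N, Z) = 0. *)
Definition Tor_vanishes j Z : Prop := forall f : {linear 'rV[A]_(p j.+1) -> Z},
  (forall v, f (v *m C j) = 0) ->
  exists g : {linear 'rV[A]_(p j.+2) -> Z}, forall v, f v = g (v *m C j.+1).

Lemma Tor_vanishes_quotient j Y Y' Y'' (i : {linear Y -> Y'}) (q : {linear Y' -> Y''}) :
  ses i q -> Tor_vanishes j Y -> Tor_vanishes j.+1 Y' -> Tor_vanishes j.+1 Y''.
Proof.
move=> [inj_i ex_i sq] tY tY' f fC.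
have [f' f'E] := projective_row f sq.
have [m mE] := mulmxr_linear (C j.+1); have [fm fmE] := comp_linear m f'.
have [|w wE] := factor_inj (f := fm) inj_i.
  by move=> v; apply/ex_i; rewrite fmE mE f'E fC.
have [|g gE] := tY w.
  by move=> v; apply: inj_i; rewrite wE fmE mE -mulmxA CC mulmx0 !linear0.
have [ig igE] := comp_linear g i; have [e eE] := sub_linear f' ig.
have [|h hE] := tY' e.
  by move=> v; rewrite eE igE -gE wE fmE mE subrr.
have [qh qhE] := comp_linear h q; exists qh => v; rewrite qhE -hE eE linearB f'E igE.
by rewrite (_ : q (i (g v)) = 0) ?subr0 //; apply/ex_i; exists (g v).
Qed.

(** For a projective module [k] is positive, so [j] is at least 1, where the columns are exact; each
    [fpd_quotient] consumes one degree. *)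
Lemma Tor_vanishes_fpd k Y j : fpd k Y -> (k <= j)%N -> Tor_vanishes j Y.
Proof.
move=> fY; elim: fY j => {k Y} [k Y Y0|k Q pQ|k Y Y' _ tY _ tY'|k Y Y' Y'' i q s _ tY _ tY'] j.
- move=> _ f _; have [g gE] := cst0_linear 'rV[A]_(p j.+2) Y.
  by exists g => v; rewrite gE (Y0 (f v)).
- case: j => // j _ f fC.
  exact: Hom_exact_row pQ (@exC j) fC.
- move=> kj f fC; have [a aE] := fst_linear Y Y'; have [b bE] := snd_linear Y Y'.
  have [fa faE] := comp_linear f a; have [fb fbE] := comp_linear f b.
  have [|ga gaE] := tY j kj fa; first by move=> v; rewrite faE fC linear0.
  have [|gb gbE] := tY' j kj fb; first by move=> v; rewrite fbE fC linear0.
  have [g gE] := pair_linear ga gb; exists g => v.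
  by rewrite gE -gaE -gbE faE fbE aE bE -surjective_pairing.
- case: j => // j kj; apply: (Tor_vanishes_quotient s); [exact: tY|exact: tY'].
Qed.

End Flat.

Section RowExact.
Context (R : comPzRingType) (A : pzRingType) (phi : {rmorphism R -> A}).
Context (noethR : noetherian R) (slR : semilocal R).
Context (central : forall r a, phi r * a = a * phi r) (fgA : fgR phi A^o).
Implicit Types (M W : lmodType A).

Lemma fgR_row n : fgR phi 'rV[A]_n.
Proof.
have [s sP] := fgA.
pose L := flatten [seq [seq (a : A) *: (delta_mx 0 i : 'rV[A]_n) | a <- s] | i <- enum 'I_n].
exists L => x; rewrite [x]row_sum_delta.
have hL := rspan_rsub phi L.
apply: big_ind => [||i _]; [by case: hL|by move=> u v; apply: (rsubD hL)|].
apply: (@rspan_sub R A phi A^o s [set a : A^o | rspan phi L ((a : A) *: delta_mx 0 i)]) => //.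
- split; first by rewrite /= scale0r; case: hL.
  by move=> r a b La Lb /=; rewrite scalerDl -scalerA; have [_] := hL; apply.
- move=> a sa; apply: rspan_mem; apply/flattenP.
  exists [seq (a : A) *: (delta_mx 0 i : 'rV[A]_n) | a <- s]; last exact: map_f.
  by apply/mapP; exists i; rewrite ?mem_enum.
Qed.

Lemma centralZ M r (a : A) (x : M) : phi r *: (a *: x) = a *: (phi r *: x).
Proof. by rewrite !scalerA central. Qed.

(** The kernels of the powers of [x] stabilize at some [x ^+ k]. If this kernel and the image of
    [x ^+ k] were both nonzero, [e] would lie in both; writing [e] as [x ^+ k] times [z'] puts [z']
    in the stable kernel, so [e] would be 0. If [x] is injective, [e] lies in [x A e], contrary to
    Nakayama's lemma. *)
Lemma uniform_nilpotent M (e : M) : fgR phi M -> e <> 0 ->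
  (forall N, lsub N -> (exists2 y, N y & y <> 0) -> N e) ->
  forall x : R, (x : R^o) \in @jacobson R -> forall y : M, exists k, phi (x ^+ k) *: y = 0.
Proof.
move=> fM e0 uni x radx.
pose ker k : set M := fun y => phi (x ^+ k) *: y = 0.
have hker k : lsub (ker k).
  split=> [|a y z ky kz]; first by rewrite /ker scaler0.
  by rewrite /ker scalerDr centralZ ky kz scaler0 addr0.
have kerS k l : ker k `<=` ker (l + k)%N.
  by move=> y ky; rewrite /ker exprD rmorphM -scalerA ky scaler0.
have [||_ [k ->] maxk] := @rsub_max R A phi noethR M [set X | exists k, X = ker k] fM.
- by move=> _ [k ->]; apply: lsub_rsub.
- by exists (ker 0%N), 0%N.
have maxk' l y : ker (l + k)%N y -> ker k y.
  by apply: (maxk (ker (l + k)%N)) => //; exists (l + k)%N.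
have [[y ky y0]|nk] := pselect (exists2 y, ker k y & y <> 0).
  have ke := uni _ (hker k) (ex_intro2 _ _ y ky y0).
  move=> z; exists k; apply: contrapT => kz.
  have [||z' ez'] := uni [set u | exists z, phi (x ^+ k) *: z = u].
  - split=> [|a _ _ [u <-] [v <-]]; first by exists 0; rewrite scaler0.
    by exists (a *: u + v); rewrite scalerDr centralZ.
  - by exists (phi (x ^+ k) *: z) => //; exists z.
  apply: e0; rewrite -ez'; apply: (maxk' k).
  by rewrite /ker exprD rmorphM -scalerA ez'.
have inj_x (y : M) : phi x *: y = 0 -> y = 0.
  move=> xy; apply: contrapT => y0; apply: nk; exists y => //.
  by apply: (maxk' 1%N); rewrite /ker exprD expr1 mulrC rmorphM -scalerA xy scaler0.
have [||_ [a <-] aE] := uni [set u | exists2 z, (exists a : A, a *: e = z) & phi x *: z = u].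
- split=> [|a _ _ [_ [b <-] <-] [_ [c <-] <-]].
    by exists 0; rewrite ?scaler0 //; exists 0; rewrite scale0r.
  exists ((a * b + c) *: e); first by exists (a * b + c).
  by rewrite scalerDl scalerDr -scalerA centralZ.
- exists (phi x *: e); last by move/inj_x.
  by exists e => //; exists 1; rewrite scale1r.
exfalso; apply: e0.
apply: (@nakayama R noethR A phi M [set u | exists a : A, a *: e = u] [set 0] x fM _ _ radx) => //.
- apply: lsub_rsub; split=> [|b _ _ [c <-] [d <-]]; first by exists 0; rewrite scale0r.
  by exists (b * c + d); rewrite scalerDl scalerA.
- by apply: lsub_rsub; split=> // b u v -> ->; rewrite scaler0 addr0.
- move=> _ [b <-]; exists ((b * a) *: e); first by exists (b * a).
  by rewrite -scalerA centralZ aE subrr.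
- by exists 1; rewrite scale1r.
Qed.

Lemma row_exact k0 (T : lmodType A) (pT : {linear A^o -> T})
    (p : nat -> nat) (C : forall j, 'M[A]_(p j, p j.+1)) :
  surj pT -> (forall a : A^o, pT a = 0 <-> a \in @jacobson A) -> approx k0 T ->
  (forall j, C j *m C j.+1 = 0) ->
  (forall j (u : 'cV[A]_(p j.+2)), C j.+1 *m u = 0 ->
    exists w : 'cV_(p j.+3), u = C j.+2 *m w) ->
  forall j (v : 'rV[A]_(p j.+1)), (k0 < j)%N -> v *m C j.+1 = 0 ->
    exists w, v = w *m C j.
Proof.
move=> sT pTE aT CC exC j e kj eC; apply: contrapT => ne.
pose im : set 'rV[A]_(p j.+1) := fun v => exists w, v = w *m C j.
(* [N] is maximal among the submodules containing the image and missing [e]. Hence every nonzero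
   submodule of the quotient [M] contains the class of [e], the hypothesis of
   [uniform_nilpotent]. *)
have [||N [hN imN nNe] maxN] := @rsub_max R A phi noethR 'rV[A]_(p j.+1)
  [set N : set 'rV[A]_(p j.+1) | [/\ lsub N, im `<=` N & ~ N e]] (fgR_row _).
- by move=> X [/(lsub_rsub phi)].
- exists im; split=> //; split=> [|a _ _ [u ->] [v ->]]; first by exists 0; rewrite mul0mx.
  by exists (a *: u + v); rewrite mulmxDl scalemxAl.
have [M [q [sq qE]]] := quotient_ex hN.
have qe0 : q e <> 0 by move=> /qE.
have fM : fgR phi M := fgR_quotient sq (fgR_row _).
have [|W [i [fW inj_i]]] := embed_fpd noethR slR central fgA sT pTE aT fM.
  apply: (uniform_nilpotent fM qe0) => X hX [y Xy y0]; apply: contrapT => nXe.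
  have [x xE] := sq y; apply: y0; rewrite -xE; apply/qE.
  apply: (maxN [set x | X (q x)]); last by rewrite /= xE.
    split=> //; last by move=> v /imN/qE /= ->; case: hX.
    split=> [|a u v Xu Xv] /=; first by rewrite linear0; case: hX.
    by rewrite linearP; have [_] := hX; apply.
  by move=> v /qE /= ->; case: hX.
have [f fE] := comp_linear q i.
have [|g gE] := Tor_vanishes_fpd CC exC fW kj (f := f).
  move=> v; rewrite fE (_ : q _ = 0) ?linear0 //; apply/qE/imN; by exists v.
apply: qe0; apply: inj_i; rewrite -fE gE eC !linear0; by [].
Qed.

End RowExact.

(** * Finite injective dimension *)

Section Bass.
Context (R : comPzRingType) (A : pzRingType) (phi : {rmorphism R -> A}).
Context (noethR : noetherian R) (slR : semilocal R).
Context (central : forall r a, phi r * a = a * phi r) (fgA : fgR phi A^o).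
Implicit Types (F K M N P Q : lmodType A).

Lemma mulphi_linear M (r : R) : exists f : {linear M -> M}, forall x, f x = phi r *: x.
Proof. by apply: linear_ex => a x y; rewrite scalerDr centralZ. Qed.

Lemma fgR_cover M : fgR phi M -> exists n (q : {linear 'rV[A]_n -> M}), surj q.
Proof.
move=> [t tP]; have [q qE] := row_linear (fun i : 'I_(size t) => t`_i).
exists (size t), q => x.
have hX := lsub_rsub phi (lsub_im q).
apply: (rspan_sub hX _ (tP x)) => y yt.
exists (delta_mx 0 (Ordinal (etrans (index_mem y t) yt))).
rewrite qE (bigD1 (Ordinal (etrans (index_mem y t) yt))) //= big1 => [|i ni].
  by rewrite mxE !eqxx scale1r addr0 nth_index.
by rewrite mxE (negPf ni) andbF scale0r.
Qed.

Lemma eq_on_rspan M N (f g : {linear M -> N}) (t : seq M) x :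
  (forall y, y \in t -> f y = g y) -> rspan phi t x -> f x = g x.
Proof.
move=> fg tx; have [h hE] := sub_linear f g.
have hX : rsub phi [set x | h x = 0] by apply/lsub_rsub/lsub_ker.
have /= := rspan_sub hX _ tx; rewrite hE => hx.
apply/eqP; rewrite -subr_eq0; apply/eqP/hx => y yt.
by rewrite /= hE fg // subrr.
Qed.

(** Extending [v] along [m] writes it as [x] times a map [M -> A] plus a map factoring through [g],
    and Nakayama's lemma removes the first term. *)
Lemma extend_nakayama M F N (x : R) (g : {linear M -> F}) (m : {linear M -> (M * F)%type})
    (q : {linear (M * F)%type -> N}) :
  fgR phi M -> (x : R^o) \in @jacobson R -> (forall y, m y = (phi x *: y, g y)) ->
  ses m q -> Ext1_vanishes N A^o ->
  forall v : {linear M -> A^o}, exists b : {linear F -> A^o}, forall y, v y = b (g y).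
Proof.
move=> fM radx mE s EN v; have [t tP] := fM; pose n := size t.
(* Maps [M -> A] are recorded by their values on generators: Hom(M, A) is only an [R]-module, but
   becomes an [R]-submodule of the module of rows. *)
pose Z : set 'rV[A]_n := fun w => exists v : {linear M -> A^o}, forall i : 'I_n, w 0 i = v t`_i.
pose B : set 'rV[A]_n := fun w => exists b : {linear F -> A^o}, forall i : 'I_n, w 0 i = b (g t`_i).
have scale_linear K (r : R) (f1 f2 : {linear K -> A^o}) :
    exists f : {linear K -> A^o}, forall y, f y = phi r * (f1 y : A) + f2 y.
  apply: linear_ex => a y z; rewrite !linearP.
  rewrite -[a *: _ + f1 z]/(a * (f1 y : A) + f1 z) mulrDr mulrA central -mulrA.
  rewrite -[a *: f2 y]/(a * (f2 y : A)) -[a *: (_ + _)]/(a * (phi r * (f1 y : A) + f2 y)).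
  by rewrite mulrDr addrACA.
have zero_linear K : exists f : {linear K -> A^o}, forall y, f y = 0 by apply: cst0_linear.
have ZB : Z `<=` B.
  apply: (nakayama noethR (fgR_row fgA n) _ _ radx).
  - split; first by have [z zE] := zero_linear M; exists z => i; rewrite mxE zE.
    move=> r w1 w2 [f1 f1E] [f2 f2E]; have [f fE] := scale_linear _ r f1 f2.
    by exists f => i; rewrite !mxE fE f1E f2E.
  - split; first by have [z zE] := zero_linear F; exists z => i; rewrite mxE zE.
    move=> r w1 w2 [f1 f1E] [f2 f2E]; have [f fE] := scale_linear _ r f1 f2.
    by exists f => i; rewrite !mxE fE f1E f2E.
  - move=> w [u uE]; have [h hE] := EN _ _ _ _ s u.
    have [iM iME] := id_linear M; have [zM zME] := cst0_linear M F.
    have [inl inlE] := pair_linear iM zM; have [h1 h1E] := comp_linear inl h.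
    have [iF iFE] := id_linear F; have [zF zFE] := cst0_linear F M.
    have [inr inrE] := pair_linear zF iF; have [h2 h2E] := comp_linear inr h.
    exists (\row_i (h1 t`_i : A)); first by exists h1 => i; rewrite mxE.
    exists h2 => i; rewrite !mxE uE -hE mE h2E.
    have -> : phi x * (h1 t`_i : A) = h1 (phi x *: t`_i) by rewrite linearZ.
    rewrite h1E inrE inlE iME zME iFE zFE.
    have -> : (phi x *: t`_i, g t`_i) = (phi x *: t`_i, 0) + (0, g t`_i) :> (M * F)%type.
      by congr (_, _); rewrite /= ?addr0 ?add0r.
    by rewrite linearD addrC addKr.
have [|b bE] := ZB (\row_i (v t`_i : A)); first by exists v => i; rewrite mxE.
exists b => y; have [bg bgE] := comp_linear g b; rewrite -bgE.
apply: (eq_on_rspan (t := t)) => // z zt; rewrite bgE.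
have := bE (Ordinal (etrans (index_mem z t) zt)).
by rewrite mxE /= nth_index.
Qed.

(** The configuration passes to syzygies: [N'] is the kernel of [P * F -> M * F -> N], and the
    inclusion [k] of the syzygy takes over the role of [g]. *)
Lemma extend_syzygy j M F N (x : R) (g : {linear M -> F}) (m : {linear M -> (M * F)%type})
    (q : {linear (M * F)%type -> N}) K P (k : {linear K -> P}) (e : {linear P -> M}) :
  projective F -> projective P -> (forall y, m y = (phi x *: y, g y)) ->
  ses m q -> ses k e -> Ext_vanishes A^o j.+1 N ->
  exists N' (m' : {linear K -> (K * P)%type}) (q' : {linear (K * P)%type -> N'}),
    [/\ forall y, m' y = (phi x *: y, k y), ses m' q' & Ext_vanishes A^o j N'].
Proof.
move=> pF pP mE [inj_m ex_m sq] sk EN; have [inj_k ex_k se] := sk.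
have [iF iFE] := id_linear F; have [zF zFE] := cst0_linear F M.
have [inr inrE] := pair_linear zF iF; have [zM zME] := cst0_linear M F.
have [iM iME] := id_linear M; have [inl inlE] := pair_linear iM zM.
have [einl einlE] := comp_linear e inl; have [ei eiE] := copair_linear einl inr.
have eiE' r f : ei (r, f) = (e r, f).
  by rewrite eiE einlE inlE inrE iME zME zFE iFE; congr (_, _); rewrite /= ?addr0 ?add0r.
have [t tE] := comp_linear ei q.
have st : surj t.
  move=> n; have [[y f] yE] := sq n; have [r rE] := se y.
  by exists (r, f); rewrite tE eiE' rE.
have [N' [k' sk']] := ses_of_surj st; have [inj_k' ex_k' _] := sk'.
have [X XE] := mulphi_linear K x; have [Y YE] := mulphi_linear P x.
have [m' m'E] := pair_linear X k.
have [a aE] : exists a : {linear (K * P)%type -> (P * F)%type},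
    forall z, a z = (phi x *: z.2 - k z.1, g (e z.2)).
  have [s1 s1E] := fst_linear K P; have [s2 s2E] := snd_linear K P.
  have [Ys YsE] := comp_linear s2 Y; have [ks ksE] := comp_linear s1 k.
  have [d dE] := sub_linear Ys ks; have [es esE] := comp_linear s2 e.
  have [ge geE] := comp_linear es g; have [a aE] := pair_linear d ge.
  by exists a => z; rewrite aE dE YsE ksE geE esE s1E s2E YE.
have [|b bE] := factor_inj (f := a) inj_k'.
  move=> [w r]; apply/ex_k'; rewrite aE tE eiE' linearB (ses_comp0 _ sk) subr0 linearZ /=.
  by apply/ex_m; exists (e r); rewrite mE.
exists N', m', b; split=> [y||]; first by rewrite m'E XE.
  split=> [u v|z|n].
  - by rewrite !m'E => -[_ /inj_k].
  - case: z => w r; split=> [bz|[w' <-]].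
      have : a (w, r) = 0 by rewrite -bE bz linear0.
      rewrite aE /= => -[/eqP]; rewrite subr_eq0 => /eqP xr ger.
      have er : e r = 0.
        apply: inj_m; rewrite linear0 mE ger; congr (_, _).
        by rewrite -linearZ /= xr (ses_comp0 _ sk).
      have /ex_k[w' w'E] := er; exists w'; rewrite m'E XE w'E; congr (_, _).
      by apply: inj_k; rewrite linearZ /= w'E xr.
    apply: inj_k'; rewrite bE aE m'E XE /= linear0 (ses_comp0 _ sk) linear0.
    by rewrite linearZ /= subrr.
  - case En : (k' n) => [r0 f].
    have : t (r0, f) = 0 by rewrite -En (ses_comp0 _ sk').
    rewrite tE eiE' => /ex_m[y]; rewrite mE => -[yr yf].
    have [r rE] := se y.
    have /ex_k[w wE] : e (phi x *: r - r0) = 0 by rewrite linearB linearZ /= rE yr subrr.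
    exists (w, r); apply: inj_k'; rewrite bE aE En /= wE rE yf; congr (_, _).
    by rewrite opprB addrC subrK.
exact: (EN _ _ _ _ sk' (projective_prod pP pF)).
Qed.

(** For [F = 0] and [x] injective on [M], [N] is [M / x M], and this is Nakayama's lemma for
    multiplication by [x] on Ext^(j+1)(M, A). The factor [F] is present because it appears on
    passing to syzygies, even from [F = 0]. *)
Lemma Ext_vanishes_nakayama j M F N (x : R) (g : {linear M -> F}) (m : {linear M -> (M * F)%type})
    (q : {linear (M * F)%type -> N}) :
  fgR phi M -> projective F -> (x : R^o) \in @jacobson R ->
  (forall y, m y = (phi x *: y, g y)) -> ses m q ->
  Ext_vanishes A^o j.+1 N -> Ext_vanishes A^o j M.
Proof.
elim: j M F N g m q => [|j IHj] M F N g m q fM pF radx mE s EN;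
  have [n [e se]] := fgR_cover fM; have [K [k sk]] := ses_of_surj se;
  have pn := @projective_row A n;
  have [N' [m' [q' [m'E s' EN']]]] := extend_syzygy pF pn mE s sk EN;
  have [inj_k _ _] := sk; have fK : fgR phi K := fgR_sub noethR inj_k (fgR_row fgA n).
- apply: (Ext1_vanishes_of_projective sk pn) => u.
  by have [b bE] := extend_nakayama fK radx m'E s' EN' u; exists b.
- by apply: (Ext_vanishes_syzygy sk pn); apply: IHj fK pn radx m'E s' EN'.
Qed.

Context (T : lmodType A) (pT : {linear A^o -> T}) (sT : surj pT).
Context (pTE : forall a : A^o, pT a = 0 <-> a \in @jacobson A).
Context (m0 : nat) (ET : forall j, (m0 <= j)%N -> Ext_vanishes A^o j T).

Let Good M := forall j, (m0 <= j)%N -> Ext_vanishes A^o j M.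

Lemma good_finite_length M : fgR phi M ->
  (forall x : R, (x : R^o) \in @jacobson R -> forall y : M, exists k, phi (x ^+ k) *: y = 0) ->
  Good M.
Proof.
move=> fM nilM.
have [|N y hN [_ [K [i [inj_i iE gK]]]] mI|_ [K [i [inj_i iE gK]]]] :=
  finite_length_ind noethR slR (Pr := fun N : set M => lsub N /\
    exists (K : lmodType A) (i : {linear K -> M}),
    [/\ injective i, forall x, N x <-> exists k, i k = x & Good K]) fM nilM.
- have h0 : lsub [set (0 : M)] by split=> // a x y -> ->; rewrite scaler0 addr0.
  split=> //; have [K [i [inj_i iE]]] := submodule_ex h0; exists K, i; split=> // j _.
  by apply: Ext_vanishes_zero => x; apply: inj_i; rewrite linear0; apply/iE; exists x.
- have hadj := adjoin_lsub y hN; split=> //.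
  have [K' [i' [inj_i' i'E]]] := submodule_ex hadj; exists K', i'; split=> // j m0j.
  have [k kI IkJ] := simple_retract noethR slR central fgA mI.
  have hI : lsub [set a | a \in annihilator N y] by case: mI.
  have [S [pS [sS pSE]]] := quotient_ex hI.
  have [k' k'E] : exists f : {linear A^o -> A^o}, forall a, f a = (a : A) * k.
    by apply: linear_ex => c u v; rewrite mulrDl -mulrA.
  have [pk pkE] := comp_linear k' pT.
  have [|s sE] := factor_surj (f := pk) sS.
    by move=> a /pSE Ia; rewrite pkE k'E; apply/pTE/IkJ.
  have [|r rE] := factor_surj (f := pS) sT.
    by move=> a /pTE/jacobsonP Ja; apply/pSE/Ja.
  (* The simple factor [S] is a retract of [T], through right multiplication by [k]. *)
  have gS : Ext_vanishes A^o j S.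
    apply: (Ext_vanishes_retract (s := s) (r := r) _ (ET m0j)) => z.
    have [a <-] := sS z; rewrite sE pkE rE k'E; apply/eqP.
    rewrite eq_sym -subr_eq0 -linearB; apply/eqP/pSE.
    have -> : (a : A) - a * k = a *: (1 - k : A^o) by rewrite regularZ mulrBr mulr1.
    exact: lsubZ.
  have [|a aE] := factor_inj (f := i) inj_i'.
    move=> u; apply/i'E; exists 0; rewrite // scale0r subr0; apply/iE; by exists u.
  have [|||b bE] := @linear_of_rel A K' S (fun x z => exists2 a : A, N (i' x - a *: y) & z = pS a).
  + move=> x; have /i'E[c Nc _] : exists w, i' w = i' x by exists x.
    by exists (pS c), c.
  + move=> c u u' v v' [d Nd ->] [d' Nd' ->]; exists (c * d + d').
      by rewrite linearP scalerDl opprD addrACA -scalerA -scalerBr; have [_] := hN; apply.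
    by rewrite -linearP.
  + move=> z [d]; rewrite linear0 sub0r => Nd ->; apply/pSE/(annihilatorP N y).
    by rewrite -[d *: y]opprK; apply: lsubN.
  apply: (@Ext_vanishes_ext A _ _ K K' S a b) => //; last exact: gK.
  split=> [u v /(congr1 i')|u|z].
  + by rewrite !aE => /inj_i.
  + split=> [/bE[d Nd /esym/pSE/(annihilatorP N y) Ndy]|[w <-]].
      have /iE[w wE] : N (i' u) by rewrite -(subrK (d *: y) (i' u)); apply: lsubD.
      by exists w; apply: inj_i'; rewrite aE.
    apply/bE; exists 0; last by rewrite linear0.
    by rewrite scale0r subr0 aE; apply/iE; exists w.
  + have [d <-] := sS z; have [x xE] : exists x, i' x = (d : A) *: y.
      by apply/i'E; exists d; rewrite // subrr; case: hN.
    by exists x; apply/bE; exists d; rewrite // xE subrr; case: hN.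
- move=> j m0j; apply: (Ext_vanishes_iso inj_i _ (gK j m0j)) => x.
  by apply/iE.
Qed.

(** Take a bad quotient [Q] of [M] all of whose proper quotients are good. If the radical of [R]
    kills [Q], it has finite length. Otherwise some [x] in the radical acts nontrivially, so
    [Q / x Q] is good: if [x] is not injective, [x Q] is good too and [Q] is an extension of good
    modules; if [x] is injective, Nakayama's lemma applies. *)
Lemma finite_injective_dimension M j : fgR phi M -> (m0 <= j)%N -> Ext_vanishes A^o j M.
Proof.
move=> fM; move: j; apply: contrapT => badM.
have [||N [hN [Q [p [sp pE badQ]]]] maxN] := @rsub_max R A phi noethR M
  [set N : set M | lsub N /\ exists Q (p : {linear M -> Q}),
    [/\ surj p, forall x, p x = 0 <-> N x & ~ Good Q]] fM.
- by move=> X [/(lsub_rsub phi)].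
- exists [set 0]; split; first by split=> // a x y -> ->; rewrite scaler0 addr0.
  have [i iE] := id_linear M; exists M, i; split=> // x; first by exists x.
  by rewrite iE.
have fQ := fgR_quotient sp fM.
have goodQ Q' (p' : {linear Q -> Q'}) y : surj p' -> p' y = 0 -> y <> 0 -> Good Q'.
  move=> sp' p'y y0; apply: contrapT => badQ'; apply: y0.
  have [x xE] := sp y; rewrite -xE; apply/pE.
  have [pp ppE] := comp_linear p p'.
  apply: (maxN [set x | pp x = 0]); last by rewrite /= ppE xE.
    split; first exact: lsub_ker.
    exists Q', pp; split=> // z; have [u <-] := sp' z; have [v <-] := sp u.
    by exists v.
  by move=> v /pE /= pv; rewrite ppE pv linear0.
apply: (badQ); apply: good_finite_length => // x radx y; exists 1%N; rewrite expr1.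
apply: contrapT => xy; have [X XE] := mulphi_linear Q x; apply: badQ => j m0j.
have [[z z0 xz]|inj_x] := pselect (exists2 z : Q, z <> 0 & phi x *: z = 0).
  have [K [i [inj_i iE]]] := submodule_ex (lsub_im X).
  have [|f fE] := factor_inj (f := X) inj_i; first by move=> u; apply/iE; exists u.
  have sf : surj f.
    move=> k; have /iE[u uE] : exists k', i k' = i k by exists k.
    by exists u; apply: inj_i; rewrite fE.
  have [Q' [p' s]] := ses_of_inj inj_i; have [_ ex_i sp'] := s.
  apply: (Ext_vanishes_ext s).
    by apply: (goodQ K f z) => //; apply: inj_i; rewrite fE XE xz linear0.
  apply: (goodQ Q' p' (phi x *: y)) => //.
  by apply/ex_i/iE; exists y; rewrite XE.
have pF := @projective_row A 0.
have [g gE] := cst0_linear Q 'rV[A]_0; have [m mE] := pair_linear X g.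
have mE' u : m u = (phi x *: u, g u) by rewrite mE XE.
have [|N' [q s]] := @ses_of_inj A _ _ m.
  apply: linear_inj => u; rewrite mE' => -[xu _]; apply: contrapT => u0.
  by apply: inj_x; exists u.
have [_ ex_m sq] := s.
apply: (Ext_vanishes_nakayama fQ pF radx mE' s).
have [iQ iQE] := id_linear Q; have [inl inlE] := pair_linear iQ g.
have [f fE] := comp_linear inl q.
apply: (goodQ N' f (phi x *: y)) => //; last exact: leqW.
  move=> n; have [[u v] uE] := sq n; exists u; rewrite fE inlE iQE -uE gE.
  by congr (q (_, _)); apply/matrixP => ? [].
by rewrite fE inlE iQE; apply/ex_m; exists y; rewrite mE' !gE.
Qed.

End Bass.

Lemma dependent_choice (T : Type) (U : T -> Type) (P : forall t, U t -> Prop) :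
  (forall t, exists u, P t u) -> exists f : forall t, U t, forall t, P t (f t).
Proof. by move=> h; exists (fun t => projT1 (cid (h t))) => t; apply: (projT2 (cid (h t))). Qed.

(** * Construction of complete resolutions *)

Section GorensteinConstruction.
Context (B : pzRingType).
Implicit Types (G H K M P Q : lmodType B).

Lemma projective_regular : projective B^o.
Proof.
have [s sE] : exists s : {linear B^o -> 'rV[B]_1}, forall x, s x = const_mx (x : B).
  by apply: linear_ex => a x y; apply/rowP => i; rewrite !mxE.
have [r rE] : exists r : {linear 'rV[B]_1 -> B^o}, forall v, r v = v 0 0.
  by apply: linear_ex => a u v; rewrite !mxE.
by apply: (projective_retract (s := s) (r := r) _ (@projective_row B 1)) => x;
   rewrite rE sE mxE.
Qed.

(** The contractible complex with all terms [P * P] and differential [(x, y) |-> (y, 0)] has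
    cokernel [P]. *)
Lemma Gorenstein_of_projective P : projective P -> Gorenstein_projective P.
Proof.
move=> pP; have [d dE] : exists d : {linear (P * P)%type -> (P * P)%type},
    forall z, d z = (z.2, 0).
  have [s sE] := snd_linear P P; have [z zE] := cst0_linear (P * P)%type P.
  by have [d dE] := pair_linear s z; exists d => x; rewrite dE sE zE.
exists (fun=> (P * P)%type : lmodType B), (fun=> d); split.
- by move=> _; apply: projective_prod.
- move=> i [x y]; rewrite dE /=; split=> [[->]|[[u v]]]; first by exists (0, x); rewrite dE.
  by rewrite dE => -[_ <-].
- move=> Q _ i f; split=> [fd|[g gf] z]; last by rewrite -gf !dE linear0.
  have [z0 z0E] := cst0_linear P P; have [iP iPE] := id_linear P.
  have [inr inrE] := pair_linear z0 iP; have [fs fsE] := fst_linear P P.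
  have [a aE] := comp_linear fs inr; have [g gE] := comp_linear a f.
  exists g => -[x y]; rewrite gE aE fsE inrE z0E iPE dE /=.
  have -> : (x, y) = (0, y) + (x, 0) :> (P * P)%type.
    by congr (_, _); rewrite /= ?addr0 ?add0r.
  have <- : d (0, x) = (x, 0) by rewrite dE.
  by rewrite linearD fd addr0.
- have [s sE] := snd_linear P P; exists 0, s; split=> [[x y]|x]; last by exists (0, x); rewrite sE.
  rewrite sE /=; split=> [->|[[u v]]]; first by exists (0, x); rewrite dE.
  by rewrite dE => -[_ <-].
Qed.

Lemma Gproj_resolution_Gorenstein G : Gorenstein_projective G -> Gproj_resolution G 0.
Proof.
move=> gG; pose F (i : nat) : lmodType B := if i is 0%N then G else 'rV[B]_0.
have F0 (i : nat) : (0 < i)%N -> forall x : F i, x = 0.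
  by case: i => // i _ x; apply/matrixP => ? [].
have [d dE] := dependent_choice (fun i => cst0_linear (F i.+1) (F i)).
have [e eE] := id_linear G; exists F, d, e; split=> //.
- by case.
- move=> i y; rewrite dE; split=> // _; exists 0.
  by rewrite linear0 (F0 _ _ y).
- split=> [y|y]; last by exists y.
  by rewrite eE; split=> [->|[x <-]]; [exists 0; rewrite linear0 | rewrite dE].
Qed.

Lemma Gproj_resolution_splice n K G M (i : {linear K -> G}) (p : {linear G -> M}) :
  ses i p -> Gorenstein_projective G -> Gproj_resolution K n -> Gproj_resolution M n.+1.
Proof.
move=> [inj_i ex_i sp] gG [F [d [e [gF F0 ex [ex_e se]]]]].
have [ei eiE] := comp_linear e i.
pose F' (j : nat) : lmodType B := if j is j'.+1 then F j' else G.
pose d' (j : nat) : {linear F' j.+1 -> F' j} :=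
  match j return {linear F' j.+1 -> F' j} with 0%N => ei | j'.+1 => d j' end.
exists F', d', p; split.
- by case=> // j; apply: gF.
- by case=> // j; apply: F0.
- case=> [y|j]; last exact: ex.
  rewrite [d' _ _]eiE; split=> [|[x <-]].
    by rewrite -(linear0 i) => /inj_i/ex_e.
  by rewrite (_ : e _ = 0) ?linear0 //; apply/ex_e; exists x.
- split=> // y; split=> [/ex_i[k <-]|[x <-]].
    by have [x <-] := se k; exists x; rewrite [d' _ _]eiE.
  by rewrite [d' _ _]eiE; apply/ex_i; exists (e x).
Qed.

Lemma Gorenstein_matrix (X : int -> nat) (N : forall i, 'M[B]_(X (i + 1), X i))
    (k : int) H (p : {linear 'rV[B]_(X k) -> H}) :
  (forall i (v : 'rV_(X (i + 1))), v *m N i = 0 <-> exists w, v = w *m N (i + 1)) ->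
  (forall i (u : 'cV_(X (i + 1))), N (i + 1) *m u = 0 -> exists w, u = N i *m w) ->
  surj p -> (forall v, p v = 0 <-> exists w, v = w *m N k) ->
  Gorenstein_projective H.
Proof.
move=> rowN colN sp pE.
have [d dE] := dependent_choice (fun i => mulmxr_linear (N i)).
exists (fun i => 'rV[B]_(X i) : lmodType B), d; split.
- by move=> i; apply: projective_row.
- move=> i v; rewrite dE; split=> [/rowN[w ->]|[w <-]]; first by exists w; rewrite dE.
  by apply/rowN; exists w; rewrite dE.
- move=> Q pQ i f; split=> [fd|[g gE] y]; last first.
    by rewrite -gE !dE (_ : _ *m N i = 0) ?linear0 //; apply/rowN; exists y.
  have [||g gE] := Hom_exact_row (D := N (i + 1)) (D' := N i) (f := f) pQ.
  + by move=> u /colN.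
  + by move=> v; rewrite -dE.
  by exists g => x; rewrite dE gE.
- exists k, p; split=> // v; split=> [/pE[w ->]|[w <-]]; first by exists w; rewrite dE.
  by apply/pE; exists w; rewrite dE.
Qed.

(** Defined by cases so that it reduces on constructors, as the types of matrices indexed by [int]
    require when a complex is glued from two halves. *)
Definition succ_int (i : int) : int :=
  match i with Posz k => Posz k.+1 | Negz 0%N => Posz 0 | Negz k.+1 => Negz k end.

Lemma succ_intE i : i + 1 = succ_int i.
Proof.
case: i => [k|[|k]] //=; first by rewrite -PoszD addn1.
by rewrite !NegzE -addn1 PoszD opprD subrK.
Qed.

Lemma Gorenstein_matrix_succ (X : int -> nat) (N : forall i, 'M[B]_(X (succ_int i), X i))
    (k : int) H (p : {linear 'rV[B]_(X k) -> H}) :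
  (forall i (v : 'rV_(X (succ_int i))), v *m N i = 0 <-> exists w, v = w *m N (succ_int i)) ->
  (forall i (u : 'cV_(X (succ_int i))), N (succ_int i) *m u = 0 -> exists w, u = N i *m w) ->
  surj p -> (forall v, p v = 0 <-> exists w, v = w *m N k) ->
  Gorenstein_projective H.
Proof.
move=> rowN colN sp pE.
(* The cast is indexed by an arbitrary proof of [j = succ_int i], so that substituting for [j] turns
   it into the identity. *)
pose N' i j (e : j = succ_int i) : 'M[B]_(X j, X i) :=
  castmx (congr1 X (esym e), erefl) (N i).
have rowN' i j l (e : j = succ_int i) (e' : l = succ_int j) (v : 'rV_(X j)) :
    v *m N' i j e = 0 <-> exists w, v = w *m N' j l e'.
  by subst j; subst l; rewrite /N' !castmx_id; apply: rowN.
have colN' i j l (e : j = succ_int i) (e' : l = succ_int j) (u : 'cV_(X j)) :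
    N' j l e' *m u = 0 -> exists w, u = N' i j e *m w.
  by subst j; subst l; rewrite /N' !castmx_id; apply: colN.
have pE' j (e : j = succ_int k) v : p v = 0 <-> exists w, v = w *m N' k j e.
  by subst j; rewrite /N' castmx_id; apply: pE.
exact: (Gorenstein_matrix (N := fun i => N' i _ (succ_intE i))
  (fun i => rowN' _ _ _ _ _) (fun i => colN' _ _ _ _ _) sp (pE' _ (succ_intE k))).
Qed.

End GorensteinConstruction.

(** * Resolutions by matrices *)

Section MatrixSequence.
Context (A : pzRingType).

Context (rel : forall m n p, 'M[A]_(m, n) -> 'M[A]_(n, p) -> Prop).
Context (rel_ex : forall m n (E : 'M[A]_(m, n)), exists p (E' : 'M_(n, p)), rel E E').

(** The state carries the sizes with the matrix, so the column size of a term is the row size of the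
    next by computation. [b] starts two terms after [D], past the prescribed sizes [m] and [n]. *)
Lemma matrix_sequence_from m n (D : 'M[A]_(m, n)) :
  exists (b : nat -> nat) (F : 'M[A]_(n, b 0%N)) (E : forall j, 'M[A]_(b j, b j.+1)),
    [/\ rel D F, rel F (E 0%N) & forall j, rel (E j) (E j.+1)].
Proof.
pose nx m n (E : 'M[A]_(m, n)) := cid (rel_ex E).
pose nxE m n (E : 'M[A]_(m, n)) := cid (projT2 (nx m n E)).
pose st := {m : nat & {n : nat & 'M[A]_(m, n)}}.
pose step (s : st) : st := existT _ (projT1 (projT2 s))
  (existT _ (projT1 (nx _ _ (projT2 (projT2 s)))) (projT1 (nxE _ _ (projT2 (projT2 s))))).
pose s (j : nat) : st := iter j step (existT _ m (existT _ n D)).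
exists (fun j => projT1 (s j.+2)), (projT2 (projT2 (s 1%N))), (fun j => projT2 (projT2 (s j.+2))).
have sP j := projT2 (nxE _ _ (projT2 (projT2 (s j)))).
by split=> [||j]; [apply: (sP 0%N) | apply: (sP 1%N) | apply: (sP j.+2)].
Qed.

Lemma matrix_sequence m n (D : 'M[A]_(m, n)) (init : forall m n, 'M[A]_(m, n) -> Prop) :
  init m n D ->
  exists (a : nat -> nat) (E : forall j, 'M[A]_(a j, a j.+1)),
    init _ _ (E 0%N) /\ forall j, rel (E j) (E j.+1).
Proof.
move=> initD; have [b [F [E [DF FE EE]]]] := matrix_sequence_from D.
pose a j := match j with 0%N => m | 1%N => n | j.+2 => b j end.
pose E' (j : nat) : 'M[A]_(a j, a j.+1) :=
  match j return 'M[A]_(a j, a j.+1) with 0%N => D | 1%N => F | j.+2 => E j end.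
exists a, E'; split; first exact: initD.
by case=> [|[|j]]; [exact: DF | exact: FE | exact: EE].
Qed.

End MatrixSequence.

Section OppositeMatrix.
Context (A B : pzRingType).

(** Transposition reverses products once the entries are moved by an anti-isomorphism; columns over
    [A] then become rows over [B], which are left modules. *)
Definition op_mx (f : A -> B) m n (D : 'M[A]_(m, n)) : 'M[B]_(n, m) := (map_mx f D)^T.

Context (tau : A -> B) (tau' : B -> A).
Context (tauK : cancel tau tau') (tauK' : cancel tau' tau).
Context (tauD : {morph tau : x y / x + y}).
Context (tauM : forall x y, tau (x * y) = tau y * tau x).

Lemma anti0 : tau 0 = 0.
Proof. by apply: (addrI (tau 0)); rewrite -tauD !addr0. Qed.

Lemma op_mulmx m n p (D : 'M[A]_(m, n)) (E : 'M[A]_(n, p)) :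
  op_mx tau (D *m E) = op_mx tau E *m op_mx tau D.
Proof.
apply/matrixP => i j; rewrite !mxE (big_morph tau tauD anti0).
by apply: eq_bigr => k _; rewrite !mxE tauM.
Qed.

Lemma op_mx0 m n : op_mx tau (0 : 'M[A]_(m, n)) = 0.
Proof. by apply/matrixP => i j; rewrite !mxE anti0. Qed.

Lemma op_mx_ex m n (E : 'M[B]_(n, m)) : exists D : 'M[A]_(m, n), E = op_mx tau D.
Proof.
exists (\matrix_(i, j) tau' (E j i)); apply/matrixP => i j.
by rewrite !mxE tauK'.
Qed.

Lemma op_mx_inj m n : injective (@op_mx tau m n).
Proof.
move=> D E /matrixP DE; apply/matrixP => i j; have := DE j i.
by rewrite !mxE => /(can_inj tauK).
Qed.

Lemma op_row_exact p q r (D' : 'M[A]_(p, q)) (D : 'M[A]_(q, r)) :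
  (forall u : 'cV[A]_q, D' *m u = 0 <-> exists w, u = D *m w) ->
  forall v : 'rV[B]_q, v *m op_mx tau D' = 0 <-> exists w, v = w *m op_mx tau D.
Proof.
move=> ex v; have [u ->] := op_mx_ex v; rewrite -op_mulmx; split.
  rewrite -(op_mx0 p 1) => /op_mx_inj/ex[w ->]; exists (op_mx tau w).
  by rewrite op_mulmx.
move=> [w']; have [w ->] := op_mx_ex w'; rewrite -op_mulmx => /op_mx_inj uE.
by rewrite -(op_mx0 p 1); congr (op_mx tau _); apply/ex; exists w.
Qed.

Lemma op_col_exact p q r (D' : 'M[A]_(p, q)) (D : 'M[A]_(q, r)) :
  (forall v : 'rV[A]_q, v *m D = 0 -> exists w, v = w *m D') ->
  forall u : 'cV[B]_q, op_mx tau D *m u = 0 -> exists w, u = op_mx tau D' *m w.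
Proof.
move=> ex u; have [v ->] := op_mx_ex u; rewrite -op_mulmx -(op_mx0 1 r).
move=> /op_mx_inj/ex[w ->]; exists (op_mx tau w); by rewrite op_mulmx.
Qed.

End OppositeMatrix.

Section Generators.
Context (R : comPzRingType) (A : pzRingType) (phi : {rmorphism R -> A}).
Context (noethR : noetherian R).
Context (central : forall r a, phi r * a = a * phi r) (fgA : fgR phi A^o).

Lemma row_generators n (X : set 'rV[A]_n) : rsub phi X ->
  exists p (E : 'M[A]_(p, n)), (forall v, X v -> exists w, v = w *m E) /\
    forall i, X (row i E).
Proof.
move=> hX; have [t [tX tP]] := rsub_fg noethR (fgR_row fgA n) hX.
exists (size t), (\matrix_(i < size t) t`_i); split=> [v /tP|i]; last first.
  by rewrite rowK; apply: tX; apply: mem_nth.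
apply: (@rspan_sub R A phi _ t [set v | exists w, v = w *m _]).
  split=> [|r _ _ [u ->] [w ->]]; first by exists 0; rewrite mul0mx.
  by exists (phi r *: u + w); rewrite mulmxDl scalemxAl.
move=> y yt; have lt_y : (index y t < size t)%N by rewrite index_mem.
by exists (delta_mx 0 (Ordinal lt_y)); rewrite -rowE rowK nth_index.
Qed.

Lemma mulmx_central m n p (E : 'M[A]_(m, n)) (u : 'M[A]_(n, p)) r :
  E *m (phi r *: u) = phi r *: (E *m u).
Proof.
apply/matrixP => i j; rewrite !mxE mulr_sumr; apply: eq_bigr => k _.
by rewrite mxE !mulrA central.
Qed.

Lemma fgR_col n : fgR phi 'cV[A]_n.
Proof.
have [f fE] : exists f : {linear 'rV[A]_n -> 'cV[A]_n}, forall v, f v = v^T.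
  by apply: linear_ex => a u v; apply/matrixP => i j; rewrite !mxE.
by apply: (fgR_quotient (p := f) _ (fgR_row fgA n)) => u; exists u^T; rewrite fE trmxK.
Qed.

(** Columns form a right module here, although ['cV[A]_n] carries a left action. Generators over the
    central image of [R] also generate for the right action. *)
Lemma col_generators n (X : set 'cV[A]_n) : rsub phi X ->
  exists p (E : 'M[A]_(n, p)), (forall u, X u -> exists w, u = E *m w) /\
    forall i, X (col i E).
Proof.
move=> hX; have [t [tX tP]] := rsub_fg noethR (fgR_col n) hX.
pose E : 'M[A]_(n, size t) := \matrix_(i, j) t`_j i 0.
have colt j : col j E = t`_j.
  by apply/matrixP => i k; rewrite !mxE ord1.
exists (size t), E; split=> [v /tP|i]; last by rewrite colt; apply: tX; apply: mem_nth.
apply: (@rspan_sub R A phi _ t [set v | exists w, v = E *m w]).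
  split=> [|r _ _ [u ->] [w ->]]; first by exists 0; rewrite mulmx0.
  by exists (phi r *: u + w); rewrite mulmxDr mulmx_central.
move=> y yt; have lt_y : (index y t < size t)%N by rewrite index_mem.
by exists (delta_mx (Ordinal lt_y) 0); rewrite -colE colt nth_index.
Qed.

Lemma row_kernel m n (E : 'M[A]_(m, n)) : exists p (S : 'M[A]_(p, m)),
  forall v : 'rV[A]_m, v *m E = 0 <-> exists w, v = w *m S.
Proof.
have [|p [S [SP rowS]]] := @row_generators m [set v | v *m E = 0].
  split=> [|r u v uE vE] /=; first by rewrite mul0mx.
  by rewrite mulmxDl -scalemxAl uE vE scaler0 addr0.
exists p, S => v; split=> [/SP //|[w ->]]; rewrite -mulmxA.
suff -> : S *m E = 0 by rewrite mulmx0.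
by apply/row_matrixP => i; rewrite row_mul rowS row0.
Qed.

Lemma col_kernel m n (E : 'M[A]_(m, n)) : exists p (S : 'M[A]_(n, p)),
  forall u : 'cV[A]_n, E *m u = 0 <-> exists w, u = S *m w.
Proof.
have [|p [S [SP colS]]] := @col_generators n [set u | E *m u = 0].
  split=> [|r u v uE vE] /=; first by rewrite mulmx0.
  by rewrite mulmxDr mulmx_central uE vE scaler0 addr0.
exists p, S => v; split=> [/SP //|[w ->]]; rewrite mulmxA.
suff -> : E *m S = 0 by rewrite mul0mx.
apply/matrixP => i j; have /= /matrixP/(_ i 0) := colS j; rewrite !mxE => E0.
by rewrite -[RHS]E0; apply: eq_bigr => k _; rewrite mxE.
Qed.

End Generators.

Section Cokernels.
Context (A : pzRingType).
Implicit Types (Q Y : lmodType A).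

Definition Ext_vanishes_coker Y j m n (D : 'M[A]_(m, n)) : Prop :=
  forall Q (q : {linear 'rV[A]_n -> Q}), surj q ->
    (forall v, q v = 0 <-> exists w, v = w *m D) -> Ext_vanishes Y j Q.

Lemma coker_exists m n (D : 'M[A]_(m, n)) : exists Q (q : {linear 'rV[A]_n -> Q}),
  surj q /\ forall v, q v = 0 <-> exists w, v = w *m D.
Proof.
have [f fE] := mulmxr_linear D; have [Q [q [sq qE]]] := quotient_ex (lsub_im f).
exists Q, q; split=> // v; rewrite qE /=; split=> [[w <-]|[w ->]]; exists w; by rewrite fE.
Qed.

Context (m n p : nat) (D' : 'M[A]_(m, n)) (D : 'M[A]_(n, p)).
Context (exD : forall v : 'rV[A]_n, v *m D = 0 <-> exists w, v = w *m D').

Lemma coker_ses Q' (q' : {linear 'rV[A]_n -> Q'}) Q (q : {linear 'rV[A]_p -> Q}) :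
  surj q' -> (forall v, q' v = 0 <-> exists w, v = w *m D') ->
  surj q -> (forall v, q v = 0 <-> exists w, v = w *m D) ->
  exists2 i : {linear Q' -> 'rV[A]_p}, ses i q & forall v, i (q' v) = v *m D.
Proof.
move=> sq' q'E sq qE; have [f fE] := mulmxr_linear D.
have [|i iE] := factor_surj (f := f) sq'.
  by move=> v /q'E/exD; rewrite fE.
exists i => [|v]; last by rewrite iE fE.
split=> // [|v].
- apply: linear_inj => x; have [v <-] := sq' x; rewrite iE fE => /exD vD.
  exact/q'E.
- split=> [/qE[w ->]|[x <-]]; first by exists (q' w); rewrite iE fE.
  by have [w <-] := sq' x; apply/qE; exists w; rewrite iE fE.
Qed.

Lemma Ext_vanishes_coker_shift Y j : Ext_vanishes_coker Y j.+1 D -> Ext_vanishes_coker Y j D'.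
Proof.
move=> hD Q' q' sq' q'E; have [Q [q [sq qE]]] := coker_exists D.
have [i s _] := coker_ses sq' q'E sq qE.
apply: (Ext_vanishes_left s); first exact/Ext_vanishes_projective/projective_row.
exact: hD sq qE.
Qed.

(** A column killed by [D'] is a map to [A] from the cokernel of [D'], which is a syzygy of the
    cokernel of [D]. Vanishing of Ext^1 extends it to all rows of length [p], where it is given by a
    column [w]. *)
Lemma Ext_vanishes_coker_existsact : Ext_vanishes_coker A^o 0 D ->
  forall u : 'cV[A]_n, D' *m u = 0 -> exists w, u = D *m w.
Proof.
move=> hD u D'u; have [Q [q [sq qE]]] := coker_exists D.
have [Q' [q' [sq' q'E]]] := coker_exists D'.
have [i s iE] := coker_ses sq' q'E sq qE.
have [f fE] : exists f : {linear 'rV[A]_n -> A^o}, forall v, f v = (v *m u) 0 0.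
  by apply: linear_ex => a x y; rewrite mulmxDl -scalemxAl !mxE.
have [|g gE] := factor_surj (f := f) sq'.
  by move=> v /q'E[w ->]; rewrite fE -mulmxA D'u mulmx0 mxE.
have [h hE] := hD _ _ sq qE _ _ _ _ s g.
exists (\col_k (h (delta_mx 0 k) : A)); apply/matrixP => k l; rewrite ord1.
have -> : u k 0 = h (delta_mx 0 k *m D).
  by rewrite -iE hE gE fE -rowE mxE.
rewrite linear_row mxE; apply: eq_bigr => r _.
by rewrite -rowE !mxE.
Qed.

End Cokernels.

Section OneSide.
Context (R : comPzRingType) (A : pzRingType) (phi : {rmorphism R -> A}).
Context (noethR : noetherian R) (slR : semilocal R).
Context (central : forall r a, phi r * a = a * phi r) (fgA : fgR phi A^o).
Context (B : pzRingType) (tau : A -> B) (tau' : B -> A).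
Context (tauK : cancel tau tau') (tauK' : cancel tau' tau).
Context (tauD : {morph tau : x y / x + y}).
Context (tauM : forall x y, tau (x * y) = tau y * tau x).
Context (M : lmodType A) (iM : {linear M -> A^o}) (inj_iM : injective iM).
Context (iME : forall a : A^o, a \in @jacobson A <-> exists x, iM x = a).
Context (N : lmodType B) (iN : {linear N -> B^o}) (inj_iN : injective iN).
Context (iNE : forall a : A, (a : A^o) \in @jacobson A <-> exists x, iN x = tau a).

(** A free resolution of the right module A/J, written in columns. *)
Lemma jacobson_columns : exists (a : nat -> nat) (D : forall j, 'M[A]_(a j, a j.+1)),
  (a 0%N = 1%N /\ forall u : 'cV[A]_(a 0%N), (exists w, u = D 0%N *m w) <->
     forall i, (u i 0 : A^o) \in @jacobson A) /\
  forall j (u : 'cV[A]_(a j.+1)), D j *m u = 0 <-> exists w, u = D j.+1 *m w.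
Proof.
have [J0 linJ] := @jacobson_submod_closed A.
have [|p [D [DP colD]]] := @col_generators R A phi noethR central fgA 1
    [set u | (u 0 0 : A^o) \in @jacobson A].
  split=> [|r u v Ju Jv] /=; first by rewrite mxE.
  by rewrite !mxE; apply: linJ.
apply: (@matrix_sequence A (fun m n p E E' => forall u : 'cV[A]_n,
  E *m u = 0 <-> exists w, u = E' *m w) _ 1 p D (fun m n D => m = 1%N /\
  forall u : 'cV[A]_m, (exists w, u = D *m w) <->
     forall i, (u i 0 : A^o) \in @jacobson A)).
  by move=> m n E; apply: (col_kernel noethR central fgA).
split=> // u; split=> [[w ->] i|Ju]; last exact/DP/Ju.
rewrite ord1 mxE; apply: (big_ind (fun x : A => (x : A^o) \in @jacobson A)) => // [x y Jx Jy|k _].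
  by have := linJ 1 _ _ Jx Jy; rewrite scale1r.
by apply: jacobson_mulr; have := colD k; rewrite /= mxE.
Qed.

Lemma Gproj_resolution_opposite n : Gproj_resolution M n -> Gproj_resolution N n.
Proof.
move=> resM; pose m := n.+1.
have [T [pT sT']] := ses_of_inj inj_iM; have [_ ex_T sT] := sT'.
have pTE (a : A^o) : pT a = 0 <-> a \in @jacobson A by rewrite iME; apply: ex_T.
have aT : approx m T.
  apply: approx_step sT' _ (approx_resolution resM).
  exact/coresolved_projective/projective_regular.
have ET j : (m <= j)%N -> Ext_vanishes A^o j T.
  case: j => // j le_nj; apply: (Ext_vanishes_right sT').
    exact: Ext_vanishes_Gproj_resolution (@projective_regular A) resM le_nj.
  exact/Ext_vanishes_projective/projective_regular.
have [a [D [[a0 D0] colD]]] := jacobson_columns.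
have DD j : D j *m D j.+1 = 0.
  apply/matrixP => i k.
  have : D j *m (D j.+1 *m delta_mx k 0 : 'cV_ _) = 0 by apply/colD; exists (delta_mx k 0).
  by rewrite mulmxA -colE => /matrixP/(_ i 0); rewrite !mxE.
have rowD i (v : 'rV[A]_(a i.+1)) : (m <= i)%N ->
    v *m D i.+1 = 0 <-> exists w, v = w *m D i.
  move=> le_mi; split=> [|[w ->]]; last by rewrite -mulmxA DD mulmx0.
  (* Padding with an empty matrix raises the index by one, so that the strict bound of [row_exact]
     gives exactness already at [i = m]. *)
  pose p j := if j is j'.+1 then a j' else 0%N.
  pose C (j : nat) : 'M[A]_(p j, p j.+1) :=
    match j return 'M[A]_(p j, p j.+1) with 0%N => 0 | j'.+1 => D j' end.
  apply: (@row_exact R A phi noethR slR central fgA m T pT p C sT pTE aT _ _ i.+1) => //.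
    by case=> [|j]; [rewrite /C mul0mx | apply: DD].
  by move=> j u /colD.
have finj X j : fgR phi X -> (m <= j)%N -> Ext_vanishes A^o j X.
  exact: (finite_injective_dimension noethR slR central fgA sT pTE ET).
(* From [m] on, the cokernel of [D q] is a [k]-th syzygy of that of [D (q + k)]; shifting far enough
   gives vanishing in every positive degree. *)
have cokD k : forall q j, (m <= q)%N -> (m <= j + k)%N -> Ext_vanishes_coker A^o j (D q).
  elim: k => [|k IHk] q j mq mjk.
    rewrite addn0 in mjk => Q q' sq' _; apply: finj => //.
    exact: fgR_quotient sq' (fgR_row fgA _).
  apply: (Ext_vanishes_coker_shift (fun v => rowD _ v mq)).
  by apply: IHk; [apply: leqW | rewrite addSnnS].
(* This resolves the left module of rows killed by [D m]. Such a resolution grows to the left, hence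
   the transposes. *)
have [|b [F [E [DF FE EE]]]] := @matrix_sequence_from A
    (fun m n p E E' => forall v : 'rV[A]_n, v *m E^T = 0 <-> exists w : 'rV_p, v = w *m E'^T)
    _ _ _ (D m)^T.
  move=> q r E; have [s [S SE]] := row_kernel noethR fgA E^T.
  by exists s, S^T => v; rewrite trmxK.
rewrite trmxK in DF.
have cokF j : Ext_vanishes_coker A^o j F^T.
  by apply: (Ext_vanishes_coker_shift DF); apply: (cokD m); rewrite // leq_addl.
have cokE k j : Ext_vanishes_coker A^o j (E k)^T.
  elim: k j => [|k IHk] j; first exact: (Ext_vanishes_coker_shift FE).
  exact: (Ext_vanishes_coker_shift (EE k)).
have colDF (u : 'cV[A]_(a m)) : F^T *m u = 0 <-> exists w, u = D m *m w.
  split; first by apply: (Ext_vanishes_coker_existsact DF); apply: (cokD m).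
  move=> [w ->]; rewrite mulmxA (_ : F^T *m D m = 0) ?mul0mx //.
  apply/row_matrixP => i; rewrite row0 row_mul; apply/DF; exists (delta_mx 0 i).
  exact: rowE.
have colFE (u : 'cV[A]_(b 0%N)) : (E 0%N)^T *m u = 0 <-> exists w, u = F^T *m w.
  split; first by apply: (Ext_vanishes_coker_existsact FE).
  move=> [w ->]; rewrite mulmxA (_ : _ *m F^T = 0) ?mul0mx //.
  apply/row_matrixP => i; rewrite row0 row_mul; apply/FE; exists (delta_mx 0 i).
  exact: rowE.
have colEE k (u : 'cV[A]_(b k.+1)) : (E k.+1)^T *m u = 0 <-> exists w, u = (E k)^T *m w.
  split; first by apply: (Ext_vanishes_coker_existsact (EE k)).
  move=> [w ->]; rewrite mulmxA (_ : _ *m (E k)^T = 0) ?mul0mx //.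
  apply/row_matrixP => i; rewrite row0 row_mul; apply/EE; exists (delta_mx 0 i).
  exact: rowE.
pose op p q := @op_mx A B tau p q.
have opR := op_row_exact tauK tauK' tauD tauM.
have opC := op_col_exact tauK tauK' tauD tauM.
(* The opposite of the dual complex from [D m] on, continued in negative degrees by the opposite of
   the resolution just chosen; [F] is the joint. *)
pose X (i : int) : nat := match i with Posz k => a (k + m)%N | Negz k => b k end.
pose G (i : int) : 'M[B]_(X (succ_int i), X i) :=
  match i return 'M[B]_(X (succ_int i), X i) with
  | Posz k => op _ _ (D (k + m)%N)
  | Negz k => match k return 'M[B]_(X (succ_int (Negz k)), X (Negz k)) with
              | 0%N => op _ _ F^T
              | k'.+1 => op _ _ (E k')^T
              end
  end.
(* Since [m = n + 1], the image of [D n] is the cokernel of [D m], the differential of the glued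
   complex in degree 0. *)
have gorK (K : lmodType B) (i : {linear K -> 'rV[B]_(a n)}) : injective i ->
    (forall x, (exists k, i k = x) <-> exists w, x = w *m op _ _ (D n)) ->
    Gorenstein_projective K.
  move=> inj_i iE; have [f fE] := mulmxr_linear (op _ _ (D n)).
  have [|p pE] := factor_inj (f := f) inj_i.
    by move=> x; apply/iE; exists x; rewrite fE.
  apply: (@Gorenstein_matrix_succ B X G 0 K p).
  - move=> [k|[|[|k]]] v; [exact: opR (@colD _) v|exact: opR colDF v|exact: opR colFE v|].
    exact: opR (@colEE _) v.
  - move=> [k|[|[|k]]] u.
    + by apply: (opC _ _ _ (D (k + m)%N) (D (k + m).+1)) => v /rowD; apply; apply: leq_addl.
    + by apply: opC => v /DF.
    + by apply: opC => v /FE.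
    + by apply: opC => v /EE.
  - move=> x; have /iE[w wE] : exists k, i k = i x by exists x.
    by exists w; apply: inj_i; rewrite pE fE wE.
  - move=> v; rewrite -(opR _ _ _ _ _ (colD n) v) -fE -pE; split=> [->|pv].
      by rewrite linear0.
    by apply: inj_i; rewrite pv linear0.
(* The image of [D q] is the [q]-th syzygy of J, so [k = n - q] free terms separate it from the
   Gorenstein projective one. *)
have resK k : forall q, (q + k)%N = n -> forall (K : lmodType B)
    (i : {linear K -> 'rV[B]_(a q)}), injective i ->
    (forall x, (exists k, i k = x) <-> exists w, x = w *m op _ _ (D q)) ->
    Gproj_resolution K k.
  elim: k => [|k IHk] q qk K i inj_i iE.
    rewrite addn0 in qk; subst q.
    exact/Gproj_resolution_Gorenstein/(gorK K i).
  have [f fE] := mulmxr_linear (op _ _ (D q)).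
  have [|p pE] := factor_inj (f := f) inj_i.
    by move=> x; apply/iE; exists x; rewrite fE.
  have sp : surj p.
    move=> x; have /iE[w wE] : exists k, i k = i x by exists x.
    by exists w; apply: inj_i; rewrite pE fE wE.
  have [K' [i' s]] := ses_of_surj sp; have [inj_i' ex_i' _] := s.
  apply: (Gproj_resolution_splice s (Gorenstein_of_projective (@projective_row B _))).
  apply: (IHk q.+1 _ K' i' inj_i'); first by rewrite addSnnS.
  move=> x; rewrite -(opR _ _ _ _ _ (colD q) x) -fE -pE -ex_i'; split=> [->|px].
    by rewrite linear0.
  by apply: inj_i; rewrite px linear0.
have [i iE] : exists i : {linear N -> 'rV[B]_(a 0%N)}, forall x, i x = const_mx (iN x : B).
  by apply: linear_ex => c x y; apply/rowP => l; rewrite !mxE linearP.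
have l0 : 'I_(a 0%N) by rewrite a0; exact: ord0.
have l0E (l : 'I_(a 0%N)) : l = l0.
  by apply: val_inj; case: (l) (l0) => [x hx] [y hy] /=; move: hx hy; rewrite a0; case: x; case: y.
apply: (resK n 0%N _ N i) => // [x y|x].
  by rewrite !iE => /rowP/(_ l0); rewrite !mxE => /inj_iN.
have [u ->] := op_mx_ex tauK' x; split.
  move=> [k]; rewrite iE => /rowP kE.
  have /D0[w ->] : forall l, (u l 0 : A^o) \in @jacobson A.
    by move=> l; apply/iNE; exists k; have := kE l; rewrite !mxE.
  by exists (op_mx tau w); rewrite -op_mulmx.
move=> [w']; have [w ->] := op_mx_ex tauK' w'; rewrite -op_mulmx //.
move=> /(op_mx_inj tauK) uE.
have /D0/(_ l0)/iNE[k kE] : exists w, u = D 0%N *m w by exists w.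
by exists k; rewrite iE; apply/rowP => l; rewrite !mxE kE (l0E l).
Qed.

End OneSide.

(** * Passage to the opposite algebra *)

Section Conversion.
Context (R : comPzRingType) (A : pzRingType) (phi : {rmorphism R -> A}).

Lemma noether_algebra_fgR : noether_algebra_over phi -> fgR phi A^o.
Proof.
move=> [_ _ [n [v vP]]]; exists [seq v i | i <- enum 'I_n] => a.
have [c ->] := vP a; have hS := rspan_rsub phi [seq (v i : A^o) | i <- enum 'I_n].
apply: big_ind => [|x y|i _]; [by case: hS|exact: (rsubD hS)|].
apply: (@rsubZ R A phi A^o _ (c i) (v i) hS); apply: rspan_mem.
by apply: map_f; rewrite mem_enum.
Qed.

Lemma noether_algebra_converse : noether_algebra_over phi ->
  exists psi : {rmorphism R -> A^c}, noether_algebra_over psi.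
Proof.
move=> [noethR central [n [v vP]]].
have zm : zmod_morphism (phi : R -> A^c) by move=> x y; rewrite rmorphB.
have mm : monoid_morphism (phi : R -> A^c).
  by split=> [|x y]; [rewrite rmorph1 | rewrite mulrC rmorphM].
pose psi : {rmorphism R -> A^c} := HB.pack (phi : R -> A^c)
  (GRing.isZmodMorphism.Build R A^c phi zm) (GRing.isMonoidMorphism.Build R A^c phi mm).
exists psi; split=> // [r a|]; first by have := central r a.
exists n, v => a; have [c cE] := vP a; exists c.
by rewrite cE; apply: eq_bigr => i _; rewrite central.
Qed.

End Conversion.

Lemma semilocal_noether_algebra_converse (A : pzRingType) :
  semilocal_noether_algebra A -> semilocal_noether_algebra A^c.
Proof.
move=> [R [phi [hA slR]]]; have [psi hpsi] := noether_algebra_converse hA.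
by exists R, psi.
Qed.

Section JacobsonOpposite.
Context (A B : pzRingType) (tau : A -> B) (tau' : B -> A).
Context (tauK : cancel tau tau') (tauK' : cancel tau' tau).
Context (tauD : {morph tau : x y / x + y}).
Context (tauM : forall x y, tau (x * y) = tau y * tau x).

(** Left-right symmetry of the radical: for [y] in J, a left inverse [u] of [1 - y] equals
    [1 + u * y], so it is left invertible in turn and [1 - y] is a unit. Its image under [tau] is
    then left invertible and lies in no maximal left ideal. *)
Lemma jacobson_anti (x : A) : semilocal_noether_algebra A ->
  (x : A^o) \in @jacobson A -> (tau x : B^o) \in @jacobson B.
Proof.
move=> [R [phi [hA _]]] Jx; have noethR : noetherian R by case: hA.
have fgA := noether_algebra_fgR hA.
have tau1 : tau 1 = 1.
  by rewrite -[LHS]mulr1 -[in LHS](tauK' 1) -tauM mulr1.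
have [J0 linJ] := @jacobson_submod_closed A.
apply/jacobsonP => I mI; apply: contrapT => /negP nIx.
have [b] := maximal_inv mI nIx; rewrite -(tauK' b) -tauM.
set y := x * tau' b => Iy.
have Jy : (y : A^o) \in @jacobson A by apply: jacobson_mulr.
have [u uE] := jacobson_left_inv noethR fgA Jy.
have Ju : (- (u * y) : A^o) \in @jacobson A.
  by have := linJ (- u) _ _ Jy J0; rewrite addr0 -[_ *: _]/(- u * y) mulNr.
have [u' u'E] := jacobson_left_inv noethR fgA Ju.
have u'u : u' * u = 1.
  rewrite -[RHS]u'E; congr (u' * _); rewrite opprK -[X in X + _]uE.
  by rewrite mulrBr mulr1 subrK.
have yu : (1 - y) * u = 1.
  by rewrite -[1 - y]mul1r -[in X in X * _ * _]u'u -[u' * u * _]mulrA uE mulr1.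
case/negP: (maximal_proper mI).
have -> : (1 : B^o) = tau u *: (1 - tau y : B^o) + 0.
  have tauN : tau (1 - y) = 1 - tau y.
    by apply/eqP; rewrite eq_sym subr_eq -tauD subrK tau1.
  by rewrite addr0 -[RHS]/(tau u * (1 - tau y)) -tauN -tauM yu tau1.
by have [[I0 linI] _ _] := mI; apply: linI.
Qed.

End JacobsonOpposite.

Lemma jacobson_val (A : pzRingType) :
  exists i : {linear jacobson_left A -> A^o}, injective i /\
    forall a : A^o, a \in @jacobson A <-> exists x, i x = a.
Proof.
have [i iE] : exists i : {linear jacobson_left A -> A^o}, forall x, i x = val x.
  by apply: linear_ex => a x y.
exists i; split=> [x y|a]; first by rewrite !iE => /val_inj.
by split=> [Ja|[x <-]]; [exists (Sub a Ja); rewrite iE | rewrite iE; case: x].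
Qed.

Lemma jacobson_op_val (A : pzRingType) :
  exists i : {linear jacobson_right A -> A^c^o}, injective i /\
    forall a : A^o, a \in @jacobson A <-> exists x, i x = a.
Proof.
have [i iE] : exists i : {linear jacobson_right A -> A^c^o}, forall x, i x = val x.
  by apply: linear_ex => a x y.
exists i; split=> [x y|a]; first by rewrite !iE => /val_inj.
by split=> [Ja|[x <-]]; [exists (Sub a Ja); rewrite iE | rewrite iE; case: x].
Qed.

Lemma Gproj_dim_eq (A B : pzRingType) (M : lmodType A) (N : lmodType B) :
  (forall n, Gproj_resolution M n <-> Gproj_resolution N n) -> Gproj_dim M = Gproj_dim N.
Proof.
move=> MN; rewrite /Gproj_dim; case: pselect => [exM|nM]; case: pselect => [exN|nN] //.
- congr Some; case: ex_minnP => m /asboolP/MN Nm minm.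
  case: ex_minnP => l /asboolP/MN Ml minl; apply/eqP; rewrite eqn_leq.
  by rewrite minm ?minl //; apply/asboolP => //; apply/MN.
- by case: nN; have [n /MN] := exM; exists n.
- by case: nM; have [n /MN] := exN; exists n.
Qed.

Theorem corollary3p5 (A : pzRingType) (hA : semilocal_noether_algebra A) :
  Gproj_dim (jacobson_left A) = Gproj_dim (jacobson_right A).
Proof.
have hAc := semilocal_noether_algebra_converse hA.
have [i [inj_i iE]] := jacobson_val A; have [j [inj_j jE]] := jacobson_op_val A.
have JE (a : A) : ((a : A^c) : A^c^o) \in @jacobson A^c <-> (a : A^o) \in @jacobson A.
  split.
    exact: (@jacobson_anti A^c A id id _ _ _ a hAc).
  exact: (@jacobson_anti A A^c id id _ _ _ a hA).
apply: Gproj_dim_eq => n; split.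
  have [R [phi [[noethR central fg] slR]]] := hA.
  have fgA := noether_algebra_fgR (And3 noethR central fg).
  by apply: (@Gproj_resolution_opposite R A phi noethR slR central fgA A^c id id
    _ _ _ _ _ i inj_i iE _ j inj_j).
(* For the reverse direction [A] itself serves as the opposite of [A^c], the identity being the
   anti-isomorphism both ways. *)
have [R [phi [[noethR central fg] slR]]] := hAc.
have fgA := noether_algebra_fgR (And3 noethR central fg).
apply: (@Gproj_resolution_opposite R A^c phi noethR slR central fgA A id id
    _ _ _ _ _ j inj_j _ _ i inj_i) => // a; first by rewrite JE.
by rewrite JE.
Qed.
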